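(* Let $k\ge3$, $\ell\ge k-1$ be integers. The following inf-sup condition holds: $$|v_h|_{2,h}\lesssim\sup_{\boldsymbol\tau_h\in\boldsymbol\Sigma_h,\ \boldsymbol\tau_h\ne0}\frac{(\operatorname{div}\operatorname{div}\boldsymbol\tau_h,v_h)}{\|\boldsymbol\tau_h\|_0}\qquad\forall\,v_h\in\mathcal Q_h.$$
   Context: $\Omega\subset\mathbb R^2$ is a bounded polygon, $\{\mathcal T_h\}$ a shape-regular family of conforming triangulations of $\Omega$ with edges $\mathcal E_h$ and interior edges $\mathcal E_h^i$; $h_e$ is the length of $e$; $\lesssim$ means $\le C\,\cdot$ with $C$ independent of the mesh size and of $v_h$. $\mathbb S$: symmetric real $2\times2$ matrices; $\operatorname{div}$ of a matrix is row-wise; $(\cdot,\cdot)$, $\|\cdot\|_0$ are the $L^2(\Omega)$ inner product and norm; $\mathbb P_m$: polynomials of total degree $\le m$. For $v\in L^2(\Omega)$ with $v|_K\in H^2(K)$ for all $K\in\mathcal T_h$, $$|v|_{2,h}^2=\sum_{K\in\mathcal T_h}|v|_{2,K}^2+\sum_{e\in\mathcal E_h}\big(h_e^{-3}\|[\![v]\!]\|_{0,e}^2+h_e^{-1}\|[\![\partial_{n_e}v]\!]\|_{0,e}^2\big),$$ where $[\![v]\!]$, $[\![\partial_{n_e}v]\!]$ are the jumps across $e$ for $e\in\mathcal E_h^i$, and $[\![v]\!]=v$, $[\![\partial_{n_e}v]\!]=\partial_{n_e}v$ on boundary edges. Spaces: $\boldsymbol\Sigma_{\ell,k}(K)=\operatorname{sym}\operatorname{curl}\mathbb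 P_{\ell+1}(K;\mathbb R^2)\oplus\boldsymbol x\boldsymbol x^{\intercal}\mathbb P_{k-2}(K)$, where $\operatorname{curl}\phi=(\partial_{x_2}\phi,-\partial_{x_1}\phi)^{\intercal}$ is applied row-wise to vectors, $\operatorname{sym}A=(A+A^{\intercal})/2$, and $\boldsymbol x$ has its origin at a point of $K$. $\boldsymbol\Sigma_h$ is the set of $\boldsymbol\tau_h\in\boldsymbol L^2(\Omega;\mathbb S)$ with $\boldsymbol\tau_h|_K\in\boldsymbol\Sigma_{\ell,k}(K)$ for all $K\in\mathcal T_h$ such that the following are single-valued (equal from all elements sharing the vertex/edge): $\boldsymbol\tau_h(\delta)$ at vertices $\delta$; $(\boldsymbol n^{\intercal}\boldsymbol\tau_h\boldsymbol n,q)_e$, $q\in\mathbb P_{\ell-2}(e)$, and $(\partial_{t_e}(\boldsymbol t^{\intercal}\boldsymbol\tau_h\boldsymbol n)+\boldsymbol n_e^{\intercal}\operatorname{div}\boldsymbol\tau_h,q)_e$, $q\in\mathbb P_{\ell-1}(e)$, on edges $e$, where $\boldsymbol n_e=(n_1,n_2)^{\intercal}$ is a fixed unit normal of $e$, $\boldsymbol t_e=(-n_2,n_1)^{\intercal}$ (and $\boldsymbol n,\boldsymbol t$ may be taken as $\boldsymbol n_e,\boldsymbol t_e$). One has $\boldsymbol\Sigma_h\subset\{\boldsymbol\tau\in\boldsymbol L^2(\Omega;\mathbb S):\operatorname{div}\operatorname{div}\boldsymbol\tau\in L^2(\Omega)\}$. $\mathcal Q_h=\{q_h\in L^2(\Omega):q_h|_K\in\mathbb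 P_{k-2}(K)\ \forall K\in\mathcal T_h\}$. *)

(* Defs.v *)
From HB Require Import structures.
From mathcomp Require Import all_boot all_order all_algebra.
From mathcomp Require Import all_classical all_reals all_analysis.
Set Implicit Arguments.
Unset Strict Implicit.
Unset Printing Implicit Defensive.
Import Order.TTheory GRing.Theory Num.Theory.
Import numFieldNormedType.Exports.
Local Open Scope classical_set_scope.
Local Open Scope ring_scope.

(* The plane is R * R.  Its library norm is the max norm, hence the explicit
   Euclidean norm below; topology and boundedness do not depend on the choice. *)
Definition dotp (R : realType) (x y : R * R) : R := x.1 * y.1 + x.2 * y.2.
Definition enorm (R : realType) (x : R * R) : R := Num.sqrt (dotp x x).
Definition rot90 (R : realType) (x : R * R) : R * R := (- x.2, x.1).
Definition colvec (R : realType) (x : R * R) : 'cV[R]_2 :=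
  \col_i (if i == 0 then x.1 else x.2).
Definition basis_vec (R : realType) (i : 'I_2) : R * R :=
  if i == 0 then (1, 0) else (0, 1).

Definition hull (R : realType) (n : nat) (p : 'I_n -> R * R) (S : {set 'I_n}) :
    set (R * R) :=
  [set x | exists w : 'I_n -> R,
     [/\ forall i, 0 <= w i, \sum_(i in S) w i = 1 & x = \sum_(i in S) w i *: p i]].

Definition affine_free (R : realType) (n : nat) (p : 'I_n -> R * R)
    (S : {set 'I_n}) : Prop :=
  forall w : 'I_n -> R, \sum_(i in S) w i = 0 -> \sum_(i in S) w i *: p i = 0 ->
  forall i, i \in S -> w i = 0.

Definition segment (R : realType) (a b : R * R) : set (R * R) :=
  [set a + t *: (b - a) | t in `[0, 1]].

(* A polygonal domain, possibly multiply connected.  The condition on the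
   interior of the closure excludes slits and isolated boundary points. *)
Definition bounded_polygon (R : realType) (Omega : set (R * R)) : Prop :=
  [/\ Omega !=set0, open Omega, connected Omega, bounded_set Omega &
      (closure Omega)° = Omega /\
      exists s : seq ((R * R) * (R * R)),
        closure Omega `\` Omega = \bigcup_(ab in [set` s]) segment ab.1 ab.2].

(* Triangles and edges are sets of vertex indices.  The fixed unit normal n_e of
   every edge and the local origin of every triangle (which enters the shape
   function spaces) are arbitrary data carried along with the triangulation. *)
Record triangulation (R : realType) (Omega : set (R * R)) := Triangulation {
  nvert : nat;
  vert : 'I_nvert -> R * R;
  cells : {set {set 'I_nvert}};
  edge_normal : {set 'I_nvert} -> R * R;
  origin : {set 'I_nvert} -> R * R;
  card_cell : forall K : {set 'I_nvert}, K \in cells -> #|K| = 3%N;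
  cell_nondegenerate : forall K, K \in cells -> affine_free vert K;
  cells_cover : \bigcup_(K in [set` cells]) hull vert K = closure Omega;
  cells_conforming : forall K K', K \in cells -> K' \in cells ->
    hull vert K `&` hull vert K' = hull vert (K :&: K')%SET;
  edge_normal_unit : forall K e : {set 'I_nvert},
    K \in cells -> e \subset K -> #|e| = 2%N ->
    enorm (edge_normal e) = 1;
  edge_normal_orth : forall K e : {set 'I_nvert},
    K \in cells -> e \subset K -> #|e| = 2%N ->
    {in e &, forall i j, dotp (edge_normal e) (vert j - vert i) = 0};
  origin_in : forall K, K \in cells -> hull vert K (origin K)
}.

Definition cell (R : realType) (Omega : set (R * R)) (T : triangulation Omega)
    (K : {set 'I_(nvert T)}) : set (R * R) := hull (@vert _ _ T) K.

Definition edges (R : realType) (Omega : set (R * R)) (T : triangulation Omega) :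
    {set {set 'I_(nvert T)}} :=
  [set e : {set 'I_(nvert T)} |
     (#|e| == 2%N) && [exists K in cells T, e \subset K]]%SET.

Definition edge_tangent (R : realType) (Omega : set (R * R))
    (T : triangulation Omega) (e : {set 'I_(nvert T)}) : R * R :=
  rot90 (edge_normal e).

Definition endpoints (R : realType) (Omega : set (R * R)) (T : triangulation Omega)
    (e : {set 'I_(nvert T)}) : (R * R) * (R * R) :=
  let s := [seq vert i | i <- enum e] in (s`_0, s`_1).

Definition edge_length (R : realType) (Omega : set (R * R))
    (T : triangulation Omega) (e : {set 'I_(nvert T)}) : R :=
  enorm ((endpoints e).2 - (endpoints e).1).

Definition diam (R : realType) (A : set (R * R)) : R :=
  sup [set d | exists x y, [/\ A x, A y & d = enorm (x - y)]].

Definition indiam (R : realType) (A : set (R * R)) : R :=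
  sup [set d | exists c r, [/\ 0 <= r, [set x | enorm (x - c) <= r] `<=` A
                             & d = 2 * r]].

Definition shape_regular (R : realType) (Omega : set (R * R)) (I : Type)
    (Th : I -> triangulation Omega) : Prop :=
  exists sigma : R, forall i K, K \in cells (Th i) ->
    diam (cell K) <= sigma * indiam (cell K).

Definition leb2 (R : realType) :
    {measure set (measurableTypeR R * measurableTypeR R) -> \bar R} :=
  (@lebesgue_measure R \x @lebesgue_measure R)%E.

Definition cell_int (R : realType) (Omega : set (R * R)) (T : triangulation Omega)
    (K : {set 'I_(nvert T)}) (f : R * R -> R) : R :=
  (\int[leb2 R]_(x in cell K) f x)%R.

(* Arc-length integral over e. *)
Definition edge_int (R : realType) (Omega : set (R * R)) (T : triangulation Omega)
    (e : {set 'I_(nvert T)}) (f : R * R -> R) : R :=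
  let: (a, b) := endpoints e in
  edge_length e *
    (\int[@lebesgue_measure R]_(t in `[0, 1]) f (a + t *: (b - a)))%R.

(* Polynomials of total degree at most m.  Restricted to a line, they give the
   polynomials of degree at most m on an edge. *)
Definition Poly_le (R : realType) (m : nat) : set (R * R -> R) :=
  [set f | exists c : nat -> nat -> R, forall x,
     f x = \sum_(i < m.+1) \sum_(j < m.+1 | (i + j <= m)%N)
             c i j * x.1 ^+ i * x.2 ^+ j].

Definition pd (R : realType) (i : 'I_2) (f : R * R -> R) (x : R * R) : R :=
  'D_(basis_vec R i) f x.

Definition curl (R : realType) (phi : R * R -> R) (x : R * R) : 'cV[R]_2 :=
  colvec (pd 1 phi x, - pd 0 phi x).

Definition curl_rows (R : realType) (phi : 'I_2 -> R * R -> R) (x : R * R) :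
    'M[R]_2 := \matrix_(i, j) curl (phi i) x j 0.

Definition sym (R : realType) (A : 'M[R]_2) : 'M[R]_2 := 2^-1 *: (A + A^T).

Definition div_rows (R : realType) (tau : R * R -> 'M[R]_2) (x : R * R) :
    'cV[R]_2 := \col_i \sum_j pd j (fun y => tau y i j) x.

Definition divdiv (R : realType) (tau : R * R -> 'M[R]_2) (x : R * R) : R :=
  \sum_i pd i (fun y => div_rows tau y i 0) x.

Definition bilin (R : realType) (a : R * R) (A : 'M[R]_2) (b : R * R) : R :=
  ((colvec a)^T *m A *m colvec b) 0 0.

(* A function on Omega that is polynomial on every triangle is represented by the
   family of its polynomial pieces, indexed by the triangles; the trace of the
   function from inside K is then the piece of K itself.  Values of the family
   outside (cells T) are irrelevant. *)
Definition broken (R : realType) (Omega : set (R * R)) (T : triangulation Omega)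
    (V : Type) : Type := {set 'I_(nvert T)} -> R * R -> V.

Definition Sigma_loc (R : realType) (l k : nat) (x0 : R * R) :
    set (R * R -> 'M[R]_2) :=
  [set tau | exists (phi : 'I_2 -> R * R -> R) (p : R * R -> R),
     [/\ forall i, Poly_le l.+1 (phi i), Poly_le (k - 2) p &
         forall x, tau x = sym (curl_rows phi x) +
                           p x *: (colvec (x - x0) *m (colvec (x - x0))^T)]].

Definition Sigma_h (R : realType) (Omega : set (R * R)) (T : triangulation Omega)
    (l k : nat) : set (broken T 'M[R]_2) :=
  [set tau |
     [/\ forall K, K \in cells T -> Sigma_loc l k (origin K) (tau K),
         forall (d : 'I_(nvert T)) K K', K \in cells T -> K' \in cells T ->
           d \in K -> d \in K' -> tau K (vert d) = tau K' (vert d) &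
         forall e K K' : {set 'I_(nvert T)}, e \in edges T -> K \in cells T -> K' \in cells T ->
           e \subset K -> e \subset K' ->
           let n := edge_normal e in
           let t := edge_tangent e in
           let nn L x := bilin n (tau L x) n in
           let tn L x := 'D_t (fun y => bilin t (tau L y) n) x
                         + ((colvec n)^T *m div_rows (tau L) x) 0 0 in
           (forall q, Poly_le (l - 2) q ->
              edge_int e (fun x => nn K x * q x) =
              edge_int e (fun x => nn K' x * q x)) /\
           (forall q, Poly_le (l - 1) q ->
              edge_int e (fun x => tn K x * q x) =
              edge_int e (fun x => tn K' x * q x))]].

Definition Q_h (R : realType) (Omega : set (R * R)) (T : triangulation Omega)
    (k : nat) : set (broken T R) :=
  [set v | forall K, K \in cells T -> Poly_le (k - 2) (v K)].

(* An edge has two adjacent triangles if it is interior and one if it lies on the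
   boundary.  The order in the difference only affects the sign. *)
Definition jump (R : realType) (Omega : set (R * R)) (T : triangulation Omega)
    (v : broken T R) (e : {set 'I_(nvert T)}) (x : R * R) : R :=
  match enum [set K in cells T | e \subset K]%SET with
  | [:: K, K' & _] => v K x - v K' x
  | [:: K] => v K x
  | [::] => 0
  end.

Definition seminorm2h (R : realType) (Omega : set (R * R))
    (T : triangulation Omega) (v : broken T R) : R :=
  Num.sqrt
    (\sum_(K in cells T)
        cell_int K (fun x => \sum_i \sum_j (pd i (pd j (v K)) x) ^+ 2)
     + \sum_(e in edges T)
        (edge_length e ^- 3 * edge_int e (fun x => (jump v e x) ^+ 2)
         + (edge_length e)^-1 *
           edge_int e (fun x =>
             (jump (fun K => 'D_(edge_normal e) (v K)) e x) ^+ 2))).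

Definition L2norm (R : realType) (Omega : set (R * R)) (T : triangulation Omega)
    (tau : broken T 'M[R]_2) : R :=
  Num.sqrt (\sum_(K in cells T)
    cell_int K (fun x => \sum_i \sum_j (tau K x i j) ^+ 2)).

(* (div div tau, v).  For tau in Sigma_h, the distributional div div is square
   integrable, hence it is computed triangle by triangle. *)
Definition divdiv_form (R : realType) (Omega : set (R * R))
    (T : triangulation Omega) (tau : broken T 'M[R]_2) (v : broken T R) : R :=
  \sum_(K in cells T) cell_int K (fun x => divdiv (tau K) x * v K x).

Definition nonzero (R : realType) (Omega : set (R * R)) (T : triangulation Omega)
    (tau : broken T 'M[R]_2) : Prop :=
  exists K x, [/\ K \in cells T, cell K x & tau K x != 0].

(* Main.v *)
Require Import Defs.
From HB Require Import structures.
From mathcomp Require Import all_boot all_order all_algebra.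
From mathcomp Require Import all_classical all_reals all_analysis.
From mathcomp Require Import measurable_realfun.
From mathcomp Require Import zify ring lra.
Set Implicit Arguments.
Unset Strict Implicit.
Unset Printing Implicit Defensive.
Import Order.TTheory GRing.Theory Num.Theory.
Import numFieldNormedType.Exports.
Local Open Scope classical_set_scope.
Local Open Scope ring_scope.

(** On a triangle with edge vectors t_1, t_2, t_3 a symmetric matrix field is written
    \sum_j u_j t_j t_j^T.  Its divdiv is then \sum_j d_j^2 u_j, d_j being the derivative
    along t_j, so that in barycentric coordinates the pairing with v, and Green's formula,
    live on a fixed reference triangle.  The geometry of the actual triangle enters only
    through an affine change of variables and, on an edge e, through the scale and the
    slant of the opposite vertex: with f, g the reference traces, n^T tau n = a^2 f and
    the effective shear is a (g / 2 + c f'), a being the height over e.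

    The norm of v is bounded piecewise with three families of test fields, all of whose
    vertex values vanish and which are glued from contributions of single edges:
    interior bubbles control the second derivatives (by duality in finite dimension),
    fields whose only nonzero trace is the effective shear - h^-3 [v] control the jumps,
    and fields with n^T tau n = h^-1 x (1 - x) [d_n v] and vanishing shear control the
    jumps of the normal derivative.  The constants come from the reference triangle and,
    by shape regularity, from t_i . t_i <= C |det|; the remaining terms are absorbed by
    Young's inequality. *)

(** * Affine changes of variables *)

(** Degrees of freedom and unisolvence are bypassed. The test fields are explicit members of
    P_{k-1}(S) + x x^T P_{k-2}, and their traces from the two sides of an edge agree pointwise, so
    the moment conditions of all orders hold at once. Dyads t_j t_j^T suit this because n . t_j = 0
    on edge j: a coefficient made of the j-th edge bubble has no normal-normal trace on any edge.

    The obstacle is the top degree. A bubble field with coefficients of degree k - 1 has a divdiv of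
    degree k - 3 and cannot see the component of v orthogonal to P_{k-3}. That component is reached
    only through x x^T P_{k-2}: the divdiv of x x^T q reproduces the leading part of q up to a
    positive integer factor.

    The order of the estimates matters. Green's formula for the edge families leaves a pairing with
    the second derivatives of v, which can be absorbed because interior bubbles, having no edge
    terms, bound them beforehand. For the normal family the shear must be cancelled by a multiple of
    f' that depends on the slant, so the reference estimate is made explicit in that multiple, and
    shape regularity bounds it afterwards. *)

Lemma measurable_affine (R : realType) (a d : R) :
  measurable_fun [set: measurableTypeR R]
    ((fun y => a * y + d) : measurableTypeR R -> measurableTypeR R).
Proof.
apply: measurable_funD; last exact: measurable_cst.
by apply: measurable_funM; [exact: measurable_cst|exact: measurable_id].
Qed.

Lemma measurable_affine_fst (R : realType) (a b d : R) :
  measurable_fun [set: measurableTypeR R * measurableTypeR R]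
    ((fun z => (a * z.1 + (b * z.2 + d), z.2)) :
       measurableTypeR R * measurableTypeR R -> measurableTypeR R * measurableTypeR R).
Proof.
apply: measurable_fun_pair; last exact: measurable_snd.
apply: measurable_funD; first by apply: measurable_funM => //; exact: measurable_fst.
by apply: measurable_funD => //; apply: measurable_funM => //; exact: measurable_snd.
Qed.

Lemma measurable_affine_snd (R : realType) (a b d : R) :
  measurable_fun [set: measurableTypeR R * measurableTypeR R]
    ((fun z => (z.1, a * z.2 + (b * z.1 + d))) :
       measurableTypeR R * measurableTypeR R -> measurableTypeR R * measurableTypeR R).
Proof.
apply: measurable_fun_pair; first exact: measurable_fst.
apply: measurable_funD; first by apply: measurable_funM => //; exact: measurable_snd.
by apply: measurable_funD => //; apply: measurable_funM => //; exact: measurable_fst.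
Qed.

(** Lebesgue measure is characterised by its values on half-open intervals, so the image measure
    rescaled by |a| is compared with it there. A negative [a] yields an interval closed on the other
    side, of the same length. *)
Lemma lebesgue_measure_affine (R : realType) (a d : R) (A : set (measurableTypeR R)) :
  a != 0 -> measurable A ->
  (lebesgue_measure ((fun y : measurableTypeR R => a * y + d)%R @^-1` A) =
   `|a|^-1%:E * lebesgue_measure A)%E.
Proof.
move=> a0 mA.
pose f : measurableTypeR R -> measurableTypeR R := fun y => a * y + d.
rewrite -[X in lebesgue_measure (X @^-1` A)]/f.
have mf : measurable_fun [set: measurableTypeR R] f.
  exact: measurable_affine.
have na0 : 0 < `|a| by rewrite normr_gt0.
unshelve epose (m := (mscale (NngNum (ltW na0)) (pushforward (@lebesgue_measure R) f)
  : {measure set (measurableTypeR R) -> \bar R})).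
  exact: mf.
have mE B : m B = (`|a|%:E * lebesgue_measure (f @^-1` B))%E by [].
suff -> : lebesgue_measure A = m A.
  by rewrite mE muleA -EFinM mulVf ?mul1e // gt_eqF.
refine (@lebesgue_measure_unique R m _ A mA) => X /ocitvP[->|[[x y] /= xy ->]].
  by rewrite !measure0.
rewrite mE lebesgue_measure_itv /= lte_fin xy.
have [ap|an] := ltrP 0 a.
  have -> : f @^-1` `]x, y] =
            `](x - d) / a, (y - d) / a]%classic.
    apply/seteqP; split => z /=; rewrite !in_itv /= ltr_pdivrMr // ler_pdivlMr //;
      by rewrite ltrBlDr lerBrDr (mulrC z).
  rewrite lebesgue_measure_itv /= lte_fin ltr_pM2r ?invr_gt0 // ltrD2r xy.
  rewrite gtr0_norm // -!EFinB -EFinM; congr (_ %:E); field.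
  exact: lt0r_neq0.
have {}an : a < 0 by rewrite lt_neqAle a0.
have -> : f @^-1` `]x, y] =
          `[(y - d) / a, (x - d) / a[%classic.
  apply/seteqP; split => z /=; rewrite !in_itv /= ltr_ndivlMr // ler_ndivrMr //;
    by rewrite ltrBlDr lerBrDr (mulrC z) andbC.
rewrite lebesgue_measure_itv /= lte_fin ltr_nM2r ?invr_lt0 // ltrD2r xy.
rewrite ltr0_norm // -!EFinB -EFinM; congr (_ %:E); field.
exact: a0.
Qed.


(** On every vertical section the map is affine with the same factor [a]; only the translation
    depends on the section. *)
Lemma leb2_affine_snd (R : realType) (a b d : R)
    (E : set (measurableTypeR R * measurableTypeR R)) :
  a != 0 -> measurable E ->
  (leb2 R ((fun z => (z.1, a * z.2 + (b * z.1 + d))%R) @^-1` E) = `|a|^-1%:E * leb2 R E)%E.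
Proof.
move=> a0 mE; rewrite /leb2 /product_measure1 /=.
rewrite -ge0_integralZl//=; last exact: measurable_fun_xsection.
apply: eq_integral => x _ /=.
by rewrite -(@lebesgue_measure_affine _ _ (b * x + d)) //; exact: measurable_xsection.
Qed.

Lemma leb2_ysection (R : realType) (E : set (measurableTypeR R * measurableTypeR R)) :
  measurable E ->
  leb2 R E = (\int[@lebesgue_measure R]_y lebesgue_measure (ysection E y))%E.
Proof.
move=> mE; transitivity ((@lebesgue_measure R \x^ @lebesgue_measure R)%E E) => //.
by apply: product_measure_unique => //= A B mA mB; rewrite product_measure2E.
Qed.

Lemma leb2_affine_fst (R : realType) (a b d : R)
    (E : set (measurableTypeR R * measurableTypeR R)) :
  a != 0 -> measurable E ->
  (leb2 R ((fun z => (a * z.1 + (b * z.2 + d), z.2)%R) @^-1` E) = `|a|^-1%:E * leb2 R E)%E.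
Proof.
move=> a0 mE; rewrite !leb2_ysection //; last first.
  rewrite -[X in measurable X]setTI.
  by apply: (measurable_affine_fst a b d).
rewrite -ge0_integralZl//=; last exact: measurable_fun_ysection.
apply: eq_integral => y _ /=.
by rewrite -(@lebesgue_measure_affine _ _ (b * y + d)) //; exact: measurable_ysection.
Qed.

Definition affine_map (R : realType) (g h : R * R) (c d : R) (z : R * R) : R * R :=
  (g.1 * z.1 + g.2 * z.2 + c, h.1 * z.1 + h.2 * z.2 + d).

(** Gaussian elimination with pivot [g.1]: the map is one acting on the first coordinate followed by
    one acting on the second, with factors [g.1] and determinant over [g.1]. *)
Lemma leb2_affine_nz (R : realType) (g h : R * R) (c d : R)
    (E : set (measurableTypeR R * measurableTypeR R)) :
  g.1 != 0 -> g.1 * h.2 - g.2 * h.1 != 0 -> measurable E ->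
  (leb2 R (affine_map g h c d @^-1` E) =
   `|g.1 * h.2 - g.2 * h.1|^-1%:E * leb2 R E)%E.
Proof.
move=> g0 det0 mE.
have e0 : (g.1 * h.2 - g.2 * h.1) / g.1 != 0 by rewrite mulf_neq0 ?invr_eq0.
set e := (X in X != 0) in e0.
pose s (z : measurableTypeR R * measurableTypeR R) : measurableTypeR R * measurableTypeR R :=
  (z.1, e * z.2 + (h.1 / g.1 * z.1 + (d - h.1 / g.1 * c))).
have ms : measurable (s @^-1` E).
  by rewrite -[X in measurable X]setTI; by apply: (measurable_affine_snd _ _ _).
have aE : affine_map g h c d = s \o (fun z => (g.1 * z.1 + (g.2 * z.2 + c), z.2)).
  by apply/funext => -[x y]; rewrite /affine_map /s /e /=; congr pair; field.
rewrite aE comp_preimage.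
rewrite leb2_affine_fst // leb2_affine_snd // muleA -EFinM -invfM -normrM.
by congr ((`| _ |^-1)%:E * _)%E; rewrite /e; field.
Qed.

Lemma leb2_swap (R : realType) (E : set (measurableTypeR R * measurableTypeR R)) :
  measurable E -> leb2 R ((fun z : R * R => (z.2, z.1)) @^-1` E) = leb2 R E.
Proof.
by move=> mE; rewrite [RHS]leb2_ysection // /leb2 /product_measure1 /=.
Qed.

(** A zero pivot is avoided by exchanging the two coordinates of the image, which preserves area and
    changes the determinant by a sign. *)
Lemma leb2_affine (R : realType) (g h : R * R) (c d : R)
    (E : set (measurableTypeR R * measurableTypeR R)) :
  g.1 * h.2 - g.2 * h.1 != 0 -> measurable E ->
  (leb2 R (affine_map g h c d @^-1` E) =
   `|g.1 * h.2 - g.2 * h.1|^-1%:E * leb2 R E)%E.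
Proof.
move=> det0 mE; have [g0|g0] := eqVneq g.1 0; last exact: leb2_affine_nz.
have h0 : h.1 != 0 by apply: contraNneq det0 => h0; rewrite g0 h0 mul0r mulr0 subr0.
pose sw (z : measurableTypeR R * measurableTypeR R) : measurableTypeR R * measurableTypeR R :=
  (z.2, z.1).
have msw : measurable (sw @^-1` E).
  rewrite -[X in measurable X]setTI.
  have : measurable_fun setT sw by exact: measurable_swap.
  by apply.
have -> : affine_map g h c d @^-1` E = affine_map h g d c @^-1` (sw @^-1` E) by [].
have e : h.1 * g.2 - h.2 * g.1 = - (g.1 * h.2 - g.2 * h.1) by ring.
by rewrite leb2_affine_nz // e ?oppr_eq0 // normrN -(leb2_swap mE).
Qed.

Lemma measurable_affine_map (R : realType) (g h : R * R) (c d : R) :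
  measurable_fun [set: measurableTypeR R * measurableTypeR R]
    (affine_map g h c d :
       measurableTypeR R * measurableTypeR R -> measurableTypeR R * measurableTypeR R).
Proof.
apply: measurable_fun_pair; apply: measurable_funD => //; apply: measurable_funD;
  apply: measurable_funM => //; by [exact: measurable_fst|exact: measurable_snd].
Qed.

Lemma integral_affine (R : realType) (g h : R * R) (c d : R) (D : set (R * R))
    (f : R * R -> R) :
  g.1 * h.2 - g.2 * h.1 != 0 ->
  measurable (D : set (measurableTypeR R * measurableTypeR R)) ->
  (leb2 R D < +oo)%E ->
  measurable_fun [set: measurableTypeR R * measurableTypeR R] (f : _ -> measurableTypeR R) ->
  [bounded f x | x in D] ->
  (leb2 R).-integrable (affine_map g h c d @^-1` D) (EFin \o (f \o affine_map g h c d)) /\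
  (\int[leb2 R]_(x in affine_map g h c d @^-1` D) f (affine_map g h c d x))%R =
   `|g.1 * h.2 - g.2 * h.1|^-1 * (\int[leb2 R]_(x in D) f x)%R.
Proof.
move=> det0 mD fD mf bf.
set L := affine_map g h c d; set a := `|_|^-1.
have a0 : 0 < a by rewrite invr_gt0 normr_gt0.
have mL := @measurable_affine_map R g h c d.
have mLD : measurable (L @^-1` D : set (measurableTypeR R * measurableTypeR R)).
  by rewrite -[X in measurable X]setTI; apply: mL.
have iL : (leb2 R).-integrable (L @^-1` D) (EFin \o (f \o L)).
  apply: measurable_bounded_integrable => //.
  - rewrite [X in (X < _)%E]leb2_affine // -/a.
    by rewrite lte_mul_pinfty // ?lee_fin ?ltW.
  - by apply: measurable_funTS; apply: measurableT_comp mL.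
  - case: bf => M [rM HM]; exists M; split => // x Mx z Lz; exact: HM Mx _ Lz.
split=> //.
have mef : measurable_fun [set: measurableTypeR R * measurableTypeR R] (EFin \o f).
  by apply/measurable_EFinP.
have e1 := integral_pushforward mL mef iL mD.
rewrite /Rintegral -[X in fine X = _]e1.
have mfD : measurable_fun D (EFin \o f : _ -> \bar R) by apply: measurable_funTS.
pose T : measurableType _ := (measurableTypeR R * measurableTypeR R)%type.
have e2 : (\int[pushforward (leb2 R) (L : T -> T)]_(y in D) (EFin \o f) y =
           \int[mscale (NngNum (ltW a0)) (leb2 R)]_(y in D) (EFin \o f) y)%E.
  unshelve epose (m1 := (pushforward (leb2 R) (L : T -> T) : {measure set T -> \bar R})).
    exact: mL.
  refine (@eq_measure_integral _ T R D (mscale (NngNum (ltW a0)) (leb2 R)) m1 (EFin \o f) _).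
  by move=> A mA AD; exact: leb2_affine.
have ifD : (leb2 R).-integrable D (EFin \o f).
  refine (measurable_bounded_integrable mD fD _ bf); exact: measurable_funTS mf.
(* The factor [a] is pulled out of the measure on the positive and the negative part separately;
   both integrals are finite, so their difference may be formed. *)
have Pfin := integrable_pos_fin_num mD ifD; have Nfin := integrable_neg_fin_num mD ifD.
pose P := (\int[leb2 R]_(x in D) ((EFin \o f)^\+ x))%E.
pose N := (\int[leb2 R]_(x in D) ((EFin \o f)^\- x))%E.
have eP : (\int[mscale (NngNum (ltW a0)) (leb2 R)]_(x in D) ((EFin \o f)^\+ x) =
           a%:E * P)%E.
  refine (ge0_integral_mscale (leb2 R) mD (NngNum (ltW a0)) (measurable_funepos mfD) _).
  by move=> x _; exact: funepos_ge0.
have eN : (\int[mscale (NngNum (ltW a0)) (leb2 R)]_(x in D) ((EFin \o f)^\- x) =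
           a%:E * N)%E.
  refine (ge0_integral_mscale (leb2 R) mD (NngNum (ltW a0)) (measurable_funeneg mfD) _).
  by move=> x _; exact: funeneg_ge0.
transitivity (fine (a%:E * P - a%:E * N)).
  congr fine; rewrite [LHS]e2 [LHS]integralE; congr (_ - _)%E; [exact: eP|exact: eN].
have -> : (\int[leb2 R]_(x in D) (f x)%:E)%E = (P - N)%E by exact: integralE.
have {}Pfin : P \is a fin_num := Pfin; have {}Nfin : N \is a fin_num := Nfin.
clearbody P N; clear -Pfin Nfin.
by case: P N Pfin Nfin => [p| |] [n| |] // _ _; rewrite -!EFinM -!EFinB /= mulrBr.
Qed.

(** * Bivariate polynomials and the reference triangle *)

(* The inner variable is the first coordinate, the outer one the second. *)
Notation bpoly R := {poly {poly R}}.
Notation px := ('X%:P : bpoly _).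
Notation py := ('X : bpoly _).

Definition ev (R : realType) (P : bpoly R) (z : R * R) : R := P.[z.2%:P].[z.1].

Lemma evE (R : realType) (z : R * R) :
  (forall P Q, ev (P + Q) z = ev P z + ev Q z) *
  (forall P Q, ev (P * Q) z = ev P z * ev Q z) *
  (forall P, ev (- P) z = - ev P z) * (ev 0 z = 0) * (ev 1 z = 1) * (ev px z = z.1) *
  (ev py z = z.2) * (forall c : R, ev c%:P%:P z = c) *
  (forall P n, ev (P *+ n) z = ev P z *+ n) * (forall P n, ev (P ^+ n) z = ev P z ^+ n).
Proof. by rewrite /ev; do !split => *; rewrite ?(hornerD, hornerM, hornerN, hornerC, hornerX, hornerMn, horner_exp, horner0). Qed.

Lemma ev_sum (R : realType) (I : Type) (r : seq I) (p : pred I) (F : I -> bpoly R) z :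
  ev (\sum_(i <- r | p i) F i) z = \sum_(i <- r | p i) ev (F i) z.
Proof. by rewrite /ev !horner_sum. Qed.

Definition dpx (R : realType) (P : bpoly R) : bpoly R := map_poly (@deriv R) P.
Definition dpy (R : realType) (P : bpoly R) : bpoly R := P^`().

Lemma coef_dpx (R : realType) (P : bpoly R) j : (dpx P)`_j = (P`_j)^`().
Proof. by rewrite coef_map_id0 // deriv0. Qed.

Lemma dpxE (R : realType) :
  (forall P Q : bpoly R, dpx (P + Q) = dpx P + dpx Q) *
  (forall P Q : bpoly R, dpx (P * Q) = dpx P * Q + P * dpx Q) *
  (forall P : bpoly R, dpx (- P) = - dpx P) * (dpx 0 = 0 :> bpoly R) * (dpx 1 = 0 :> bpoly R) *
  (dpx px = 1 :> bpoly R) * (dpx py = 0 :> bpoly R) *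
  (forall c : R, dpx c%:P%:P = 0) * (forall (P : bpoly R) n, dpx (P *+ n) = dpx P *+ n).
Proof.
do !split.
- by move=> P Q; apply/polyP=> i; rewrite coefD !coef_dpx coefD derivD.
- move=> P Q; apply/polyP=> i; rewrite coefD !coef_dpx !coefM raddf_sum -big_split /=.
  by apply: eq_bigr => k _; rewrite derivM !coef_dpx.
- by move=> P; apply/polyP=> i; rewrite coefN !coef_dpx coefN derivN.
- by apply/polyP=> i; rewrite !coef_dpx !coef0 deriv0.
- by apply/polyP=> i; rewrite coef_dpx coef1 coef0 -polyC_natr derivC.
- by apply/polyP=> i; rewrite coef_dpx coefC coef1; case: eqP; rewrite ?derivX ?deriv0.
- by apply/polyP=> i; rewrite coef_dpx coefX coef0 -polyC_natr derivC.
- by move=> c; apply/polyP=> i; rewrite coef_dpx !coefC; case: eqP; rewrite ?derivC ?deriv0.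
- by move=> P n; apply/polyP=> i; rewrite coefMn !coef_dpx coefMn derivMn.
Qed.

Lemma dpyE (R : realType) :
  (forall P Q : bpoly R, dpy (P + Q) = dpy P + dpy Q) *
  (forall P Q : bpoly R, dpy (P * Q) = dpy P * Q + P * dpy Q) *
  (forall P : bpoly R, dpy (- P) = - dpy P) * (dpy 0 = 0 :> bpoly R) * (dpy 1 = 0 :> bpoly R) *
  (dpy px = 0 :> bpoly R) * (dpy py = 1 :> bpoly R) *
  (forall c : R, dpy c%:P%:P = 0) * (forall (P : bpoly R) n, dpy (P *+ n) = dpy P *+ n).
Proof.
rewrite /dpy; do !split => *; rewrite ?derivD ?derivM ?derivN ?deriv0 ?derivC ?derivX ?derivMn //.
Qed.

HB.instance Definition _ (R : realType) :=
  GRing.isZmodMorphism.Build (bpoly R) (bpoly R) (@dpx R)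
    (fun P Q => etrans ((dpxE R).1.1.1.1.1.1.1.1 P (- Q))
                       (congr1 _ ((dpxE R).1.1.1.1.1.1.2 Q))).
HB.instance Definition _ (R : realType) :=
  GRing.isZmodMorphism.Build (bpoly R) (bpoly R) (@dpy R)
    (fun P Q => etrans ((dpyE R).1.1.1.1.1.1.1.1 P (- Q))
                       (congr1 _ ((dpyE R).1.1.1.1.1.1.2 Q))).

Lemma dpxM (R : realType) (P Q : bpoly R) : dpx (P * Q) = dpx P * Q + P * dpx Q.
Proof. by rewrite dpxE. Qed.

Lemma dpyM (R : realType) (P Q : bpoly R) : dpy (P * Q) = dpy P * Q + P * dpy Q.
Proof. by rewrite dpyE. Qed.

Lemma dpxyC (R : realType) (P : bpoly R) : dpx (dpy P) = dpy (dpx P).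
Proof.
by apply/polyP=> i; rewrite coef_dpx /dpy !coef_deriv coef_dpx derivMn.
Qed.

(** Restriction to the curve t -> (a(t), b(t)), see [horner_sub2]; all traces on edges are
    instances. *)
Definition sub2 (R : realType) (a b : {poly R}) (P : bpoly R) : {poly R} :=
  (map_poly (comp_poly a) P).[b].

Lemma sub2E (R : realType) (a b : {poly R}) :
  (forall P Q, sub2 a b (P + Q) = sub2 a b P + sub2 a b Q) *
  (forall P Q, sub2 a b (P * Q) = sub2 a b P * sub2 a b Q) *
  (forall P, sub2 a b (- P) = - sub2 a b P) * (sub2 a b 0 = 0) * (sub2 a b 1 = 1) *
  (sub2 a b px = a) * (sub2 a b py = b) * (forall c : R, sub2 a b c%:P%:P = c%:P) *
  (forall P n, sub2 a b (P *+ n) = sub2 a b P *+ n) *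
  (forall P n, sub2 a b (P ^+ n) = sub2 a b P ^+ n).
Proof.
rewrite /sub2; do !split => *.
- by rewrite rmorphD hornerD.
- by rewrite rmorphM hornerM.
- by rewrite rmorphN hornerN.
- by rewrite rmorph0 horner0.
- by rewrite rmorph1 hornerC.
- by rewrite map_polyC /= comp_polyX hornerC.
- by rewrite map_polyX hornerX.
- by rewrite map_polyC /= comp_polyC hornerC.
- by rewrite rmorphMn hornerMn.
- by rewrite rmorphXn horner_exp.
Qed.

HB.instance Definition _ (R : realType) (a b : {poly R}) :=
  GRing.isZmodMorphism.Build (bpoly R) {poly R} (sub2 a b)
    (fun P Q => etrans ((sub2E a b).1.1.1.1.1.1.1.1.1 P (- Q))
                       (congr1 _ ((sub2E a b).1.1.1.1.1.1.1.2 Q))).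
HB.instance Definition _ (R : realType) (a b : {poly R}) :=
  GRing.isMonoidMorphism.Build (bpoly R) {poly R} (sub2 a b)
    (conj (sub2E a b).1.1.1.1.1.2 (sub2E a b).1.1.1.1.1.1.1.1.2).

Lemma horner_sub2 (R : realType) (a b : {poly R}) (P : bpoly R) s :
  (sub2 a b P).[s] = ev P (a.[s], b.[s]).
Proof.
elim/poly_ind: P => [|P c IH]; first by rewrite sub2E evE horner0.
rewrite !sub2E !evE hornerD hornerM IH /=; congr (_ + _).
by rewrite /ev /sub2 map_polyC /= !hornerC horner_comp.
Qed.

Lemma deriv_sub2 (R : realType) (a b : {poly R}) (P : bpoly R) :
  (sub2 a b P)^`() = sub2 a b (dpx P) * a^`() + sub2 a b (dpy P) * b^`().
Proof.
elim/poly_ind: P => [|P c IH].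
  by rewrite dpxE dpyE !sub2E deriv0; ring.
rewrite !(dpxE, dpyE) !sub2E derivD derivM IH.
have -> : dpx c%:P = c^`()%:P.
  by apply/polyP=> i; rewrite coef_dpx !coefC; case: eqP; rewrite ?deriv0.
have -> : dpy c%:P = 0 by rewrite /dpy derivC.
have sC p : sub2 a b p%:P = p \Po a by rewrite /sub2 map_polyC /= hornerC.
by rewrite !sC deriv_comp ?comp_poly0; ring.
Qed.

(** * Exact integration of polynomials by antiderivatives *)

Definition prim (R : realType) (q : {poly R}) : {poly R} :=
  \poly_(i < (size q).+1) (i%:R^-1 * q`_i.-1).
Definition primy (R : realType) (P : bpoly R) : bpoly R :=
  \poly_(i < (size P).+1) ((i%:R^-1)%:P * P`_i.-1).

(** Since [0^-1 = 0], the formula also covers the constant term: [prim q] is the antiderivative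
    vanishing at 0. *)
Lemma coef_prim (R : realType) (q : {poly R}) i : (prim q)`_i = i%:R^-1 * q`_i.-1.
Proof.
rewrite coef_poly; case: ltnP => // lei.
by rewrite (nth_default _ (_ : size q <= i.-1)%N) ?mulr0 //; case: i lei.
Qed.

Lemma coef_primy (R : realType) (P : bpoly R) i :
  (primy P)`_i = (i%:R^-1)%:P * P`_i.-1.
Proof.
rewrite coef_poly; case: ltnP => // lei.
by rewrite (nth_default _ (_ : size P <= i.-1)%N) ?mulr0 //; case: i lei.
Qed.

Lemma deriv_prim (R : realType) (q : {poly R}) : (prim q)^`() = q.
Proof.
apply/polyP=> i; rewrite coef_deriv coef_prim -[LHS]mulr_natr mulrAC.
by rewrite mulVf ?mul1r // pnatr_eq0.
Qed.

Lemma prim_deriv (R : realType) (q : {poly R}) : prim q^`() = q - (q`_0)%:P.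
Proof.
apply/polyP=> -[|i]; rewrite coef_prim coefB coefC /=.
  by rewrite invr0 mul0r subrr.
by rewrite coef_deriv subr0 -[q`_i.+1 *+ _]mulr_natr mulrCA mulVf ?mulr1 // pnatr_eq0.
Qed.

(** Algebraic substitutes for the integrals over [0, 1] and over the reference triangle (inner
    variable y from 0 to 1 - x). They are identified with Lebesgue integrals in [Rintegral01] and
    [Rintegral_reft]. *)
Definition I1 (R : realType) (q : {poly R}) : R := (prim q).[1].
Definition I2 (R : realType) (P : bpoly R) : R := I1 (sub2 'X (1 - 'X) (primy P)).

Lemma primE (R : realType) :
  (forall p q : {poly R}, prim (p + q) = prim p + prim q) *
  (forall c (p : {poly R}), prim (c%:P * p) = c%:P * prim p).
Proof.
split; first by move=> p q; apply/polyP=> i; rewrite coefD !coef_prim coefD mulrDr.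
by move=> c q; apply/polyP=> i; rewrite coefCM !coef_prim coefCM mulrCA.
Qed.

Lemma primyE (R : realType) :
  (forall P Q : bpoly R, primy (P + Q) = primy P + primy Q) *
  (forall c (P : bpoly R), primy (c%:P * P) = c%:P * primy P).
Proof.
split; first by move=> P Q; apply/polyP=> i; rewrite coefD !coef_primy coefD mulrDr.
by move=> c q; apply/polyP=> i; rewrite coefCM !coef_primy coefCM mulrCA.
Qed.

Lemma I1D (R : realType) (p q : {poly R}) : I1 (p + q) = I1 p + I1 q.
Proof. by rewrite /I1 primE hornerD. Qed.
Lemma I1Z (R : realType) c (p : {poly R}) : I1 (c%:P * p) = c * I1 p.
Proof. by rewrite /I1 primE hornerM hornerC. Qed.
Lemma I1_0 (R : realType) : I1 (0 : {poly R}) = 0.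
Proof. by rewrite -[0](mul0r 0) -polyC0 I1Z mul0r. Qed.
Lemma I1N (R : realType) (p : {poly R}) : I1 (- p) = - I1 p.
Proof. by apply/eqP; rewrite -addr_eq0 -I1D addNr I1_0. Qed.
Lemma I1B (R : realType) (p q : {poly R}) : I1 (p - q) = I1 p - I1 q.
Proof. by rewrite I1D I1N. Qed.
Lemma I1_sum (R : realType) (I : Type) (r : seq I) (p : pred I) (F : I -> {poly R}) :
  I1 (\sum_(i <- r | p i) F i) = \sum_(i <- r | p i) I1 (F i).
Proof. by apply: (big_morph (@I1 R)) => [P Q|]; rewrite ?I1D ?I1_0. Qed.

Lemma I2D (R : realType) (p q : bpoly R) : I2 (p + q) = I2 p + I2 q.
Proof. by rewrite /I2 primyE sub2E I1D. Qed.
Lemma I2Z (R : realType) c (p : bpoly R) : I2 (c%:P%:P * p) = c * I2 p.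
Proof. by rewrite /I2 primyE sub2E sub2E I1Z. Qed.
Lemma I2_0 (R : realType) : I2 (0 : bpoly R) = 0.
Proof. by rewrite -[0](mul0r 0) -polyC0 -[0%:P](rmorph0 (@polyC _)) -polyC0 I2Z mul0r. Qed.
Lemma I2N (R : realType) (p : bpoly R) : I2 (- p) = - I2 p.
Proof. by apply/eqP; rewrite -addr_eq0 -I2D addNr I2_0. Qed.
Lemma I2B (R : realType) (p q : bpoly R) : I2 (p - q) = I2 p - I2 q.
Proof. by rewrite I2D I2N. Qed.
Lemma I2_sum (R : realType) (I : Type) (r : seq I) (p : pred I) (F : I -> bpoly R) :
  I2 (\sum_(i <- r | p i) F i) = \sum_(i <- r | p i) I2 (F i).
Proof. by apply: (big_morph (@I2 R)) => [P Q|]; rewrite ?I2D ?I2_0. Qed.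

Lemma I1_deriv (R : realType) (q : {poly R}) : I1 q^`() = q.[1] - q.[0].
Proof. by rewrite /I1 prim_deriv !hornerE horner_coef0. Qed.

Lemma I1_flip (R : realType) (q : {poly R}) : I1 (q \Po (1 - 'X)) = I1 q.
Proof.
have e : q \Po (1 - 'X) = - (prim q \Po (1 - 'X))^`().
  rewrite deriv_comp deriv_prim derivB derivX -polyC1 derivC; ring.
rewrite e I1N I1_deriv !horner_comp !hornerE subrr subr0 /I1.
by rewrite [X in - (X - _)]horner_coef0 coef_prim invr0 mul0r sub0r opprK.
Qed.

(* Restrictions to the edges of the reference triangle opposite to (0, 0), (1, 0) and
   (0, 1), and below the derivatives along these edges, oriented cyclically. *)
Definition tr1 (R : realType) : bpoly R -> {poly R} := sub2 (1 - 'X) 'X.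
Definition tr2 (R : realType) : bpoly R -> {poly R} := sub2 0 (1 - 'X).
Definition tr3 (R : realType) : bpoly R -> {poly R} := sub2 'X 0.

Lemma sub2C (R : realType) (a b p : {poly R}) : sub2 a b p%:P = p \Po a.
Proof. by rewrite /sub2 map_polyC /= hornerC. Qed.

Lemma sub2_comp (R : realType) (a b c : {poly R}) P :
  sub2 a b P \Po c = sub2 (a \Po c) (b \Po c) P.
Proof.
elim/poly_ind: P => [|P p IH]; first by rewrite !sub2E comp_poly0.
by rewrite !sub2E comp_polyD comp_polyM IH !sub2C comp_polyA.
Qed.

Lemma I1_tr1 (R : realType) (P : bpoly R) : I1 (tr1 P) = I1 (sub2 'X (1 - 'X) P).
Proof.
rewrite -[RHS]I1_flip sub2_comp comp_polyX comp_polyB comp_polyX -polyC1 comp_polyC.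
by rewrite subKr polyC1.
Qed.

Lemma I2_dpy (R : realType) (P : bpoly R) : I2 (dpy P) = I1 (tr1 P) - I1 (tr3 P).
Proof.
rewrite I1_tr1 /I2 /tr3 -I1B; congr I1.
have -> : primy (dpy P) = P - (P`_0)%:P.
  apply/polyP=> -[|i]; rewrite coef_primy coefB coefC /=.
    by rewrite invr0 mul0r subrr.
  rewrite /dpy coef_deriv subr0 -[P`_i.+1 *+ _]mulr_natr mulrCA -polyC_natr -polyCM.
  by rewrite mulVf ?mulr1 // pnatr_eq0.
rewrite !sub2E sub2C; congr (_ - _).
by rewrite /sub2 horner_coef0 coef_map.
Qed.

(** Leibniz' rule with the moving bound 1 - x: the inner integral of [dpx P] is the x-derivative of
    the inner integral of P plus the value of P on the hypotenuse. The derivative integrates to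
    minus the integral of P over the edge x = 0, as the inner integral vanishes at x = 1. *)
Lemma I2_dpx (R : realType) (P : bpoly R) : I2 (dpx P) = I1 (tr1 P) - I1 (tr2 P).
Proof.
have e : sub2 'X (1 - 'X) (primy (dpx P)) =
         (sub2 'X (1 - 'X) (primy P))^`() + sub2 'X (1 - 'X) P.
  rewrite deriv_sub2 derivX derivB derivX -polyC1 derivC.
  have -> : dpy (primy P) = P.
    apply/polyP=> i; rewrite coef_deriv coef_primy -[LHS]mulr_natr mulrAC.
    by rewrite -polyC_natr -polyCM mulVf ?mul1r // pnatr_eq0.
  have -> : dpx (primy P) = primy (dpx P).
    apply/polyP=> i; rewrite coef_dpx !coef_primy coef_dpx derivM derivC; ring.
  ring.
rewrite I1_tr1 /I2 e I1D I1_deriv addrC; congr (_ + _).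
rewrite !horner_sub2 !hornerE subrr subr0.
have map0 Q : sub2 0 'X Q = map_poly (horner_eval 0) Q :> {poly R}.
  elim/poly_ind: Q => [|Q p IH]; first by rewrite sub2E rmorph0.
  rewrite !sub2E sub2C IH rmorphD rmorphM /= map_polyX map_polyC /=.
  by rewrite /horner_eval comp_polyCr.
have -> : tr2 P = sub2 0 'X P \Po (1 - 'X).
  by rewrite sub2_comp comp_poly0 comp_polyX.
rewrite I1_flip /I1.
have -> : prim (sub2 0 'X P) = sub2 0 'X (primy P).
  apply/polyP=> i; rewrite coef_prim !map0 !coef_map /= coef_primy.
  by rewrite /horner_eval hornerM hornerC.
rewrite horner_sub2 !hornerE /ev horner_coef0 coef_primy invr0 mul0r horner0.
by rewrite sub0r.
Qed.

Definition d1 (R : realType) (P : bpoly R) : bpoly R := dpy P - dpx P.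
Definition d2 (R : realType) (P : bpoly R) : bpoly R := - dpy P.
Definition d3 (R : realType) (P : bpoly R) : bpoly R := dpx P.

Lemma I2_d1 (R : realType) (P : bpoly R) : I2 (d1 P) = I1 (tr2 P) - I1 (tr3 P).
Proof. by rewrite I2B I2_dpx I2_dpy; ring. Qed.
Lemma I2_d2 (R : realType) (P : bpoly R) : I2 (d2 P) = I1 (tr3 P) - I1 (tr1 P).
Proof. by rewrite I2N I2_dpy opprB. Qed.
Lemma I2_d3 (R : realType) (P : bpoly R) : I2 (d3 P) = I1 (tr1 P) - I1 (tr2 P).
Proof. exact: I2_dpx. Qed.

Lemma deriv_tr1 (R : realType) (P : bpoly R) : (tr1 P)^`() = tr1 (d1 P).
Proof. by rewrite deriv_sub2 /tr1 /d1 !sub2E derivB derivX -polyC1 derivC; ring. Qed.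
Lemma deriv_tr2 (R : realType) (P : bpoly R) : (tr2 P)^`() = tr2 (d2 P).
Proof. by rewrite deriv_sub2 /tr2 /d2 !sub2E derivB derivX -polyC1 deriv0 derivC; ring. Qed.
Lemma deriv_tr3 (R : realType) (P : bpoly R) : (tr3 P)^`() = tr3 (d3 P).
Proof. by rewrite deriv_sub2 /tr3 /d3 derivX deriv0; ring. Qed.

Definition vert0 (R : realType) (P : bpoly R) : Prop :=
  [/\ ev P (0, 0) = 0, ev P (1, 0) = 0 & ev P (0, 1) = 0].

Lemma I1_tr_deriv (R : realType) (P : bpoly R) : vert0 P ->
  [/\ I1 (tr1 (d1 P)) = 0, I1 (tr2 (d2 P)) = 0 & I1 (tr3 (d3 P)) = 0].
Proof.
case=> e0 e1 e2; rewrite -deriv_tr1 -deriv_tr2 -deriv_tr3 !I1_deriv.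
by rewrite !horner_sub2 !hornerE ?subrr ?subr0 e0 e1 e2 subrr.
Qed.

(* [aff1], [aff2], [aff3] are the affine-invariant part of the effective shear
   trace of \sum_j u_j t_j t_j^T on the three edges (times two), see [edge_trace]. *)
Definition aff1 (R : realType) (u2 u3 : bpoly R) : bpoly R :=
  d1 (u3 - u2) + (d2 u2 - d3 u3) *+ 2.
Definition aff2 (R : realType) (u3 u1 : bpoly R) : bpoly R :=
  d2 (u1 - u3) + (d3 u3 - d1 u1) *+ 2.
Definition aff3 (R : realType) (u1 u2 : bpoly R) : bpoly R :=
  d3 (u2 - u1) + (d1 u1 - d2 u2) *+ 2.

(** Two integrations by parts along each t_j. On edge 1 the doubled boundary terms are grouped by u2
    + u3, paired with the derivative [d2 - d3] of V along the median, and u2 - u3, paired with the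
    tangential derivative of V. The tangential derivative is moved onto the coefficients, and the
    end point terms vanish by [vert0]; likewise on the other edges. *)
Lemma green (R : realType) (u1 u2 u3 V : bpoly R) :
  vert0 u1 -> vert0 u2 -> vert0 u3 ->
  I2 ((d1 (d1 u1) + d2 (d2 u2) + d3 (d3 u3)) * V) *+ 2 =
  I2 (u1 * d1 (d1 V) + u2 * d2 (d2 V) + u3 * d3 (d3 V)) *+ 2
  + (I1 (tr1 (u2 + u3) * tr1 (d2 V - d3 V)) - I1 (tr1 (aff1 u2 u3) * tr1 V))
  + (I1 (tr2 (u3 + u1) * tr2 (d3 V - d1 V)) - I1 (tr2 (aff2 u3 u1) * tr2 V))
  + (I1 (tr3 (u1 + u2) * tr3 (d1 V - d2 V)) - I1 (tr3 (aff3 u1 u2) * tr3 V)).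
Proof.
move=> v1 v2 v3.
have vM u v : vert0 u -> vert0 v -> vert0 ((u - v) * V).
  by case=> a b c [a' b' c']; split; rewrite !evE ?(a, b, c, a', b', c'); ring.
have [b1 _ _] := I1_tr_deriv (vM _ _ v3 v2).
have [_ b2 _] := I1_tr_deriv (vM _ _ v1 v3).
have [_ _ b3] := I1_tr_deriv (vM _ _ v2 v1).
have g1 := I2_d1 (d1 u1 * V - u1 * d1 V).
have g2 := I2_d2 (d2 u2 * V - u2 * d2 V).
have g3 := I2_d3 (d3 u3 * V - u3 * d3 V).
have -> : (d1 (d1 u1) + d2 (d2 u2) + d3 (d3 u3)) * V =
  (u1 * d1 (d1 V) + u2 * d2 (d2 V) + u3 * d3 (d3 V)) +
  (d1 (d1 u1 * V - u1 * d1 V) + d2 (d2 u2 * V - u2 * d2 V) + d3 (d3 u3 * V - u3 * d3 V)).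
  rewrite /d1 /d2 /d3 !(dpxE, dpyE); ring.
rewrite [I2 (_ + (_ + _ + _))]I2D mulrnDl -[RHS]addrA -[RHS]addrA; congr (_ + _).
rewrite [I2 (_ + _ + _)]I2D [I2 (_ + _)]I2D g1 g2 g3.
have trM1 P Q : tr1 P * tr1 Q = tr1 (P * Q) :> {poly R} by rewrite /tr1 sub2E.
have trM2 P Q : tr2 P * tr2 Q = tr2 (P * Q) :> {poly R} by rewrite /tr2 sub2E.
have trM3 P Q : tr3 P * tr3 Q = tr3 (P * Q) :> {poly R} by rewrite /tr3 sub2E.
have trB1 (P Q : bpoly R) : I1 (tr1 P) - I1 (tr1 Q) = I1 (tr1 (P - Q)).
  by rewrite -I1B /tr1 !sub2E.
have trB2 (P Q : bpoly R) : I1 (tr2 P) - I1 (tr2 Q) = I1 (tr2 (P - Q)).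
  by rewrite -I1B /tr2 !sub2E.
have trB3 (P Q : bpoly R) : I1 (tr3 P) - I1 (tr3 Q) = I1 (tr3 (P - Q)).
  by rewrite -I1B /tr3 !sub2E.
rewrite !(trM1, trM2, trM3) !(trB1, trB2, trB3).
have -> : (u2 + u3) * (d2 V - d3 V) - aff1 u2 u3 * V =
  (d3 u3 * V - u3 * d3 V) *+ 2 - (d2 u2 * V - u2 * d2 V) *+ 2 - d1 ((u3 - u2) * V).
  rewrite /aff1 /d1 /d2 /d3 !(dpxE, dpyE); ring.
have -> : (u3 + u1) * (d3 V - d1 V) - aff2 u3 u1 * V =
  (d1 u1 * V - u1 * d1 V) *+ 2 - (d3 u3 * V - u3 * d3 V) *+ 2 - d2 ((u1 - u3) * V).
  rewrite /aff2 /d1 /d2 /d3 !(dpxE, dpyE); ring.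
have -> : (u1 + u2) * (d1 V - d2 V) - aff3 u1 u2 * V =
  (d2 u2 * V - u2 * d2 V) *+ 2 - (d1 u1 * V - u1 * d1 V) *+ 2 - d3 ((u2 - u1) * V).
  rewrite /aff3 /d1 /d2 /d3 !(dpxE, dpyE); ring.
have trS (a b : {poly R}) A B C :
  I1 (sub2 a b (A *+ 2 - B *+ 2 - C)) =
  I1 (sub2 a b A) *+ 2 - I1 (sub2 a b B) *+ 2 - I1 (sub2 a b C).
  by rewrite !sub2E !I1B !mulr2n !I1D.
rewrite [in RHS]/tr1 [in RHS]/tr2 [in RHS]/tr3 !trS -/(@tr1 R) -/(@tr2 R) -/(@tr3 R).
rewrite b1 b2 b3; ring.
Qed.

(** * Total degree of bivariate polynomials *)

Definition bdeg (R : realType) (m : nat) (P : bpoly R) : Prop :=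
  forall i j, (m < i + j)%N -> (P`_j)`_i = 0.

Lemma bdegW (R : realType) m n (P : bpoly R) : (m <= n)%N -> bdeg m P -> bdeg n P.
Proof. by move=> mn dP i j ij; apply: dP; apply: leq_ltn_trans ij. Qed.

Lemma bdeg0 (R : realType) m : bdeg m (0 : bpoly R).
Proof. by move=> i j _; rewrite !coef0. Qed.

Lemma bdegD (R : realType) m (P Q : bpoly R) : bdeg m P -> bdeg m Q -> bdeg m (P + Q).
Proof. by move=> dP dQ i j ij; rewrite !coefD dP ?dQ ?addr0. Qed.

Lemma bdegN (R : realType) m (P : bpoly R) : bdeg m P -> bdeg m (- P).
Proof. by move=> dP i j ij; rewrite !coefN dP ?oppr0. Qed.

Lemma bdegB (R : realType) m (P Q : bpoly R) : bdeg m P -> bdeg m Q -> bdeg m (P - Q).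
Proof. by move=> dP dQ; apply: bdegD => //; apply: bdegN. Qed.

Lemma bdegMn (R : realType) m (P : bpoly R) n : bdeg m P -> bdeg m (P *+ n).
Proof. by move=> dP i j ij; rewrite !coefMn dP ?mul0rn. Qed.

Lemma bdegC (R : realType) m (c : R) : bdeg m (c%:P%:P : bpoly R).
Proof.
move=> i j ij; rewrite coefC; case: eqP => [j0|]; rewrite ?coef0 // coefC.
by case: eqP => // i0; rewrite i0 j0 in ij.
Qed.

Lemma bdegX (R : realType) : bdeg 1 (px : bpoly R).
Proof.
move=> i j ij; rewrite coefC; case: eqP => [j0|]; rewrite ?coef0 // coefX.
by case: eqP => // i0; rewrite i0 j0 in ij.
Qed.

Lemma bdegY (R : realType) : bdeg 1 (py : bpoly R).
Proof.
move=> i j ij; rewrite coefX; case: eqP => [j0|]; rewrite ?coef0 // coefC.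
by case: eqP => // i0; rewrite i0 j0 in ij.
Qed.

Lemma bdegM (R : realType) m n (P Q : bpoly R) :
  bdeg m P -> bdeg n Q -> bdeg (m + n) (P * Q).
Proof.
move=> dP dQ i j ij; rewrite coefM coef_sum big1 // => b _.
rewrite coefM big1 // => a _.
have [ab|ab] := ltnP m (a + b); first by rewrite dP // mul0r.
by rewrite dQ ?mulr0 //; move: (ltn_ord a) (ltn_ord b); lia.
Qed.

Lemma bdegXn (R : realType) m (P : bpoly R) n : bdeg m P -> bdeg (n * m) (P ^+ n).
Proof.
move=> dP; elim: n => [|n IH]; first by have := @bdegC R (0 * m)%N 1; rewrite !polyC1.
by rewrite exprS mulSn; apply: bdegM.
Qed.

Lemma bdeg_sum (R : realType) m (I : Type) (r : seq I) (p : pred I) (F : I -> bpoly R) :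
  (forall i, p i -> bdeg m (F i)) -> bdeg m (\sum_(i <- r | p i) F i).
Proof.
by move=> dF; apply: big_ind => //; [exact: bdeg0|move=> *; exact: bdegD].
Qed.

Lemma bdeg_dpx (R : realType) m (P : bpoly R) : bdeg m P -> bdeg m.-1 (dpx P).
Proof.
move=> dP i j ij; rewrite coef_dpx coef_deriv dP ?mul0rn //.
by case: m ij {dP} => //= m; rewrite addSn ltnS.
Qed.

Lemma bdeg_dpy (R : realType) m (P : bpoly R) : bdeg m P -> bdeg m.-1 (dpy P).
Proof.
move=> dP i j ij; rewrite coef_deriv coefMn dP ?mul0rn //.
by case: m ij {dP} => //= m; rewrite addnS ltnS.
Qed.

Lemma bdegE (R : realType) m (P : bpoly R) : bdeg m P ->
  P = \sum_(i < m.+1) \sum_(j < m.+1) ((P`_j)`_i)%:P%:P * (px ^+ i * py ^+ j).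
Proof.
move=> dP.
have mono a b (i j : nat) : (px ^+ i * py ^+ j : bpoly R)`_b`_a = ((b == j) && (a == i))%:R.
  rewrite -polyC_exp coefCM coefXn; case: (b == j); rewrite ?mulr1 ?mulr0 ?coef0 //.
  by rewrite coefXn.
apply/polyP => b; apply/polyP => a.
rewrite coef_sum coef_sum; under eq_bigr do rewrite coef_sum coef_sum.
under eq_bigr do under eq_bigr do rewrite !coefCM mono.
have [am|ma] := ltnP a m.+1; last first.
  rewrite dP ?big1 //; last by apply: leq_trans (leq_addr _ _).
  move=> i _; rewrite big1 // => j _; rewrite (gtn_eqF (leq_trans (ltn_ord i) ma)).
  by rewrite andbF mulr0.
have [bm|mb] := ltnP b m.+1; last first.
  rewrite dP ?big1 //; last by apply: leq_trans (leq_addl _ _).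
  move=> i _; rewrite big1 // => j _; rewrite (gtn_eqF (leq_trans (ltn_ord j) mb)).
  by rewrite mulr0.
rewrite (bigD1 (Ordinal am)) //= (bigD1 (Ordinal bm)) //= !eqxx mulr1.
rewrite big1 => [|j /negPf]; last by rewrite -val_eqE /= eq_sym => ->; rewrite mulr0.
rewrite big1 ?addr0 // => i /negPf; rewrite -val_eqE /= eq_sym => ->.
by rewrite big1 // => j _; rewrite andbF mulr0.
Qed.

Lemma size_sub2 (R : realType) (a b : {poly R}) m (P : bpoly R) :
  (size a <= 2)%N -> (size b <= 2)%N -> bdeg m P -> (size (sub2 a b P) <= m.+1)%N.
Proof.
move=> sa sb dP; rewrite (bdegE dP).
rewrite (big_morph (sub2 a b) (id1 := 0) (op1 := +%R)); last 2 first.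
- by move=> *; rewrite sub2E.
- by rewrite sub2E.
apply: (leq_trans (size_sum _ _ _)); apply/bigmax_leqP => i _.
rewrite (big_morph (sub2 a b) (id1 := 0) (op1 := +%R)); last 2 first.
- by move=> *; rewrite sub2E.
- by rewrite sub2E.
apply: (leq_trans (size_sum _ _ _)); apply/bigmax_leqP => j _.
have [ij|ij] := ltnP m (i + j); first by rewrite dP // !sub2E mul0r size_poly0.
rewrite !sub2E mul_polyC; apply: (leq_trans (size_scale_leq _ _)).
apply: (leq_trans (size_polyMleq _ _)).
have := size_poly_exp_leq a i; have := size_poly_exp_leq b j.
have : ((size a).-1 * i <= i)%N by rewrite -{2}[val i]mul1n leq_mul2r; case: (size a) sa => [|[|[|]]] //=; rewrite ?orbT.
have : ((size b).-1 * j <= j)%N by rewrite -{2}[val j]mul1n leq_mul2r; case: (size b) sb => [|[|[|]]] //=; rewrite ?orbT.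
lia.
Qed.

Lemma size_tr1 (R : realType) m (P : bpoly R) : bdeg m P -> (size (tr1 P) <= m.+1)%N.
Proof.
apply: size_sub2; rewrite ?size_polyX // -opprB size_polyN.
by rewrite -polyC1 size_XsubC.
Qed.

(** * Identification with Lebesgue integrals *)

Lemma measurable_ev (R : realType) (P : bpoly R) :
  measurable_fun [set: measurableTypeR R * measurableTypeR R]
    (ev P : measurableTypeR R * measurableTypeR R -> measurableTypeR R).
Proof.
elim/poly_ind: P => [|P p IH].
  by rewrite (_ : ev 0 = cst 0) //; apply/funext => z; rewrite evE.
rewrite (_ : ev _ = (fun z => ev P z * z.2 + p.[z.1])); last first.
  by apply/funext => z; rewrite !evE /ev hornerC.
apply: measurable_funD; first by apply: measurable_funM => //; exact: measurable_snd.
elim/poly_ind: p => [|p c IHp].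
  by rewrite (_ : (fun _ => _) = cst 0) //; apply/funext => z; rewrite horner0.
rewrite (_ : (fun _ => _) =
  (fun z : measurableTypeR R * measurableTypeR R => p.[z.1] * z.1 + c)); last first.
  by apply/funext => z; rewrite hornerMXaddC.
apply: measurable_funD => //; apply: measurable_funM => //; exact: measurable_fst.
Qed.

Definition reft (R : realType) : set (R * R) :=
  [set z | [/\ 0 <= z.1, 0 <= z.2 & z.1 + z.2 <= 1]].

Lemma reft_bounded_ev (R : realType) (P : bpoly R) :
  exists M, forall z, reft z -> `|ev P z| <= M.
Proof.
elim/poly_ind: P => [|P p [M IH]].
  by exists 0 => z _; rewrite evE normr0.
have [N HN] : exists N, forall z : R * R, reft z -> `|p.[z.1]| <= N.
  elim/poly_ind: p => [|p c [N IHp]]; first by exists 0 => z _; rewrite horner0 normr0.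
  exists (N + `|c|) => z rz; rewrite hornerMXaddC (le_trans (ler_normD _ _)) //.
  rewrite lerD2r normrM (le_trans _ (IHp _ rz)) // ler_piMr //.
  by case: rz => ? ? ?; rewrite ger0_norm //; lra.
exists (M + N) => z rz; rewrite !evE [X in _ + X]/ev hornerC.
rewrite (le_trans (ler_normD _ _)) // lerD ?HN // normrM (le_trans _ (IH _ rz)) //.
rewrite ler_piMr //.
by case: rz => ? ? ?; rewrite ger0_norm //; lra.
Qed.

Lemma measurable_reft (R : realType) :
  measurable (@reft R : set (measurableTypeR R * measurableTypeR R)).
Proof.
pose f1 (z : measurableTypeR R * measurableTypeR R) : measurableTypeR R := z.1.
pose f2 (z : measurableTypeR R * measurableTypeR R) : measurableTypeR R := z.2.
pose f3 (z : measurableTypeR R * measurableTypeR R) : measurableTypeR R := z.1 + z.2.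
have m1 : measurable_fun setT f1 by exact: measurable_fst.
have m2 : measurable_fun setT f2 by exact: measurable_snd.
have m3 : measurable_fun setT f3 by apply: measurable_funD.
have -> : @reft R = f1 @^-1` `[0, +oo[ `&` f2 @^-1` `[0, +oo[ `&` f3 @^-1` `]-oo, 1].
  apply/seteqP; split => z /=; rewrite !in_itv /= !andbT.
    by case.
  by case=> -[].
apply: measurableI; first apply: measurableI.
- by rewrite -[X in measurable X]setTI; apply: m1.
- by rewrite -[X in measurable X]setTI; apply: m2.
- by rewrite -[X in measurable X]setTI; apply: m3.
Qed.

Lemma leb2_reft (R : realType) : (leb2 R (@reft R) < +oo)%E.
Proof.
apply: (@le_lt_trans _ _ (leb2 R (`[0, 1]%classic `*` `[0, 1]%classic))).
  apply: le_measure; rewrite ?inE; [exact: measurable_reft|by apply: measurableX|].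
  by move=> z [a b c]; split; rewrite /= in_itv /=; lra.
have -> : leb2 R (`[0, 1]%classic `*` `[0, 1]%classic) =
    (@lebesgue_measure R `[0%R, 1%R]%classic * @lebesgue_measure R `[0%R, 1%R]%classic)%E.
  exact: product_measure1E.
by rewrite lebesgue_measure_itv /= lte_fin ltr01 -EFinB -EFinM ltry.
Qed.

Lemma integrable_ev (R : realType) (P : bpoly R) :
  (leb2 R).-integrable (@reft R) (EFin \o ev P).
Proof.
apply: measurable_bounded_integrable; first exact: measurable_reft.
- exact: leb2_reft.
- by apply: measurable_funTS; exact: measurable_ev.
- have [M HM] := reft_bounded_ev P.
  exists M; split; first by rewrite num_real.
  by move=> x Mx z rz; apply: le_trans (HM z rz) (ltW Mx).
Qed.

Lemma Rintegral_poly (R : realType) (q : {poly R}) (b : R) : 0 <= b ->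
  (\int[@lebesgue_measure R]_(t in `[0%R, b]) q.[t])%R = (prim q).[b].
Proof.
rewrite le_eqVlt => /predU1P[<-|b0].
  rewrite set_itv1 Rintegral_set1 horner_coef0 coef_prim.
  by rewrite invr0 mul0r.
have c q' : continuous (horner q' : R -> R) by exact: continuous_horner.
rewrite /Rintegral (@continuous_FTC2 _ _ (horner (prim q))) //=.
- by rewrite [X in _ - X]horner_coef0 coef_prim invr0 mul0r subr0.
- by apply: continuous_subspaceT => x; exact: c.
- split; first by move=> x _; exact: derivable_horner.
  + by apply: cvg_at_right_filter; exact: c.
  + by apply: cvg_at_left_filter; exact: c.
- by move=> x _; rewrite -derivE deriv_prim.
Qed.

Lemma Rintegral01 (R : realType) (q : {poly R}) :
  (\int[@lebesgue_measure R]_(t in `[0%R, 1%R]) q.[t])%R = I1 q.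
Proof. exact: Rintegral_poly. Qed.

Lemma integrable_poly (R : realType) (q : {poly R}) (b : R) :
  (@lebesgue_measure R).-integrable `[0%R, b] (EFin \o horner q).
Proof.
apply: continuous_compact_integrable; first exact: segment_compact.
by apply: continuous_subspaceT => x; exact: continuous_horner.
Qed.

Lemma horner_slice (R : realType) (P : bpoly R) (x y : R) :
  (map_poly (horner_eval x) P).[y] = ev P (x, y).
Proof.
have -> : map_poly (horner_eval x) P = sub2 x%:P 'X P.
  rewrite /sub2; elim/poly_ind: P => [|Q p IH]; first by rewrite !rmorph0 horner0.
  rewrite !rmorphD !rmorphM /= !map_polyX !map_polyC /= hornerD hornerM hornerX -IH.
  by rewrite hornerC comp_polyCr.
by rewrite horner_sub2 hornerC hornerX.
Qed.

Lemma Rintegral_reft (R : realType) (P : bpoly R) :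
  (\int[leb2 R]_(z in @reft R) ev P z)%R = I2 P.
Proof.
have mr := @measurable_reft R.
have iP : (leb2 R).-integrable setT ((EFin \o ev P) \_ (@reft R)).
  by apply/(integrable_mkcond _ mr); exact: integrable_ev.
rewrite /Rintegral integral_mkcond -integral12_prod_meas1 //.
transitivity (fine (\int[@lebesgue_measure R]_x
    ((EFin \o horner (sub2 'X (1 - 'X) (primy P))) \_ `[0%R, 1%R]) x)%E); last first.
  by rewrite -integral_mkcond -[RHS]Rintegral01.
(* By Fubini a single vertical slice remains: it is empty for x outside [0, 1] and the interval
   [0, 1 - x] otherwise. *)
congr fine; apply: eq_integral => x _; rewrite /fubini_F patchE mem_setE in_itv /=.
case: ifP => [/andP[x0 x1]|/negP nx]; last first.
  apply: integral0_eq => // y _; rewrite patchE; case: ifPn => // /set_mem[/= a b c].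
  by case: nx; apply/andP; split=> //; lra.
pose q : {poly R} := map_poly (horner_eval x) P.
have qE y : q.[y] = ev P (x, y) by exact: horner_slice.
have -> : (sub2 'X (1 - 'X) (primy P)).[x] = (prim q).[1 - x].
  rewrite horner_sub2 !hornerE.
  have -> : prim q = map_poly (horner_eval x) (primy P).
    apply/polyP => i; rewrite coef_prim !coef_map /= coef_primy.
    by rewrite /horner_eval hornerM hornerC.
  by rewrite horner_slice.
have x1' : 0 <= 1 - x by rewrite subr_ge0.
rewrite -(Rintegral_poly q x1') /Rintegral fineK; last first.
  exact: integrable_fin_num (integrable_poly q (1 - x)).
rewrite [RHS]integral_mkcond; apply: eq_integral => y _.
rewrite !patchE mem_setE in_itv /=.
have -> : ((x, y) \in @reft R) = (0 <= y <= 1 - x).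
  apply/idP/idP; first by move/set_mem => [/= a b c]; apply/andP; split => //; lra.
  by move=> /andP[a b]; apply/mem_set; split => //=; lra.
by case: ifP => //; rewrite qE.
Qed.

(** * Polynomial functions on a triangle *)

Record frame (R : realType) := Frame { fp1 : R * R; fp2 : R * R; fp3 : R * R }.

Definition det2 (R : realType) (a b : R * R) : R := a.1 * b.2 - a.2 * b.1.
Definition te1 (R : realType) (F : frame R) := fp3 F - fp2 F.
Definition te2 (R : realType) (F : frame R) := fp1 F - fp3 F.
Definition te3 (R : realType) (F : frame R) := fp2 F - fp1 F.
Definition fdet (R : realType) (F : frame R) : R := det2 (te2 F) (te3 F).
(* Gradients of the barycentric coordinates attached to [fp2] and [fp3]. *)
Definition grad2 (R : realType) (F : frame R) : R * R :=
  (- (te2 F).2 / fdet F, (te2 F).1 / fdet F).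
Definition grad3 (R : realType) (F : frame R) : R * R :=
  (- (te3 F).2 / fdet F, (te3 F).1 / fdet F).
Definition bary (R : realType) (F : frame R) (x : R * R) : R * R :=
  (dotp (grad2 F) (x - fp1 F), dotp (grad3 F) (x - fp1 F)).
Definition unbary (R : realType) (F : frame R) (z : R * R) : R * R :=
  fp1 F + z.1 *: te3 F - z.2 *: te2 F.
Definition plift (R : realType) (F : frame R) (P : bpoly R) (x : R * R) : R :=
  ev P (bary F x).

Lemma baryK (R : realType) (F : frame R) : fdet F != 0 -> cancel (bary F) (unbary F).
Proof.
case: F => -[a1 a2] [b1 b2] [c1 c2]; rewrite /fdet /det2 /te2 /te3 /= => d0 [x y].
rewrite /unbary /bary /dotp /grad2 /grad3 /fdet /det2 /te2 /te3 /=.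
by apply: injective_projections => /=; rewrite /GRing.scale /=; field.
Qed.

Lemma unbaryK (R : realType) (F : frame R) : fdet F != 0 -> cancel (unbary F) (bary F).
Proof.
case: F => -[a1 a2] [b1 b2] [c1 c2]; rewrite /fdet /det2 /te2 /te3 /= => d0 [x y].
rewrite /unbary /bary /dotp /grad2 /grad3 /fdet /det2 /te2 /te3 /=.
by apply: injective_projections => /=; rewrite /GRing.scale /=; field.
Qed.

Lemma grad_det (R : realType) (F : frame R) : fdet F != 0 ->
  (grad2 F).1 * (grad3 F).2 - (grad2 F).2 * (grad3 F).1 = (fdet F)^-1.
Proof.
case: F => -[a1 a2] [b1 b2] [c1 c2]; rewrite /grad2 /grad3 /fdet /det2 /te2 /te3 /=.
by move=> d0; field.
Qed.

Lemma lift_int (R : realType) (F : frame R) (P : bpoly R) : fdet F != 0 ->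
  (leb2 R).-integrable (bary F @^-1` @reft R) (EFin \o plift F P) /\
  (\int[leb2 R]_(x in bary F @^-1` @reft R) plift F P x)%R = `|fdet F| * I2 P.
Proof.
move=> d0.
pose c := - dotp (grad2 F) (fp1 F); pose d := - dotp (grad3 F) (fp1 F).
have bE : bary F = affine_map (grad2 F) (grad3 F) c d.
  by apply/funext => -[x y]; rewrite /bary /affine_map /c /d /dotp /=; congr pair; ring.
have de := grad_det d0.
have [M HM] := reft_bounded_ev P.
have bP : [bounded ev P x | x in @reft R].
  exists M; split; first by rewrite num_real.
  by move=> x Mx z rz; apply: le_trans (HM z rz) (ltW Mx).
have := @integral_affine R (grad2 F) (grad3 F) c d _ _ _ (@measurable_reft R) (leb2_reft R)
  (measurable_ev P) bP.
rewrite de invr_eq0 d0 Rintegral_reft -bE normfV invrK; exact.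
Qed.

(** Along the line through x in direction w the lift is a polynomial [q] in one variable, so the
    limit is q'(0), computed by the chain rule [deriv_sub2]. *)
Lemma D_lift (R : realType) (F : frame R) (P : bpoly R) (w : R * R) :
  (fun x => 'D_w (plift F P) x) =
  plift F ((dotp (grad2 F) w)%:P%:P * dpx P + (dotp (grad3 F) w)%:P%:P * dpy P).
Proof.
apply/funext => x.
pose q := sub2 ((bary F x).1%:P + (dotp (grad2 F) w)%:P * 'X)
  ((bary F x).2%:P + (dotp (grad3 F) w)%:P * 'X) P.
have qE s : plift F P (s *: w + x) = q.[s].
  rewrite /plift horner_sub2 !hornerE; congr ev.
  by rewrite /bary /dotp /= /GRing.scale /=; congr pair; ring.
transitivity ('D_1 (horner q) 0).
  rewrite /derive; apply: (congr1 (fun g : R -> R => lim (g @ 0^'))).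
  apply/funext => s /=.
  by rewrite qE -[x in plift F P x]add0r -(scale0r w) qE scaler1 addr0.
rewrite -derive1E -derivE deriv_sub2 /plift !evE !derivD !derivM !derivC !derivX.
rewrite !mul0r !add0r !mulr1 hornerD !hornerM !hornerC !horner_sub2 !hornerE.
by rewrite -!surjective_pairing ![_ * dotp _ _]mulrC.
Qed.

Lemma bdeg_ex (R : realType) (P : bpoly R) : exists m, bdeg m P.
Proof.
pose f (j : 'I_(size P)) := size P`_j.
exists (size P + \max_j f j)%N => i j ij.
have [js|sj] := ltnP j (size P); last by rewrite (nth_default _ sj) coef0.
rewrite nth_default //; have := leq_bigmax (F := f) (Ordinal js).
move=> h; apply: leq_trans h _; move: (\max_j _) ij => M; lia.
Qed.

(** Serves to pass between Cartesian and barycentric coordinates without raising the total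
    degree. *)
Lemma ev_comp (R : realType) m (P A B : bpoly R) :
  bdeg m P -> bdeg 1 A -> bdeg 1 B ->
  exists2 Q, bdeg m Q & forall z, ev Q z = ev P (ev A z, ev B z).
Proof.
move=> dP dA dB.
exists (\sum_(i < m.+1) \sum_(j < m.+1) ((P`_j)`_i)%:P%:P * (A ^+ i * B ^+ j)); last first.
  move=> z; rewrite {2}(bdegE dP) !ev_sum; apply: eq_bigr => i _.
  by rewrite !ev_sum; apply: eq_bigr => j _; rewrite !evE.
apply: bdeg_sum => i _; apply: bdeg_sum => j _.
have [ij|ij] := ltnP m (i + j); first by rewrite dP // mul0r; exact: bdeg0.
apply: (@bdegW _ (0 + (i * 1 + j * 1))); first by rewrite !muln1.
apply: bdegM; first exact: bdegC.
by apply: bdegM; apply: bdegXn.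
Qed.

Lemma Poly_leP (R : realType) m (f : R * R -> R) :
  Poly_le m f <-> exists2 P, bdeg m P & f = ev P.
Proof.
split=> [[c fE]|[P dP ->]].
  exists (\sum_(i < m.+1) \sum_(j < m.+1 | (i + j <= m)%N) (c i j)%:P%:P * (px ^+ i * py ^+ j)).
    apply: bdeg_sum => i _; apply: bdeg_sum => j ij.
    apply: (@bdegW _ (0 + (i * 1 + j * 1))); first by rewrite !muln1.
    apply: bdegM; first exact: bdegC.
    by apply: bdegM; apply: bdegXn; [exact: bdegX|exact: bdegY].
  apply/funext => z; rewrite fE ev_sum; apply: eq_bigr => i _.
  by rewrite ev_sum; apply: eq_bigr => j _; rewrite !evE mulrA.
exists (fun i j => (P`_j)`_i) => z; rewrite {1}(bdegE dP) ev_sum; apply: eq_bigr => i _.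
rewrite ev_sum [RHS]big_mkcond; apply: eq_bigr => j _; rewrite !evE mulrA.
by case: leqP => // ij; rewrite dP // !mul0r.
Qed.

Definition lin (R : realType) (a b c : R) : bpoly R :=
  c%:P%:P + a%:P%:P * px + b%:P%:P * py.

Lemma bdeg_lin (R : realType) (a b c : R) : bdeg 1 (lin a b c).
Proof.
apply: bdegD; first apply: bdegD; first exact: bdegC.
- by apply: (@bdegM _ 0 1); [exact: bdegC|exact: bdegX].
- by apply: (@bdegM _ 0 1); [exact: bdegC|exact: bdegY].
Qed.

Lemma Poly_le_lift (R : realType) (F : frame R) m P : bdeg m P -> Poly_le m (plift F P).
Proof.
move=> dP; apply/Poly_leP.
have [Q dQ QE] := ev_comp dP
  (bdeg_lin (grad2 F).1 (grad2 F).2 (- dotp (grad2 F) (fp1 F)))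
  (bdeg_lin (grad3 F).1 (grad3 F).2 (- dotp (grad3 F) (fp1 F))).
exists Q => //; apply/funext => z; rewrite QE /plift; congr ev.
by rewrite /bary /lin !evE /dotp /=; congr pair; ring.
Qed.

Lemma Poly_le_liftP (R : realType) (F : frame R) m f : fdet F != 0 -> Poly_le m f ->
  exists2 P, bdeg m P & f = plift F P.
Proof.
move=> d0 /Poly_leP[P dP ->].
have [Q dQ QE] := ev_comp dP
  (bdeg_lin (te3 F).1 (- (te2 F).1) (fp1 F).1) (bdeg_lin (te3 F).2 (- (te2 F).2) (fp1 F).2).
exists Q => //; apply/funext => x; rewrite /plift QE; congr ev.
rewrite -{1}(baryK d0 x) /unbary /lin !evE [LHS]surjective_pairing.
by congr pair; rewrite /= /GRing.scale /=; ring.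
Qed.

Lemma Poly_leD (R : realType) m (f g : R * R -> R) :
  Poly_le m f -> Poly_le m g -> Poly_le m (fun x => f x + g x).
Proof.
move=> /Poly_leP[P dP ->] /Poly_leP[Q dQ ->]; apply/Poly_leP.
by exists (P + Q); [exact: bdegD|apply/funext => z; rewrite evE].
Qed.

Lemma Poly_leM (R : realType) m n (f g : R * R -> R) :
  Poly_le m f -> Poly_le n g -> Poly_le (m + n) (fun x => f x * g x).
Proof.
move=> /Poly_leP[P dP ->] /Poly_leP[Q dQ ->]; apply/Poly_leP.
by exists (P * Q); [exact: bdegM|apply/funext => z; rewrite evE].
Qed.

Lemma Poly_leC (R : realType) m (c : R) : Poly_le m (fun=> c).
Proof.
by apply/Poly_leP; exists c%:P%:P; [exact: bdegC|apply/funext => z; rewrite evE].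
Qed.

Lemma Poly_leW (R : realType) m n (f : R * R -> R) : (m <= n)%N -> Poly_le m f -> Poly_le n f.
Proof. by move=> mn /Poly_leP[P dP ->]; apply/Poly_leP; exists P => //; exact: bdegW dP. Qed.

Definition polyf (R : realType) (f : R * R -> R) : Prop := exists m, Poly_le m f.

Lemma polyf_liftP (R : realType) (F : frame R) f : fdet F != 0 -> polyf f ->
  exists P, f = plift F P.
Proof. by move=> d0 [m /(Poly_le_liftP d0)[P _ ->]]; exists P. Qed.

Lemma polyf_lift (R : realType) (F : frame R) P : polyf (plift F P).
Proof. by have [m dP] := bdeg_ex P; exists m; exact: Poly_le_lift. Qed.

Lemma polyfD (R : realType) (f g : R * R -> R) :
  polyf f -> polyf g -> polyf (fun x => f x + g x).
Proof.
move=> [m pf] [n pg]; exists (maxn m n); apply: Poly_leD.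
  exact: Poly_leW (leq_maxl _ _) pf.
exact: Poly_leW (leq_maxr _ _) pg.
Qed.

Lemma polyfM (R : realType) (f g : R * R -> R) :
  polyf f -> polyf g -> polyf (fun x => f x * g x).
Proof. by move=> [m pf] [n pg]; exists (m + n)%N; exact: Poly_leM. Qed.

Lemma polyfC (R : realType) (c : R) : polyf (fun=> c).
Proof. by exists 0%N; exact: Poly_leC. Qed.

Lemma polyf_sum (R : realType) (I : Type) (r : seq I) (p : pred I) (F : I -> R * R -> R) :
  (forall i, p i -> polyf (F i)) -> polyf (fun x => \sum_(i <- r | p i) F i x).
Proof.
move=> H; elim: r => [|i r IH].
  by rewrite (_ : (fun _ => _) = fun=> 0); [exact: polyfC|apply/funext => x; rewrite big_nil].
case pi : (p i).
  rewrite (_ : (fun _ => _) = fun x => F i x + \sum_(i <- r | p i) F i x).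
    by apply: polyfD => //; exact: H.
  by apply/funext => x; rewrite big_cons pi.
by rewrite (_ : (fun _ => _) = fun x => \sum_(i <- r | p i) F i x) //; apply/funext => x;
   rewrite big_cons pi.
Qed.

(** In this frame the barycentric coordinates are the Cartesian ones, so statements on polynomial
    functions reduce to statements on lifts. *)
Definition frame0 (R : realType) : frame R := Frame (0, 0) (1, 0) (0, 1).

Lemma fdet_frame0 (R : realType) : fdet (frame0 R) != 0.
Proof.
rewrite (_ : fdet _ = 1) ?oner_eq0 // /fdet /det2 /te2 /te3 /=; ring.
Qed.

Lemma D_liftE (R : realType) (F : frame R) (P : bpoly R) (w x : R * R) :
  'D_w (plift F P) x =
  plift F ((dotp (grad2 F) w)%:P%:P * dpx P + (dotp (grad3 F) w)%:P%:P * dpy P) x.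
Proof. exact: (congr1 (fun h => h x) (D_lift F P w)). Qed.

Lemma polyf_D (R : realType) (f : R * R -> R) w : polyf f -> polyf (fun x => 'D_w f x).
Proof.
by move=> /(polyf_liftP (fdet_frame0 R))[P ->]; rewrite D_lift; exact: polyf_lift.
Qed.

Lemma DD_polyf (R : realType) (f g : R * R -> R) w : polyf f -> polyf g ->
  (fun x => 'D_w (fun y => f y + g y) x) = (fun x => 'D_w f x + 'D_w g x).
Proof.
move=> /(polyf_liftP (fdet_frame0 R))[P ->] /(polyf_liftP (fdet_frame0 R))[Q ->].
rewrite (_ : (fun y => _ + _) = plift (frame0 R) (P + Q)); last first.
  by apply/funext => y; rewrite /plift evE.
apply/funext => x; rewrite !D_liftE /plift !(dpxE, dpyE) !evE; ring.
Qed.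

(** * Matrix fields with traces on a single edge *)

(* The coefficients u_j in \sum_j u_j t_j t_j^T, as polynomials on the reference
   triangle; see [mfield]. *)
Record tfield (R : realType) := TField { tf1 : bpoly R; tf2 : bpoly R; tf3 : bpoly R }.

(* Locked, as unification would otherwise compare them as polynomials. *)
HB.lock Definition l1 (R : realType) : bpoly R := 1 - px - py.
HB.lock Definition l2 (R : realType) : bpoly R := px.
HB.lock Definition l3 (R : realType) : bpoly R := py.
HB.lock Definition b1 (R : realType) : bpoly R := l2 R * l3 R.
HB.lock Definition b2 (R : realType) : bpoly R := l3 R * l1 R.
HB.lock Definition b3 (R : realType) : bpoly R := l1 R * l2 R.

Lemma dpxD (R : realType) (P Q : bpoly R) : dpx (P + Q) = dpx P + dpx Q.
Proof. by rewrite dpxE. Qed.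
Lemma dpyD (R : realType) (P Q : bpoly R) : dpy (P + Q) = dpy P + dpy Q.
Proof. by rewrite dpyE. Qed.
Lemma dpxN (R : realType) (P : bpoly R) : dpx (- P) = - dpx P.
Proof. by rewrite dpxE. Qed.
Lemma dpyN (R : realType) (P : bpoly R) : dpy (- P) = - dpy P.
Proof. by rewrite dpyE. Qed.

Lemma dpxMn (R : realType) (P : bpoly R) n : dpx (P *+ n) = dpx P *+ n.
Proof. by rewrite dpxE. Qed.
Lemma dpyMn (R : realType) (P : bpoly R) n : dpy (P *+ n) = dpy P *+ n.
Proof. by rewrite dpyE. Qed.

Lemma bary_table (R : realType) :
  ((dpx (l1 R) = - 1) * (dpy (l1 R) = - 1) * (dpx (l2 R) = 1) * (dpy (l2 R) = 0) *
   (dpx (l3 R) = 0) * (dpy (l3 R) = 1) *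
   (dpx (b1 R) = l3 R) * (dpy (b1 R) = l2 R) * (dpx (b2 R) = - l3 R) *
   (dpy (b2 R) = l1 R - l3 R) * (dpx (b3 R) = l1 R - l2 R) * (dpy (b3 R) = - l2 R)) *
  ((tr1 (l1 R) = 0) * (tr1 (l2 R) = 1 - 'X) * (tr1 (l3 R) = 'X) *
   (tr1 (b1 R) = 'X - 'X ^+ 2) * (tr1 (b2 R) = 0) * (tr1 (b3 R) = 0)) *
  ((tr2 (l1 R) = 'X) * (tr2 (l2 R) = 0) * (tr2 (l3 R) = 1 - 'X) *
   (tr2 (b1 R) = 0) * (tr2 (b2 R) = 'X - 'X ^+ 2) * (tr2 (b3 R) = 0)) *
  ((tr3 (l1 R) = 1 - 'X) * (tr3 (l2 R) = 'X) * (tr3 (l3 R) = 0) *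
   (tr3 (b1 R) = 0) * (tr3 (b2 R) = 0) * (tr3 (b3 R) = 'X - 'X ^+ 2)).
Proof.
rewrite b1.unlock b2.unlock b3.unlock l1.unlock l2.unlock l3.unlock /tr1 /tr2 /tr3.
by do !split; rewrite ?dpxE ?dpyE ?sub2E; ring.
Qed.

Lemma tr1E (R : realType) :
  (forall P Q : bpoly R, tr1 (P + Q) = tr1 P + tr1 Q) *
  (forall P Q : bpoly R, tr1 (P * Q) = tr1 P * tr1 Q) *
  (forall P : bpoly R, tr1 (- P) = - tr1 P) *
  (forall (P : bpoly R) m, tr1 (P *+ m) = tr1 P *+ m).
Proof. by rewrite /tr1; do !split => *; rewrite sub2E. Qed.

Lemma tr2E (R : realType) :
  (forall P Q : bpoly R, tr2 (P + Q) = tr2 P + tr2 Q) *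
  (forall P Q : bpoly R, tr2 (P * Q) = tr2 P * tr2 Q) *
  (forall P : bpoly R, tr2 (- P) = - tr2 P) *
  (forall (P : bpoly R) m, tr2 (P *+ m) = tr2 P *+ m).
Proof. by rewrite /tr2; do !split => *; rewrite sub2E. Qed.

Lemma tr3E (R : realType) :
  (forall P Q : bpoly R, tr3 (P + Q) = tr3 P + tr3 Q) *
  (forall P Q : bpoly R, tr3 (P * Q) = tr3 P * tr3 Q) *
  (forall P : bpoly R, tr3 (- P) = - tr3 P) *
  (forall (P : bpoly R) m, tr3 (P *+ m) = tr3 P *+ m).
Proof. by rewrite /tr3; do !split => *; rewrite sub2E. Qed.

Definition zero_one (A : comNzRingType) :=
  (@mulr0 A, @mul0r A, @mulr1 A, @mul1r A, @addr0 A, @add0r A, @oppr0 A, @mulN1r A, @mulrN1 A,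
   @mul0rn A).

Lemma ev_bary (R : realType) z :
  (ev (l1 R) z = 1 - z.1 - z.2) * (ev (l2 R) z = z.1) * (ev (l3 R) z = z.2) *
  (ev (b1 R) z = z.1 * z.2) * (ev (b2 R) z = z.2 * (1 - z.1 - z.2)) *
  (ev (b3 R) z = (1 - z.1 - z.2) * z.1).
Proof. by rewrite b1.unlock b2.unlock b3.unlock l1.unlock l2.unlock l3.unlock !evE. Qed.

Lemma l1E (R : realType) : l1 R = 1 - l2 R - l3 R.
Proof. by rewrite l1.unlock l2.unlock l3.unlock. Qed.

Lemma bdegMW (R : realType) m n p (P Q : bpoly R) :
  bdeg m P -> bdeg n Q -> (m + n <= p)%N -> bdeg p (P * Q).
Proof. by move=> dP dQ mn; apply: bdegW mn (bdegM dP dQ). Qed.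

Lemma bdeg1 (R : realType) m : bdeg m (1 : bpoly R).
Proof. by have := @bdegC R m 1; rewrite !polyC1. Qed.

Lemma bdeg_l (R : realType) : [/\ bdeg 1 (l1 R), bdeg 1 (l2 R) & bdeg 1 (l3 R)].
Proof.
rewrite l1.unlock l2.unlock l3.unlock; split; [|exact: bdegX|exact: bdegY].
by apply: bdegB; [apply: bdegB; [exact: bdeg1|exact: bdegX]|exact: bdegY].
Qed.

Lemma bdeg_b (R : realType) :
  [/\ bdeg 2 (b1 R), bdeg 2 (b2 R) & bdeg 2 (b3 R)].
Proof.
rewrite b1.unlock b2.unlock b3.unlock.
by have [? ? ?] := bdeg_l R; split; exact: (@bdegM _ 1 1).
Qed.

Ltac tr1_ring := rewrite ?(dpxD, dpxN, dpxMn, dpxM, dpyD, dpyN, dpyMn, dpyM) ?bary_table ?zero_one ?tr1E ?bary_table; ring.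
Ltac tr2_ring := rewrite ?(dpxD, dpxN, dpxMn, dpxM, dpyD, dpyN, dpyMn, dpyM) ?bary_table ?zero_one ?tr2E ?bary_table; ring.
Ltac tr3_ring := rewrite ?(dpxD, dpxN, dpxMn, dpxM, dpyD, dpyN, dpyMn, dpyM) ?bary_table ?zero_one ?tr3E ?bary_table; ring.

(* The field \sum_j u_j t_j t_j^T belongs to the shape function space as soon as
   each u_j is a polynomial of degree k - 1 plus the j-th edge bubble times a
   polynomial of degree k - 2 that does not depend on j; see [mform_mfield]. *)
Definition shape (R : realType) (k : nat) (u : tfield R) : Prop :=
  exists q a1 a2 a3 : bpoly R,
  [/\ bdeg (k - 2) q, [/\ bdeg (k - 1) a1, bdeg (k - 1) a2 & bdeg (k - 1) a3] &
      u = TField (a1 + b1 R * q) (a2 + b2 R * q) (a3 + b3 R * q)].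

Definition tvert0 (R : realType) (u : tfield R) : Prop :=
  [/\ vert0 (tf1 u), vert0 (tf2 u) & vert0 (tf3 u)].

Definition nn1 (R : realType) (u : tfield R) := tr1 (tf2 u + tf3 u).
Definition nn2 (R : realType) (u : tfield R) := tr2 (tf3 u + tf1 u).
Definition nn3 (R : realType) (u : tfield R) := tr3 (tf1 u + tf2 u).
Definition tn1 (R : realType) (u : tfield R) := tr1 (aff1 (tf2 u) (tf3 u)).
Definition tn2 (R : realType) (u : tfield R) := tr2 (aff2 (tf3 u) (tf1 u)).
Definition tn3 (R : realType) (u : tfield R) := tr3 (aff3 (tf1 u) (tf2 u)).

Ltac edge_ring :=
  split; rewrite /nn1 /nn2 /nn3 /tn1 /tn2 /tn3 /aff1 /aff2 /aff3 /d1 /d2 /d3 /=;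
  [tr1_ring|tr2_ring|tr3_ring].

(* The only nonzero traces are those on the first edge, whose values f and g determine
   n^T tau n and the effective shear; see [one_edge_trace]. *)
Definition one_edge (R : realType) (k : nat) (u : tfield R) (f g : {poly R}) : Prop :=
  [/\ shape k u, tvert0 u, [/\ nn1 u = f, nn2 u = 0 & nn3 u = 0] &
      [/\ tn1 u = g, tn2 u = 0 & tn3 u = 0]].

Lemma bdeg_d (R : realType) m (P : bpoly R) : bdeg m P ->
  [/\ bdeg m.-1 (d1 P), bdeg m.-1 (d2 P) & bdeg m.-1 (d3 P)].
Proof.
move=> dP; have dx := bdeg_dpx dP; have dy := bdeg_dpy dP.
by split; [exact: bdegB|exact: bdegN|].
Qed.

(** [b1] vanishes on edges 2 and 3. Thanks to the sign of the first coefficient, the derivatives of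
    [b1 R * g] enter the shear there only through d1 + d3 = - d2 on edge 2 and d1 + d2 = - d3 on
    edge 3, which are tangential and hence zero. *)
Lemma edge_normal_field (R : realType) k (g : bpoly R) : (3 <= k)%N -> bdeg (k - 3) g ->
  one_edge k (TField (- b1 R * g) (b1 R * g) (b1 R * g))
    (tr1 (b1 R * g) *+ 2) (- tr1 ((dpx (b1 R * g) + dpy (b1 R * g))) *+ 2).
Proof.
move=> k3 dg; have [db1 _ _] := bdeg_b R.
split.
- exists 0, (- b1 R * g), (b1 R * g), (b1 R * g); rewrite !mulr0 !addr0.
  split=> //; first exact: bdeg0.
  split; apply: (@bdegMW _ 2 (k - 3)) => //; try lia; exact: bdegN.
- by split; split; rewrite /= !(evE, ev_bary) /=; ring.
- by edge_ring.
by edge_ring.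
Qed.

(** Supplies the constant shear, whereas the traces of [edge_shear_field] all vanish at one end
    point. The first coefficient is - b1 + b1 (l2 + l3), so l2 + l3 is the common factor required by
    [shape]; its degree 1 <= k - 2 uses 3 <= k. *)
Lemma edge_shear_field0 (R : realType) k : (3 <= k)%N ->
  one_edge k (TField (- (b1 R * l1 R)) (b2 R * (l2 R + l3 R)) (b3 R * (l2 R + l3 R))) 0 (2 : {poly R}).
Proof.
move=> k3; have [db1 db2 db3] := bdeg_b R.
split.
- exists (l2 R + l3 R), (- b1 R), 0, 0; split.
  + by have [_ ? ?] := bdeg_l R; apply: (@bdegW _ 1); [lia|exact: bdegD].
  + split; try exact: bdeg0; by apply: bdegN; apply: (@bdegW _ 2) => //; lia.
  + congr TField; last by ring. by rewrite l1E; ring. by ring.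
- by split; split; rewrite /= !(evE, ev_bary) /=; ring.
- by edge_ring.
by edge_ring.
Qed.

(** The terms in b1 g cancel in the normal trace on edge 1, and q repairs the shear: its
    coefficients 4 of l3 and 2 of l2 compensate the normal derivatives of b1 g on edges 2 and 3,
    while 2 b1 d1 g removes the derivative of g from edge 1, where 12 l3 g is left. *)
Lemma edge_shear_field (R : realType) k (g q : bpoly R) : (3 <= k)%N -> bdeg (k - 3) g ->
  q = g * (l2 R *+ 2 + l3 R *+ 4) + b1 R * d1 g *+ 2 ->
  one_edge k (TField (b1 R * q - b1 R * g *+ 3) (b1 R * g + b2 R * q)
                     (- (b1 R * g) + b3 R * q))
    0 (tr1 (l3 R * g) *+ 12).
Proof.
move=> k3 dg qE; have [db1 db2 db3] := bdeg_b R.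
have dq : bdeg (k - 2) q.
  rewrite qE; apply: bdegD.
    apply: (bdegMW dg (n := 1)); last by lia.
    by have [_ ? ?] := bdeg_l R; apply: bdegD; exact: bdegMn.
  apply: bdegMn; have [d1g _ _] := bdeg_d dg.
  (* The count 2 + (k - 4) = k - 2 fails with truncated subtraction when k = 3; but then g is
     constant and [d1 g] is zero. *)
  have [k4|k4] := leqP 4 k; first by apply: (bdegMW db1 d1g); lia.
  have -> : d1 g = 0.
    apply/polyP => j; apply/polyP => i; rewrite /d1 coefB coefB coef_dpx /dpy !coef_deriv.
    rewrite coefMn dg ?dg //; try lia; by rewrite !mul0rn subrr !coef0.
  by rewrite mulr0; exact: bdeg0.
have db1g : bdeg (k - 1) (b1 R * g) by apply: (bdegMW db1 dg); lia.
split.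
- exists q, (- (b1 R * g) *+ 3), (b1 R * g), (- (b1 R * g)); split=> //.
  + by split => //; [apply: bdegMn|]; exact: bdegN.
  + by congr TField; ring.
- by split; split; rewrite /= !(evE, ev_bary) /=; ring.
- by edge_ring.
have q1 : tr1 q = tr1 g * (2 + 'X *+ 2) + ('X - 'X ^+ 2) * tr1 (d1 g) *+ 2.
  by rewrite qE; tr1_ring.
have q2 : tr2 q = tr2 g * (1 - 'X) *+ 4 by rewrite qE; tr2_ring.
have q3 : tr3 q = tr3 g * 'X *+ 2 by rewrite qE; tr3_ring.
move: q1; rewrite /d1 ?tr1E => q1.
split; rewrite /tn1 /tn2 /tn3 /aff1 /aff2 /aff3 /d1 /d2 /d3 /=.
- rewrite ?(dpxD, dpxN, dpxMn, dpxM, dpyD, dpyN, dpyMn, dpyM) ?bary_table ?zero_one ?tr1E ?bary_table q1; ring.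
- rewrite ?(dpxD, dpxN, dpxMn, dpxM, dpyD, dpyN, dpyMn, dpyM) ?bary_table ?zero_one ?tr2E ?bary_table q2; ring.
- rewrite ?(dpxD, dpxN, dpxMn, dpxM, dpyD, dpyN, dpyMn, dpyM) ?bary_table ?zero_one ?tr3E ?bary_table q3; ring.
Qed.

(** The j-th edge bubble vanishes on the other two edges, and t_j is orthogonal to the normal of its
    own edge, so no normal trace is left; the shear retains only the derivatives of the two other
    bubbles. All interior bubbles below are instances. *)
Lemma bubble_trace (R : realType) (p q r : bpoly R) :
  let u := TField (b1 R * p) (b2 R * q) (b3 R * r) in
  ((nn1 u = 0) * (nn2 u = 0) * (nn3 u = 0)) *
  ((tn1 u = ('X * tr1 q + (1 - 'X) * tr1 r) *+ 2) *
   (tn2 u = ('X * tr2 r + (1 - 'X) * tr2 p) *+ 2) *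
   (tn3 u = ('X * tr3 p + (1 - 'X) * tr3 q) *+ 2)).
Proof.
rewrite /=; split; [|split; [split|]]; first by split; [split|];
  rewrite /nn1 /nn2 /nn3 /=; [tr1_ring|tr2_ring|tr3_ring].
- by rewrite /tn1 /aff1 /d1 /d2 /d3 /=; tr1_ring.
- by rewrite /tn2 /aff2 /d1 /d2 /d3 /=; tr2_ring.
by rewrite /tn3 /aff3 /d1 /d2 /d3 /=; tr3_ring.
Qed.

(** The second bubble factor kills the remaining shear of [bubble_trace]. The three factors are
    independent of each other because the degree 4 + (k - 5) = k - 1 calls for no common factor. *)
Lemma bubble_sq (R : realType) k (g1 g2 g3 : bpoly R) : (5 <= k)%N ->
  bdeg (k - 5) g1 -> bdeg (k - 5) g2 -> bdeg (k - 5) g3 ->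
  one_edge k (TField (b1 R * b1 R * g1) (b2 R * b2 R * g2) (b3 R * b3 R * g3)) 0 0.
Proof.
move=> k5 dg1 dg2 dg3; have [db1 db2 db3] := bdeg_b R.
have db b g : bdeg 2 b -> bdeg (k - 5) g -> bdeg (k - 1) (b * b * g).
  by move=> db dg; apply: (bdegMW (bdegM db db) dg); lia.
split.
- exists 0, (b1 R * b1 R * g1), (b2 R * b2 R * g2), (b3 R * b3 R * g3).
  by rewrite !mulr0 !addr0; split => //; [exact: bdeg0|split; exact: db].
- by split; split; rewrite /= !(evE, ev_bary) /=; ring.
- by rewrite -!mulrA !bubble_trace.
- rewrite -!mulrA !bubble_trace; split; [tr1_ring|tr2_ring|tr3_ring].
Qed.

(** As l2 + l3 = 1 - l1, the first field has the common factor l1^2 g of the maximal degree k - 2,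
    up to coefficients of degree k - 1. On edges 2 and 3 the two contributions in [bubble_trace] are
    opposite multiples of l1^2 (1 - l1) g, and on edge 1 the factor l1 vanishes. The other two
    fields arise by rotation. *)
Lemma bubble_top (R : realType) k (g : bpoly R) : (4 <= k)%N -> bdeg (k - 4) g ->
  [/\ one_edge k (TField (b1 R * (l1 R * l1 R * g)) (- (b2 R * (l1 R * (l2 R + l3 R) * g)))
        (- (b3 R * (l1 R * (l2 R + l3 R) * g)))) 0 0,
      one_edge k (TField (- (b1 R * (l2 R * (l3 R + l1 R) * g))) (b2 R * (l2 R * l2 R * g))
        (- (b3 R * (l2 R * (l3 R + l1 R) * g)))) 0 0 &
      one_edge k (TField (- (b1 R * (l3 R * (l1 R + l2 R) * g)))
        (- (b2 R * (l3 R * (l1 R + l2 R) * g))) (b3 R * (l3 R * l3 R * g))) 0 0].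
Proof.
move=> k4 dg; have [db1 db2 db3] := bdeg_b R; have [dl1 dl2 dl3] := bdeg_l R.
have dq l : bdeg 1 l -> bdeg (k - 2) (l * l * g).
  by move=> dl; apply: (bdegMW (bdegM dl dl) dg); lia.
have da b l : bdeg 2 b -> bdeg 1 l -> bdeg (k - 1) (- (b * l * g)).
  by move=> db dl; apply: bdegN; apply: (bdegMW (bdegM db dl) dg); lia.
have d0 m : bdeg m (0 : bpoly R) by exact: bdeg0.
have ll (l l' b : bpoly R) : l' = 1 - l ->
    - (b * (l * l' * g)) = - (b * l * g) + b * (l * l * g) by move=> ->; ring.
split; split.
- exists (l1 R * l1 R * g), 0, (- (b2 R * l1 R * g)), (- (b3 R * l1 R * g)).
  split; [exact: dq|by split; [exact: d0|exact: da|exact: da]|].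
  by rewrite add0r; congr TField; apply: ll; rewrite l1E; ring.
- by split; split; rewrite /= !(evE, ev_bary) /=; ring.
- by rewrite -!mulrN !bubble_trace.
- rewrite -!mulrN !bubble_trace; split; [tr1_ring|tr2_ring|tr3_ring].
- exists (l2 R * l2 R * g), (- (b1 R * l2 R * g)), 0, (- (b3 R * l2 R * g)).
  split; [exact: dq|by split; [exact: da|exact: d0|exact: da]|].
  by rewrite add0r; congr TField; apply: ll; rewrite l1E; ring.
- by split; split; rewrite /= !(evE, ev_bary) /=; ring.
- by rewrite -!mulrN !bubble_trace.
- rewrite -!mulrN !bubble_trace; split; [tr1_ring|tr2_ring|tr3_ring].
- exists (l3 R * l3 R * g), (- (b1 R * l3 R * g)), (- (b2 R * l3 R * g)), 0.
  split; [exact: dq|by split; [exact: da|exact: da|exact: d0]|].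
  by rewrite add0r; congr TField; apply: ll; rewrite l1E; ring.
- by split; split; rewrite /= !(evE, ev_bary) /=; ring.
- by rewrite -!mulrN !bubble_trace.
- rewrite -!mulrN !bubble_trace; split; [tr1_ring|tr2_ring|tr3_ring].
Qed.

(** * Positivity, definiteness and orthogonal projection *)

Lemma I1_ge0 (R : realType) (q : {poly R}) :
  (forall t, 0 <= t <= 1 -> 0 <= q.[t]) -> 0 <= I1 q.
Proof.
move=> q0; rewrite -Rintegral01; apply: Rintegral_ge0 => t /=.
by rewrite in_itv /=; exact: q0.
Qed.

Lemma I2_ge0 (R : realType) (P : bpoly R) :
  (forall z, reft z -> 0 <= ev P z) -> 0 <= I2 P.
Proof. by move=> P0; rewrite -Rintegral_reft; apply: Rintegral_ge0. Qed.

Lemma I2_le (R : realType) (P Q : bpoly R) :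
  (forall z, reft z -> ev P z <= ev Q z) -> I2 P <= I2 Q.
Proof.
move=> PQ; rewrite -subr_ge0 -I2B; apply: I2_ge0 => z rz.
by rewrite !evE subr_ge0 PQ.
Qed.

Lemma poly_itv_eq0 (R : realType) (p : {poly R}) (b : R) : 0 < b ->
  (forall t, 0 <= t < b -> p.[t] = 0) -> p = 0.
Proof.
move=> b0 H; apply/eqP; apply: contraT => p0.
pose rs := [seq b / (i.+2)%:R | i <- iota 0 (size p)].
suff : (size rs < size p)%N by rewrite size_map size_iota ltnn.
apply: max_poly_roots => //.
  apply/allP => x /mapP[i _ ->]; apply/rootP/H.
  rewrite divr_ge0 ?ler0n ?(ltW b0) //= ltr_pdivrMr ?ltr0n // -{1}[b]mulr1.
  by rewrite ltr_pM2l // ltr1n.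
rewrite map_inj_uniq ?iota_uniq // => i j /(mulfI (lt0r_neq0 b0)) /invr_inj /eqP.
by rewrite eqr_nat => /eqP [].
Qed.

(** The antiderivative is nondecreasing and takes the value 0 at both ends, so it vanishes on an
    interval and is the zero polynomial. *)
Lemma prim_eq0 (R : realType) (r : {poly R}) (b : R) : 0 < b ->
  (forall t, 0 <= t <= b -> 0 <= r.[t]) -> (prim r).[b] = 0 -> r = 0.
Proof.
move=> b0 r0 rb.
have G0 : (prim r).[0] = 0 by rewrite horner_coef0 coef_prim invr0 mul0r.
have step s t : 0 <= s -> s <= t -> t <= b -> (prim r).[s] <= (prim r).[t].
  move=> s0 st tb; rewrite -subr_ge0.
  pose a : {poly R} := s%:P + (t - s)%:P * 'X.
  have aE u : a.[u] = s + (t - s) * u by rewrite /a hornerD hornerM !hornerC hornerX.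
  have e : I1 ((prim r \Po a)^`()) = (prim r).[t] - (prim r).[s].
    by rewrite I1_deriv !horner_comp !aE; congr (_.[_] - _.[_]); ring.
  have a' : a^`() = (t - s)%:P.
    by rewrite /a derivD derivM !derivC derivX mul0r !add0r mulr1.
  rewrite -e deriv_comp deriv_prim a'; apply: I1_ge0 => u /andP[u0 u1].
  rewrite hornerM horner_comp aE hornerC mulr_ge0 // ?subr_ge0 //.
  by apply: r0; apply/andP; split; nra.
have G : prim r = 0.
  apply: (poly_itv_eq0 b0) => t /andP[t0 tb]; apply/eqP; rewrite eq_le.
  have h1 := step t b t0 (ltW tb) (lexx b); rewrite rb in h1.
  have h2 := step 0 t (lexx 0) t0 (ltW tb); rewrite G0 in h2.
  by rewrite h1.
by rewrite -[r]deriv_prim G deriv0.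
Qed.

Lemma I1_eq0 (R : realType) (r : {poly R}) :
  (forall t, 0 <= t <= 1 -> 0 <= r.[t]) -> I1 r = 0 -> r = 0.
Proof. by move=> r0; apply: prim_eq0. Qed.

(** The inner integral is a nonnegative polynomial in x with zero integral, hence zero. So every
    slice over [0, 1) is zero by [prim_eq0], and each coefficient of P has infinitely many roots. *)
Lemma I2_eq0 (R : realType) (P : bpoly R) :
  (forall z, reft z -> 0 <= ev P z) -> I2 P = 0 -> P = 0.
Proof.
move=> P0.
have slice x : (sub2 'X (1 - 'X) (primy P)).[x] = (prim (map_poly (horner_eval x) P)).[1 - x].
  rewrite horner_sub2 !hornerE -horner_slice; congr horner.
  apply/polyP => i; rewrite coef_prim !coef_map /= coef_primy.
  by rewrite /horner_eval hornerM hornerC.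
have pos x t : 0 <= x -> 0 <= t <= 1 - x -> 0 <= (map_poly (horner_eval x) P).[t].
  by move=> x0 /andP[t0 t1]; rewrite horner_slice; apply: P0; split=> //=; lra.
move=> /I1_eq0 E; have {}E : sub2 'X (1 - 'X) (primy P) = 0.
  apply: E => x /andP[x0 x1]; rewrite slice.
  rewrite -Rintegral_poly ?subr_ge0 //; apply: Rintegral_ge0 => t /=.
  by rewrite in_itv /=; exact: pos.
apply/polyP => j; rewrite coef0.
apply: (@poly_itv_eq0 _ _ 1) => // x /andP[x0 x1].
have x1' : 0 < 1 - x by rewrite subr_gt0.
have Ex := slice x; rewrite E horner0 in Ex.
have := prim_eq0 x1' (fun t => pos x t x0) (esym Ex).
by move=> /(congr1 (fun q : {poly R} => q`_j)); rewrite coef_map coef0.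
Qed.

Lemma I2_sqr_eq0 (R : realType) (P : bpoly R) : I2 (P * P) = 0 -> P = 0.
Proof.
move=> /I2_eq0 H; have : P * P = 0 by apply: H => z _; rewrite evE -expr2 sqr_ge0.
by move/eqP; rewrite mulf_eq0 orbb => /eqP.
Qed.

Lemma I2_sqr_ge0 (R : realType) (P : bpoly R) : 0 <= I2 (P * P).
Proof. by apply: I2_ge0 => z _; rewrite evE -expr2 sqr_ge0. Qed.

(** Duality of subspaces and annihilators; the columns of [cokermx B] serve as test vectors. *)
Lemma submx_coker (F : fieldType) m n p (A : 'M[F]_(m, n)) (B : 'M[F]_(p, n)) :
  (forall c : 'cV_n, B *m c = 0 -> A *m c = 0) -> (A <= B)%MS.
Proof.
move=> H; rewrite submxE; apply/eqP/matrixP => i j.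
have : A *m (cokermx B *m delta_mx j (0 : 'I_1)) = 0.
  by apply: H; rewrite mulmxA mulmx_coker mul0mx.
by rewrite mulmxA -colE => /matrixP/(_ i ord0); rewrite !mxE.
Qed.

(** The normal equations are solvable even for dependent e_i: a kernel vector of the Gram matrix
    gives a combination w with [I2 (w * w)] equal to 0, so w = 0 and the right-hand side is
    annihilated as well. *)
Lemma orth_proj (R : realType) n (e : 'I_n -> bpoly R) (V : bpoly R) :
  exists x : 'I_n -> R, forall j, I2 ((V - \sum_i (x i)%:P%:P * e i) * e j) = 0.
Proof.
pose G : 'M[R]_n := \matrix_(i, j) I2 (e i * e j).
pose b : 'rV[R]_n := \row_j I2 (V * e j).
have lin (c : 'I_n -> R) W : I2 (W * \sum_i (c i)%:P%:P * e i) = \sum_i c i * I2 (W * e i).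
  by rewrite mulr_sumr I2_sum; apply: eq_bigr => i _; rewrite mulrCA I2Z.
have : (b <= G)%MS.
  apply: submx_coker => c Gc.
  pose w := \sum_i (c i 0)%:P%:P * e i.
  have w0 : w = 0.
    apply: I2_sqr_eq0; rewrite {1}/w mulr_suml I2_sum big1 // => i _.
    rewrite -mulrA I2Z {1}/w lin.
    have := congr1 (fun m : 'cV_n => m i 0) Gc; rewrite !mxE => E.
    rewrite (_ : \sum_j _ = 0) ?mulr0 // -[RHS]E; apply: eq_bigr => l _.
    by rewrite mxE mulrC.
  apply/matrixP => i j; rewrite !ord1 !mxE.
  have := lin (fun i => c i 0) V; rewrite -/w w0 mulr0 I2_0 => E.
  by rewrite [RHS]E; apply: eq_bigr => l _; rewrite !mxE mulrC.
move/submxP => [D bD]; exists (fun i => D 0 i) => j.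
rewrite mulrBl I2B; apply/eqP; rewrite subr_eq0; apply/eqP.
have := congr1 (fun m : 'rV_n => m 0 j) bD; rewrite !mxE => ->.
rewrite mulr_suml I2_sum; apply: eq_bigr => i _.
by rewrite !mxE -mulrA I2Z.
Qed.

(* Finitely many elements of S suffice to detect the vectors orthogonal to S. *)
Lemma test_family (F : fieldType) n (S : 'cV[F]_n -> Prop) :
  exists M (A : 'M[F]_(n, M)), (forall j, S (col j A)) /\
    forall x : 'rV_n, x *m A = 0 -> forall a, S a -> x *m a = 0.
Proof.
pose P r := `[< exists M (A : 'M[F]_(n, M)), (forall j, S (col j A)) /\ \rank A = r >].
have P0 : exists r, P r.
  by exists 0%N; apply/asboolP; exists 0%N, 0; split; [case|rewrite mxrank0].
have Pn r : P r -> (r <= n)%N.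
  by move=> /asboolP[M [A [_ <-]]]; exact: rank_leq_row.
have [r /asboolP[M [A [SA rA]]] rmax] := ex_maxnP P0 Pn.
exists M, A; split=> // x xA a Sa.
(* A has maximal rank among matrices with columns in S, so appending the column a cannot enlarge its
   column space. *)
have : (a^T <= A^T)%MS.
  have sA : (A^T <= col_mx A^T a^T)%MS by rewrite -addsmxE addsmxSl.
  have : (\rank (col_mx A^T a^T) <= \rank A^T)%N.
    rewrite mxrank_tr rA; apply: rmax; apply/asboolP.
    exists (M + 1)%N, (row_mx A a); split; last first.
      by rewrite -[RHS]mxrank_tr tr_col_mx !trmxK.
    move=> j; case: (split_ordP j) => i ->.
      by rewrite colKl; exact: SA.
    by rewrite colKr [col i a](_ : _ = a) //; apply/matrixP => u v; rewrite mxE !ord1.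
  move=> rk; have := mxrank_leqif_sup sA; rewrite /leqif.
  move=> [le1 E]; have : (col_mx A^T a^T <= A^T)%MS.
    by rewrite -E eqn_leq le1 rk.
  by move/(submx_trans _); apply; rewrite -addsmxE addsmxSr.
move=> /submxP[D aD]; rewrite -[a]trmxK aD trmx_mul trmxK mulmxA xA mul0mx //.
Qed.

(** * Interior bubbles detect second derivatives *)

Lemma coefXM_dpx (R : realType) (q : bpoly R) i j :
  ((px * dpx q)`_j)`_i = (q`_j)`_i *+ i.
Proof.
rewrite coefCM coefXM coef_dpx; case: i => [|i] /=; first by rewrite mulr0n.
by rewrite coef_deriv.
Qed.

Lemma coefYM_dpy (R : realType) (q : bpoly R) i j :
  ((py * dpy q)`_j)`_i = (q`_j)`_i *+ j.
Proof.
rewrite coefXM /dpy; case: j => [|j] /=; first by rewrite coef0 mulr0n.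
by rewrite coef_deriv coefMn.
Qed.

(** Euler's identity cancels the homogeneous part of degree m. *)
Lemma euler_bdeg (R : realType) m (q : bpoly R) : bdeg m q ->
  bdeg m.-1 (px * dpx q + py * dpy q - q *+ m).
Proof.
move=> dq i j ij; rewrite !coefB !coefD coefXM_dpx coefYM_dpy !coefMn.
have [e|ne] := eqVneq (i + j)%N m; first by rewrite -mulrnDr e subrr.
by rewrite dq ?mul0rn ?addr0 ?subr0 //; lia.
Qed.

Definition divdiv_ref (R : realType) (u : tfield R) : bpoly R :=
  d1 (d1 (tf1 u)) + d2 (d2 (tf2 u)) + d3 (d3 (tf3 u)).

(** On the reference triangle the sum of b_j t_j t_j^T is diag(x, y) - x x^T. The divdiv of q
    diag(x, y) has degree m - 1, and with Euler's operator [th] that of q x x^T is (th + 2)(th + 3)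
    q, whose leading part is (m + 2)(m + 3) times that of q. *)
Lemma divdiv_top (R : realType) m (q : bpoly R) : (0 < m)%N -> bdeg m q ->
  bdeg m.-1 (divdiv_ref (TField (b1 R * q) (b2 R * q) (b3 R * q))
             + q *+ ((m + 2) * (m + 3))).
Proof.
move=> m0 dq; pose th (p : bpoly R) : bpoly R := px * dpx p + py * dpy p.
have dth p n : bdeg n p -> bdeg n (th p).
  move=> dp; apply: bdegD.
    have [n0|n0] := posnP n.
      rewrite (_ : dpx p = 0) ?mulr0; first exact: bdeg0.
      apply/polyP => j; apply/polyP => i; rewrite coef_dpx coef_deriv !coef0 dp ?mul0rn //.
      by rewrite n0; lia.
    by apply: (bdegMW (bdegX R) (bdeg_dpx dp)); lia.
  have [n0|n0] := posnP n.
    rewrite (_ : dpy p = 0) ?mulr0; first exact: bdeg0.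
    apply/polyP => j; apply/polyP => i; rewrite coef_deriv coefMn !coef0 dp ?mul0rn //.
    by rewrite n0; lia.
  by apply: (bdegMW (bdegY R) (bdeg_dpy dp)); lia.
have E := euler_bdeg dq; have E2 := dth _ _ E.
have Ey : bdeg m.-1 (dpy (dpy (py * q))).
  have := bdeg_dpy (bdeg_dpy (bdegM (bdegY R) dq)).
  by apply: bdegW; lia.
have Ex : bdeg m.-1 (dpx (dpx (px * q))).
  have := bdeg_dpx (bdeg_dpx (bdegM (bdegX R) dq)).
  by apply: bdegW; lia.
(* (th + 2)(th + 3) q is expanded with [th q] replaced by m q plus the defect [th q - q *+ m], which
   has degree m - 1. *)
have -> : divdiv_ref (TField (b1 R * q) (b2 R * q) (b3 R * q)) + q *+ ((m + 2) * (m + 3)) =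
  dpy (dpy (py * q)) + dpx (dpx (px * q)) - th (th q - q *+ m) - (th q - q *+ m) *+ (m + 5).
  rewrite /divdiv_ref /th /d1 /d2 /d3 b1.unlock b2.unlock b3.unlock l1.unlock l2.unlock l3.unlock /=.
  rewrite !(dpxD, dpxN, dpxMn, dpxM, dpyD, dpyN, dpyMn, dpyM).
  have e : (dpx px = 1 :> bpoly R) * (dpy px = 0 :> bpoly R) * (dpx py = 0 :> bpoly R) *
           (dpy py = 1 :> bpoly R) * (dpx 1 = 0 :> bpoly R) * (dpy 1 = 0 :> bpoly R) *
           (dpx 0 = 0 :> bpoly R) * (dpy 0 = 0 :> bpoly R).
    by rewrite !dpxE !dpyE.
  rewrite !(dpxD, dpxN, dpxMn, dpxM, dpyD, dpyN, dpyMn, dpyM, e) dpxyC; ring.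
apply: bdegB; last exact: bdegMn.
by apply: bdegB => //; apply: bdegD.
Qed.

Definition mono (R : realType) (i j : nat) : bpoly R := px ^+ i * py ^+ j.

Lemma bdeg_mono (R : realType) i j : bdeg (i + j) (mono R i j).
Proof. by apply: bdegM; rewrite -[X in bdeg X]muln1; apply: bdegXn; [exact: bdegX|exact: bdegY]. Qed.

Lemma bdegZ (R : realType) m c (P : bpoly R) : bdeg m P -> bdeg m (c%:P%:P * P).
Proof. by move=> dP; apply: (@bdegM _ 0) => //; exact: bdegC. Qed.

(* The squares of the barycentric coordinates span the quadratic forms. *)
Lemma squares_top (R : realType) k (z : bpoly R) : (4 <= k)%N -> bdeg (k - 2) z ->
  exists g1 g2 g3, [/\ bdeg (k - 4) g1, bdeg (k - 4) g2, bdeg (k - 4) g3 &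
    bdeg (k - 3) (l1 R * l1 R * g1 + l2 R * l2 R * g2 + l3 R * l3 R * g3 - z)].
Proof.
move=> k4 dz.
pose T (z : bpoly R) := exists g1 g2 g3, [/\ bdeg (k - 4) g1, bdeg (k - 4) g2, bdeg (k - 4) g3 &
    bdeg (k - 3) (l1 R * l1 R * g1 + l2 R * l2 R * g2 + l3 R * l3 R * g3 - z)].
have d0 m : bdeg m (0 : bpoly R) by exact: bdeg0.
have TD P Q : T P -> T Q -> T (P + Q).
  move=> [g1 [g2 [g3 [a b c d]]]] [h1 [h2 [h3 [a' b' c' d']]]].
  exists (g1 + h1), (g2 + h2), (g3 + h3); split; try exact: bdegD.
  set X := (X in bdeg _ X); rewrite (_ : X = (l1 R * l1 R * g1 + l2 R * l2 R * g2 + l3 R * l3 R * g3 - P) + (l1 R * l1 R * h1 + l2 R * l2 R * h2 + l3 R * l3 R * h3 - Q)); last by rewrite /X; ring.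
  exact: bdegD.
have TZ c P : T P -> T (c%:P%:P * P).
  move=> [g1 [g2 [g3 [a b e d]]]].
  exists (c%:P%:P * g1), (c%:P%:P * g2), (c%:P%:P * g3); split; try exact: bdegZ.
  set X := (X in bdeg _ X); rewrite (_ : X = c%:P%:P * (l1 R * l1 R * g1 + l2 R * l2 R * g2 + l3 R * l3 R * g3 - P)); last by rewrite /X; ring.
  exact: bdegZ.
have Tlow P : bdeg (k - 3) P -> T P.
  move=> dP; exists 0, 0, 0; split=> //; rewrite !mulr0 !addr0 sub0r; exact: bdegN.
have T2 i j : (i + j + 2 = k - 2)%N -> T (mono R i.+2 j).
  move=> ij; exists 0, (mono R i j), 0; split=> //.
    by refine (bdegW _ (@bdeg_mono R i j)); lia.
  rewrite !mulr0 add0r addr0 l2.unlock /mono !exprS.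
  by rewrite (_ : _ - _ = 0) //; ring.
have T3 i j : (i + j + 2 = k - 2)%N -> T (mono R i j.+2).
  move=> ij; exists 0, 0, (mono R i j); split=> //.
    by refine (bdegW _ (@bdeg_mono R i j)); lia.
  rewrite !mulr0 add0r add0r l3.unlock /mono !exprS.
  by rewrite (_ : _ - _ = 0) //; ring.
(* A monomial of degree k - 2 is divisible by x^2 or y^2, except for x y when k = 4. There 2 x y
   equals l1^2 - l2^2 - l3^2 up to degree one. *)
have T1 : k = 4%N -> T (mono R 1 1).
  move=> k4'; exists (2^-1%:P%:P), (- 2^-1%:P%:P), (- 2^-1%:P%:P).
  have dc : bdeg (k - 4) (2^-1%:P%:P : bpoly R) by exact: bdegC.
  split; [exact: dc|exact: bdegN|exact: bdegN|].
  have h2 : (2^-1%:P%:P : bpoly R) * 2 = 1.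
    by rewrite -(rmorph_nat (@polyC _)) -(rmorph_nat (@polyC _)) -!polyCM mulVf ?pnatr_eq0.
  rewrite l1.unlock l2.unlock l3.unlock.
  have XE (h x y : bpoly R) : (1 - x - y) * (1 - x - y) * h + x * x * (- h) + y * y * (- h)
      - x ^+ 1 * y ^+ 1 = h * (1 - x *+ 2 - y *+ 2) + (h * 2 - 1) * (x * y) by ring.
  rewrite /mono XE.
  rewrite h2 subrr mul0r addr0; apply: bdegZ; rewrite k4'.
  by apply: bdegB; [apply: bdegB; [exact: bdeg1|apply: bdegMn; exact: bdegX]|apply: bdegMn; exact: bdegY].
rewrite -/(T z) (bdegE dz); apply: big_ind => // [|i _]; first exact: Tlow.
apply: big_ind => // [|j _]; first exact: Tlow.
have [ij|ij] := ltnP (k - 2) (i + j).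
  by rewrite dz // mul0r; exact: Tlow.
apply: TZ; rewrite -/(mono R i j); have [lo|hi] := leqP (i + j) (k - 3).
  by apply: Tlow; apply: bdegW lo (@bdeg_mono R i j).
move: (nat_of_ord i) (nat_of_ord j) ij hi => {i j} [|[|i]] [|[|j]] ij hi; try lia.
- by apply: T3; lia.
- by apply: T1; lia.
- by apply: T3; lia.
- by apply: T2; lia.
- by apply: T2; lia.
- by apply: T2; lia.
Qed.

(** The field tested against the Hessian of V, that is the volume term of Green's formula. *)
Definition pairing (R : realType) (u : tfield R) (V : bpoly R) : R :=
  I2 (tf1 u * d1 (d1 V) + tf2 u * d2 (d2 V) + tf3 u * d3 (d3 V)).

Lemma green_edge (R : realType) k (u : tfield R) f g (V : bpoly R) : one_edge k u f g ->
  I2 (divdiv_ref u * V) *+ 2 = pairing u V *+ 2 +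
    (I1 (f * tr1 (d2 V - d3 V)) - I1 (g * tr1 V)).
Proof.
case=> _ [v1 v2 v3] [n1 n2 n3] [t1 t2 t3].
rewrite /divdiv_ref /pairing (green _ v1 v2 v3).
move: n1 n2 n3 t1 t2 t3; rewrite /nn1 /nn2 /nn3 /tn1 /tn2 /tn3 => -> -> -> -> -> ->.
by rewrite !mul0r I1_0 !subrr !addr0.
Qed.

Lemma green_bubble (R : realType) k (u : tfield R) (V : bpoly R) : one_edge k u 0 0 ->
  I2 (divdiv_ref u * V) = pairing u V.
Proof.
move=> /(green_edge V); rewrite !mul0r I1_0 subrr addr0 => /eqP.
by rewrite eqrMn2r /= => /eqP.
Qed.

Lemma bdeg0_d (R : realType) (P : bpoly R) : bdeg 0 P -> dpx P = 0 /\ dpy P = 0.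
Proof.
move=> dP; split; apply/polyP => j; apply/polyP => i.
  by rewrite coef_dpx coef_deriv !coef0 dP ?mul0rn //; lia.
by rewrite /dpy coef_deriv coefMn !coef0 dP ?mul0rn //; lia.
Qed.

Definition tfD (R : realType) (u v : tfield R) : tfield R :=
  TField (tf1 u + tf1 v) (tf2 u + tf2 v) (tf3 u + tf3 v).
Definition tfZ (R : realType) (c : R) (u : tfield R) : tfield R :=
  TField (c%:P%:P * tf1 u) (c%:P%:P * tf2 u) (c%:P%:P * tf3 u).
Definition tf0 (R : realType) : tfield R := TField 0 0 0.

Lemma vert0D (R : realType) (P Q : bpoly R) : vert0 P -> vert0 Q -> vert0 (P + Q).
Proof. by case=> a b c [a' b' c']; split; rewrite evE ?(a, b, c) ?(a', b', c') addr0. Qed.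

Lemma vert0Z (R : realType) c (P : bpoly R) : vert0 P -> vert0 (c%:P%:P * P).
Proof. by case=> a b e; split; rewrite evE ?(a, b, e) mulr0. Qed.

Lemma aff1D (R : realType) (x x' y y' : bpoly R) :
  aff1 (x + x') (y + y') = aff1 x y + aff1 x' y'.
Proof. by rewrite /aff1 /d1 /d2 /d3 !(dpxD, dpyD, dpxN, dpyN); ring. Qed.
Lemma aff2D (R : realType) (x x' y y' : bpoly R) :
  aff2 (x + x') (y + y') = aff2 x y + aff2 x' y'.
Proof. by rewrite /aff2 /d1 /d2 /d3 !(dpxD, dpyD, dpxN, dpyN); ring. Qed.
Lemma aff3D (R : realType) (x x' y y' : bpoly R) :
  aff3 (x + x') (y + y') = aff3 x y + aff3 x' y'.
Proof. by rewrite /aff3 /d1 /d2 /d3 !(dpxD, dpyD, dpxN, dpyN); ring. Qed.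

Lemma dpxZ (R : realType) c (P : bpoly R) : dpx (c%:P%:P * P) = c%:P%:P * dpx P.
Proof. by rewrite dpxM (dpxE R).1.2 mul0r add0r. Qed.
Lemma dpyZ (R : realType) c (P : bpoly R) : dpy (c%:P%:P * P) = c%:P%:P * dpy P.
Proof. by rewrite dpyM (dpyE R).1.2 mul0r add0r. Qed.

Lemma aff1Z (R : realType) c (x y : bpoly R) :
  aff1 (c%:P%:P * x) (c%:P%:P * y) = c%:P%:P * aff1 x y.
Proof. by rewrite /aff1 /d1 /d2 /d3 !(dpxD, dpyD, dpxN, dpyN, dpxZ, dpyZ); ring. Qed.
Lemma aff2Z (R : realType) c (x y : bpoly R) :
  aff2 (c%:P%:P * x) (c%:P%:P * y) = c%:P%:P * aff2 x y.
Proof. by rewrite /aff2 /d1 /d2 /d3 !(dpxD, dpyD, dpxN, dpyN, dpxZ, dpyZ); ring. Qed.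
Lemma aff3Z (R : realType) c (x y : bpoly R) :
  aff3 (c%:P%:P * x) (c%:P%:P * y) = c%:P%:P * aff3 x y.
Proof. by rewrite /aff3 /d1 /d2 /d3 !(dpxD, dpyD, dpxN, dpyN, dpxZ, dpyZ); ring. Qed.

Lemma one_edgeD (R : realType) k (u v : tfield R) f g f' g' :
  one_edge k u f g -> one_edge k v f' g' -> one_edge k (tfD u v) (f + f') (g + g').
Proof.
case=> [[q [a1 [a2 [a3 [dq [da1 da2 da3] uE]]]]] [x1 x2 x3] [n1 n2 n3] [t1 t2 t3]].
case=> [[q' [a1' [a2' [a3' [dq' [da1' da2' da3'] vE]]]]] [x1' x2' x3'] [n1' n2' n3'] [t1' t2' t3']].
split.
- exists (q + q'), (a1 + a1'), (a2 + a2'), (a3 + a3'); split; try exact: bdegD.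
    by split; exact: bdegD.
  by rewrite uE vE /tfD /=; congr TField; ring.
- by split; exact: vert0D.
- have tE (a b : {poly R}) (x y x' y' : bpoly R) :
      sub2 a b ((x + x') + (y + y')) = sub2 a b (x + y) + sub2 a b (x' + y').
    by rewrite !sub2E; ring.
  rewrite /nn1 /nn2 /nn3 /tr1 /tr2 /tr3 !tE.
  move: n1 n2 n3 n1' n2' n3'; rewrite /nn1 /nn2 /nn3 /tr1 /tr2 /tr3.
  by move=> -> -> -> -> -> ->; rewrite !addr0.
- have D (a b : {poly R}) x y : sub2 a b (x + y) = sub2 a b x + sub2 a b y by rewrite sub2E.
  move: t1 t2 t3 t1' t2' t3'; rewrite /tn1 /tn2 /tn3 /= aff1D aff2D aff3D /tr1 /tr2 /tr3.
  by rewrite !(D _ _ (aff1 _ _)) !(D _ _ (aff2 _ _)) !(D _ _ (aff3 _ _))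
    => -> -> -> -> -> ->; rewrite !addr0.
Qed.

Lemma one_edgeZ (R : realType) k (u : tfield R) f g c :
  one_edge k u f g -> one_edge k (tfZ c u) (c%:P * f) (c%:P * g).
Proof.
case=> [[q [a1 [a2 [a3 [dq [da1 da2 da3] uE]]]]] [x1 x2 x3] [n1 n2 n3] [t1 t2 t3]].
split.
- exists (c%:P%:P * q), (c%:P%:P * a1), (c%:P%:P * a2), (c%:P%:P * a3).
  split; [exact: bdegZ|by split; exact: bdegZ|].
  by rewrite uE /tfZ /=; congr TField; ring.
- by split; exact: vert0Z.
- have tE (a b : {poly R}) (x y : bpoly R) :
      sub2 a b (c%:P%:P * x + c%:P%:P * y) = c%:P * sub2 a b (x + y).
    by rewrite -mulrDr rmorphM /= sub2C comp_polyC.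
  move: n1 n2 n3; rewrite /nn1 /nn2 /nn3 /tr1 /tr2 /tr3 !tE.
  by move=> -> -> ->; rewrite !mulr0.
- have D (a b : {poly R}) y : sub2 a b (c%:P%:P * y) = c%:P * sub2 a b y.
    by rewrite rmorphM /= sub2C comp_polyC.
  move: t1 t2 t3; rewrite /tn1 /tn2 /tn3 /= aff1Z aff2Z aff3Z /tr1 /tr2 /tr3 !D.
  by move=> -> -> ->; rewrite !mulr0.
Qed.

Lemma bdeg_dd (R : realType) m (P : bpoly R) : bdeg m P ->
  [/\ bdeg (m - 2) (d1 (d1 P)), bdeg (m - 2) (d2 (d2 P)) & bdeg (m - 2) (d3 (d3 P))].
Proof.
move=> dP; have [a b c] := bdeg_d dP.
have [a' _ _] := bdeg_d a; have [_ b' _] := bdeg_d b; have [_ _ c'] := bdeg_d c.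
have e : m.-1.-1 = (m - 2)%N by lia.
by rewrite -e.
Qed.

Lemma bdeg1_dd (R : realType) (P : bpoly R) : bdeg 1 P ->
  [/\ d1 (d1 P) = 0, d2 (d2 P) = 0 & d3 (d3 P) = 0].
Proof.
move=> dP; have [a b c] := bdeg_d dP.
have [xa ya] := bdeg0_d a; have [xb yb] := bdeg0_d b; have [xc yc] := bdeg0_d c.
by split; [rewrite [LHS]/d1 xa ya subrr|rewrite [LHS]/d2 yb oppr0|rewrite [LHS]/d3 xc].
Qed.

Lemma pairingD (R : realType) (u : tfield R) V W :
  pairing u (V + W) = pairing u V + pairing u W.
Proof. by rewrite -I2D; congr I2; rewrite /d1 /d2 /d3 !(dpxD, dpyD, dpxN, dpyN); ring. Qed.

Lemma pairingZ (R : realType) (u : tfield R) c V :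
  pairing u (c%:P%:P * V) = c * pairing u V.
Proof.
rewrite -I2Z; congr I2; rewrite /d1 /d2 /d3 !(dpxD, dpyD, dpxN, dpyN, dpxZ, dpyZ); ring.
Qed.

Lemma pairingZl (R : realType) (u : tfield R) c V :
  pairing (tfZ c u) V = c * pairing u V.
Proof. by rewrite -I2Z; congr I2; rewrite /tfZ /=; ring. Qed.

Lemma orth_proj_bdeg (R : realType) m (V : bpoly R) :
  exists2 w, bdeg m w & forall Q, bdeg m Q -> I2 ((V - w) * Q) = 0.
Proof.
pose T := ('I_m.+1 * 'I_m.+1)%type.
(* The index set is the full square of exponents; those of too large total degree are sent to 0, and
   [orth_proj] accepts such dependent families. *)
pose e (t : 'I_#|{: T}|) : bpoly R :=
  let ij := enum_val t in if (ij.1 + ij.2 <= m)%N then mono R ij.1 ij.2 else 0.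
have [x xE] := orth_proj e V; exists (\sum_i (x i)%:P%:P * e i).
  apply: bdeg_sum => i _; apply: bdegZ; rewrite /e; case: ifP => h; last exact: bdeg0.
  exact: bdegW h (@bdeg_mono R _ _).
move=> Q dQ; rewrite (bdegE dQ) mulr_sumr I2_sum big1 // => i _.
rewrite mulr_sumr I2_sum big1 // => j _.
have [ij|ij] := ltnP m (i + j); first by rewrite dQ // mul0r mulr0 I2_0.
rewrite mulrCA I2Z; have := xE (enum_rank (i, j)).
by rewrite {2}/e enum_rankK /= ij => ->; rewrite mulr0.
Qed.

Lemma I2Mn (R : realType) (P : bpoly R) n : I2 (P *+ n) = I2 P *+ n.
Proof. by elim: n => [|n IH]; rewrite ?I2_0 // !mulrS I2D IH. Qed.

(* V is split into a polynomial w of degree k - 3 and a remainder z orthogonal to such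
   polynomials.  Squares of edge bubbles show that w has no second derivatives; then
   [squares_top] provides a bubble whose divdiv is a negative multiple of z modulo
   degree k - 3. *)
Lemma bubble_nondeg (R : realType) k (V : bpoly R) : (3 <= k)%N -> bdeg (k - 2) V ->
  (forall u, one_edge k u 0 0 -> pairing u V = 0) ->
  [/\ d1 (d1 V) = 0, d2 (d2 V) = 0 & d3 (d3 V) = 0].
Proof.
move=> k3 dV bV; have [k4|k4] := ltnP 3 k; last first.
  by apply: bdeg1_dd; rewrite (_ : 1%N = (k - 2)%N) //; lia.
have [w dw zP] := orth_proj_bdeg (k - 3) V; set z := V - w in zP.
have dz : bdeg (k - 2) z by apply: bdegB => //; apply: bdegW dw; lia.
have Vzw : V = z + w by rewrite /z subrK.
(* With coefficients of degree k - 1 the divdiv has degree k - 3 and is orthogonal to z, so only w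
   is seen. *)
have low u : one_edge k u 0 0 ->
    bdeg (k - 1) (tf1 u) -> bdeg (k - 1) (tf2 u) -> bdeg (k - 1) (tf3 u) -> pairing u w = 0.
  move=> bu da db dc; have := bV u bu; rewrite Vzw pairingD -(green_bubble z bu) mulrC zP ?add0r //.
  have [a _ _] := bdeg_dd da; have [_ b _] := bdeg_dd db; have [_ _ c] := bdeg_dd dc.
  rewrite (_ : (k - 3 = k - 1 - 2)%N); last by lia.
  by apply: bdegD => //; apply: bdegD.
have [w1 w2 w3] : [/\ d1 (d1 w) = 0, d2 (d2 w) = 0 & d3 (d3 w) = 0].
  have [k5|k5] := ltnP 4 k; last first.
    by apply: bdeg1_dd; rewrite (_ : 1%N = (k - 3)%N) //; lia.
  have [dd1 dd2 dd3] := bdeg_dd dw; have [db1 db2 db3] := bdeg_b R.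
  rewrite (_ : (k - 3 - 2 = k - 5)%N) in dd1 dd2 dd3; last by lia.
  have db (b g : bpoly R) : bdeg 2 b -> bdeg (k - 5) g -> bdeg (k - 1) (b * b * g).
    by move=> db dg; apply: (bdegMW (bdegM db db) dg); lia.
  (* The factors g_j = d_j d_j w turn the vanishing pairing into a sum of three squares. *)
  have := low _ (bubble_sq k5 dd1 dd2 dd3) (db _ _ db1 dd1) (db _ _ db2 dd2) (db _ _ db3 dd3).
  rewrite /pairing /=.
  have sq (b d : bpoly R) : b * b * d * d = (b * d) * (b * d) by ring.
  rewrite !sq !I2D => E.
  have bz : [/\ b1 R != 0, b2 R != 0 & b3 R != 0].
    have nz (b : bpoly R) y : ev b y != 0 -> b != 0.
      by apply: contraNneq => ->; rewrite evE.
    have h : (3^-1 : R) != 0 by rewrite invr_eq0 pnatr_eq0.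
    have e : 1 - 3^-1 - 3^-1 = 3^-1 :> R by field.
    by split; apply: (nz _ (3^-1, 3^-1)); rewrite ev_bary /= ?e mulf_neq0.
  have p1 := I2_sqr_ge0 (b1 R * d1 (d1 w)); have p2 := I2_sqr_ge0 (b2 R * d2 (d2 w)).
  have p3 := I2_sqr_ge0 (b3 R * d3 (d3 w)); case: bz => z1 z2 z3.
  have s1 : b1 R * d1 (d1 w) = 0 by apply: I2_sqr_eq0; lra.
  have s2 : b2 R * d2 (d2 w) = 0 by apply: I2_sqr_eq0; lra.
  have s3 : b3 R * d3 (d3 w) = 0 by apply: I2_sqr_eq0; lra.
  by split; apply/eqP; [move/eqP: s1|move/eqP: s2|move/eqP: s3];
    rewrite mulf_eq0 ?(negPf z1) ?(negPf z2) ?(negPf z3).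
have [g1 [g2 [g3 [dg1 dg2 dg3 dq]]]] := squares_top k4 dz.
set q := (X in bdeg _ (X - _)) in dq.
have [t1 _ _] := bubble_top k4 dg1; have [_ t2 _] := bubble_top k4 dg2.
have [_ _ t3] := bubble_top k4 dg3.
have bu := one_edgeD t1 (one_edgeD t2 t3); rewrite !addr0 in bu.
set u := tfD _ _ in bu.
have [dl1 dl2 dl3] := bdeg_l R; have [db1 db2 db3] := bdeg_b R.
(* The three top bubbles add up to the common factor q, whose leading part is that of z, plus
   coefficients of degree k - 1. *)
have uE : u = tfD (TField (b1 R * q) (b2 R * q) (b3 R * q))
   (TField (- (b1 R * l2 R * g2) - b1 R * l3 R * g3)
           (- (b2 R * l1 R * g1) - b2 R * l3 R * g3)
           (- (b3 R * l1 R * g1) - b3 R * l2 R * g2)).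
  rewrite /u /tfD /q /=.
  have e12 : l2 R + l3 R = 1 - l1 R by rewrite l1E; ring.
  have e23 : l3 R + l1 R = 1 - l2 R by rewrite l1E; ring.
  have e13 : l1 R + l2 R = 1 - l3 R by rewrite l1E; ring.
  by rewrite e12 e23 e13; congr TField; ring.
set a := TField (_ - _) _ _ in uE.
have da (b l g : bpoly R) : bdeg 2 b -> bdeg 1 l -> bdeg (k - 4) g -> bdeg (k - 1) (b * l * g).
  by move=> db dl dg; apply: (bdegMW (bdegM db dl) dg); lia.
have dda : bdeg (k - 3) (divdiv_ref a).
  have [x1 _ _] := bdeg_dd (bdegB (bdegN (da _ _ _ db1 dl2 dg2)) (da _ _ _ db1 dl3 dg3)).
  have [_ x2 _] := bdeg_dd (bdegB (bdegN (da _ _ _ db2 dl1 dg1)) (da _ _ _ db2 dl3 dg3)).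
  have [_ _ x3] := bdeg_dd (bdegB (bdegN (da _ _ _ db3 dl1 dg1)) (da _ _ _ db3 dl2 dg2)).
  rewrite (_ : (k - 3 = k - 1 - 2)%N); last by lia.
  by apply: bdegD => //; apply: bdegD.
have dq2 : bdeg (k - 2) q.
  by rewrite -[q](subrK z); apply: bdegD => //; apply: bdegW dq; lia.
have k20 : (0 < k - 2)%N by lia.
have top := divdiv_top k20 dq2; rewrite (_ : (k - 2).-1 = (k - 3)%N) in top; last by lia.
set c := ((_ + 2) * _)%N in top.
have pz : I2 (divdiv_ref u * z) = 0.
  by rewrite (green_bubble z bu); have := bV u bu; rewrite Vzw pairingD {2}/pairing
    w1 w2 w3 !mulr0 !addr0 I2_0 addr0.
have z0 : z = 0.
  apply: I2_sqr_eq0.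
  (* Besides - c z^2, z is multiplied only by polynomials of degree k - 3: the divdiv of [a], the
     remainder of [divdiv_top], and q - z. By orthogonality [pz] reduces to - c times the square
     norm of z being 0, where c > 0. *)
  have E : divdiv_ref u * z = z * (divdiv_ref a +
      (divdiv_ref (TField (b1 R * q) (b2 R * q) (b3 R * q)) + q *+ c)
      - (q - z) *+ c) - (z * z) *+ c.
    rewrite uE /divdiv_ref /tfD /= /d1 /d2 /d3 !(dpxD, dpyD, dpxN, dpyN); ring.
  move: pz; rewrite E I2B zP ?sub0r.
    move=> /eqP; rewrite oppr_eq0 => /eqP.
    rewrite I2Mn => /eqP; rewrite mulrn_eq0 => /orP[|/eqP//].
    by rewrite /c; lia.
  by apply: bdegB; [apply: bdegD|apply: bdegMn].
by rewrite Vzw z0 add0r.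
Qed.

(** * Constants on the reference triangle by finite-dimensional arguments *)

Lemma sum_CS (R : realType) (n : nat) (y w : 'I_n -> R) :
  (\sum_j y j * w j) ^+ 2 <= (\sum_j y j ^+ 2) * (\sum_j w j ^+ 2).
Proof.
elim: n y w => [|n IH] y w; first by rewrite !big_ord0 expr0n mul0r.
rewrite !big_ord_recr /=.
have := IH (fun j => y (widen_ord (leqnSn n) j)) (fun j => w (widen_ord (leqnSn n) j)).
have Y0 : 0 <= \sum_(i < n) y (widen_ord (leqnSn n) i) ^+ 2.
  by apply: sumr_ge0 => i _; exact: sqr_ge0.
have W0 : 0 <= \sum_(i < n) w (widen_ord (leqnSn n) i) ^+ 2.
  by apply: sumr_ge0 => i _; exact: sqr_ge0.
move: (y ord_max) (w ord_max) => a b.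
set S := (\sum_(i < n) _ * _); set Y := (\sum_(i < n) _) in Y0 *.
set W := (\sum_(i < n) _) in W0 * => SYW.
suff : 2 * (S * (a * b)) <= Y * b ^+ 2 + W * a ^+ 2 by move=> ?; nra.
have [Yp|] := ltrP 0 Y; last first.
  move=> Yn; have Y00 : Y = 0 by apply/eqP; rewrite eq_le Yn.
  have S0 : S = 0 by apply/eqP; rewrite -sqrf_eq0 eq_le sqr_ge0 (le_trans SYW) // Y00 mul0r.
  by rewrite S0 Y00 !mul0r mulr0 add0r mulr_ge0 // sqr_ge0.
rewrite -subr_ge0 -(pmulr_rge0 _ Yp).
have : 0 <= (Y * b - S * a) ^+ 2 + (Y * W - S ^+ 2) * a ^+ 2.
  by rewrite addr_ge0 ?sqr_ge0 // mulr_ge0 ?sqr_ge0 // subr_ge0.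
by move=> h; apply: le_trans h _; rewrite le_eqVlt; apply/orP; left; apply/eqP; ring.
Qed.

Lemma evM (R : realType) (P Q : bpoly R) z : ev (P * Q) z = ev P z * ev Q z.
Proof. by rewrite evE. Qed.

Lemma I2_comb_le (R : realType) n (y : 'I_n -> R) (W : 'I_n -> bpoly R) :
  I2 ((\sum_j (y j)%:P%:P * W j) * (\sum_j (y j)%:P%:P * W j)) <=
  (\sum_j y j ^+ 2) * \sum_j I2 (W j * W j).
Proof.
rewrite -I2_sum -I2Z; apply: I2_le => z _; rewrite !evE !ev_sum -expr2.
under eq_bigr do rewrite !evE.
rewrite [X in _ <= _ * X](eq_bigr (fun i => ev (W i) z ^+ 2)) ?sum_CS // => i _.
by rewrite expr2 evM.
Qed.

Lemma I1_le (R : realType) (p q : {poly R}) :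
  (forall t, 0 <= t <= 1 -> p.[t] <= q.[t]) -> I1 p <= I1 q.
Proof.
move=> pq; rewrite -subr_ge0 -I1B; apply: I1_ge0 => t t01.
by rewrite hornerD hornerN subr_ge0 pq.
Qed.

Lemma I1_sqr_ge0 (R : realType) (p : {poly R}) : 0 <= I1 (p * p).
Proof. by apply: I1_ge0 => t _; rewrite hornerM -expr2 sqr_ge0. Qed.

Lemma I1_comb_le (R : realType) n (y : 'I_n -> R) (W : 'I_n -> {poly R}) :
  I1 ((\sum_j (y j)%:P * W j) * (\sum_j (y j)%:P * W j)) <=
  (\sum_j y j ^+ 2) * \sum_j I1 (W j * W j).
Proof.
rewrite -I1_sum -I1Z; apply: I1_le => t _; rewrite !hornerM hornerC !horner_sum -expr2.
under eq_bigr do rewrite hornerM hornerC.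
rewrite [X in _ <= _ * X](eq_bigr (fun i => (W i).[t] ^+ 2)) ?sum_CS // => i _.
by rewrite expr2 hornerM.
Qed.

Definition sqn (R : realType) (u : tfield R) : R :=
  I2 (tf1 u * tf1 u) + I2 (tf2 u * tf2 u) + I2 (tf3 u * tf3 u).
Definition hess (R : realType) (V : bpoly R) : R :=
  I2 (d1 (d1 V) * d1 (d1 V)) + I2 (d2 (d2 V) * d2 (d2 V)) + I2 (d3 (d3 V) * d3 (d3 V)).

Lemma sqn_ge0 (R : realType) (u : tfield R) : 0 <= sqn u.
Proof. by rewrite !addr_ge0 // I2_sqr_ge0. Qed.
Lemma hess_ge0 (R : realType) (V : bpoly R) : 0 <= hess V.
Proof. by rewrite !addr_ge0 // I2_sqr_ge0. Qed.

Definition tfcomb (R : realType) n (y : 'I_n -> R) (U : 'I_n -> tfield R) : tfield R :=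
  TField (\sum_j (y j)%:P%:P * tf1 (U j)) (\sum_j (y j)%:P%:P * tf2 (U j))
         (\sum_j (y j)%:P%:P * tf3 (U j)).

Lemma one_edge0 (R : realType) k : (3 <= k)%N -> one_edge k (tf0 R) 0 0.
Proof.
move=> k3; have := one_edgeZ 0 (edge_shear_field0 R k3).
by rewrite /tfZ /= !polyC0 !mul0r.
Qed.

Lemma one_edge_comb (R : realType) k n (y : 'I_n -> R) U f g : (3 <= k)%N ->
  (forall j, one_edge k (U j) (f j) (g j)) ->
  one_edge k (tfcomb y U) (\sum_j (y j)%:P * f j) (\sum_j (y j)%:P * g j).
Proof.
move=> k3; elim: n y U f g => [|n IH] y U f g H.
  by rewrite /tfcomb !big_ord0; exact: one_edge0.
rewrite /tfcomb !big_ord_recr /=.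
have := IH (fun j => y (widen_ord (leqnSn n) j)) _ _ _
  (fun j => H (widen_ord (leqnSn n) j)).
by move=> /one_edgeD/(_ (one_edgeZ (y ord_max) (H ord_max))).
Qed.

Lemma pairing_comb (R : realType) n (y : 'I_n -> R) U V :
  pairing (tfcomb y U) V = \sum_j y j * pairing (U j) V.
Proof.
rewrite /pairing /tfcomb /= !mulr_suml -!big_split /= I2_sum; apply: eq_bigr => j _.
by rewrite -I2Z; congr I2; ring.
Qed.

Lemma pairing_sum (R : realType) n (x : 'I_n -> R) u W :
  pairing u (\sum_j (x j)%:P%:P * W j) = \sum_j x j * pairing u (W j).
Proof.
elim: n x W => [|n IH] x W.
  by rewrite !big_ord0 /pairing /d1 /d2 /d3 !(raddf0, subr0, oppr0, mulr0, addr0) I2_0.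
by rewrite !big_ord_recr /= pairingD pairingZ IH.
Qed.

Lemma sqn_comb_le (R : realType) n (y : 'I_n -> R) (U : 'I_n -> tfield R) :
  sqn (tfcomb y U) <= (\sum_j y j ^+ 2) * \sum_j sqn (U j).
Proof.
rewrite /sqn /tfcomb /= !big_split /= !mulrDr.
by rewrite !lerD // I2_comb_le.
Qed.

Lemma dd_sum (R : realType) n (x : 'I_n -> R) (W : 'I_n -> bpoly R) :
  let V := \sum_j (x j)%:P%:P * W j in
  [/\ d1 (d1 V) = \sum_j (x j)%:P%:P * d1 (d1 (W j)),
      d2 (d2 V) = \sum_j (x j)%:P%:P * d2 (d2 (W j)) &
      d3 (d3 V) = \sum_j (x j)%:P%:P * d3 (d3 (W j))].
Proof.
elim: n x W => [|n IH] x W /=.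
  by rewrite !big_ord0 /d1 /d2 /d3 !(raddf0, subr0, oppr0).
rewrite !big_ord_recr /=.
have [a b c] := IH (fun j => x (widen_ord (leqnSn n) j)) (fun j => W (widen_ord (leqnSn n) j)).
rewrite -a -b -c; rewrite /d1 /d2 /d3 !(dpxD, dpyD, dpxN, dpyN, dpxZ, dpyZ).
by split; ring.
Qed.

Lemma hess_comb_le (R : realType) n (y : 'I_n -> R) (W : 'I_n -> bpoly R) :
  hess (\sum_j (y j)%:P%:P * W j) <= (\sum_j y j ^+ 2) * \sum_j hess (W j).
Proof.
rewrite /hess; have [-> -> ->] := dd_sum y W.
rewrite !big_split /= !mulrDr.
by rewrite !lerD // I2_comb_le.
Qed.

(** Finitely many bubbles U_j from [test_family] detect whatever bubbles can detect. With y_j the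
    pairing of U_j and V, the field with coefficients y_j has pairing |y|^2 with V, and its square
    norm is at most a constant times |y|^2. A pseudo-inverse rebuilds from y alone a polynomial V'
    with the same pairings as V, hence the same second derivatives by [bubble_nondeg]; so [hess V]
    is bounded by |y|^2 too. *)
Lemma ref_bubble (R : realType) k : (3 <= k)%N ->
  exists2 C : R, 0 < C & forall V : bpoly R, bdeg (k - 2) V ->
  exists u, [/\ one_edge k u 0 0, sqn u <= C * pairing u V & hess V <= C * pairing u V].
Proof.
move=> k3.
pose T := ('I_(k - 2).+1 * 'I_(k - 2).+1)%type; pose n := #|{: T}|.
pose e (t : 'I_n) : bpoly R :=
  let ij := enum_val t in if (ij.1 + ij.2 <= k - 2)%N then mono R ij.1 ij.2 else 0.
have de t : bdeg (k - 2) (e t).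
  by rewrite /e; case: ifP => h; [exact: bdegW h (@bdeg_mono R _ _)|exact: bdeg0].
have expand V : bdeg (k - 2) V -> exists x : 'I_n -> R, V = \sum_t (x t)%:P%:P * e t.
  move=> dV; exists (fun t => (V`_(enum_val t : T).2)`_(enum_val t : T).1).
  pose F (ij : T) : bpoly R := ((V`_ij.2)`_ij.1)%:P%:P * mono R ij.1 ij.2.
  transitivity (\sum_(t < n) F (enum_val t)).
    rewrite {1}(bdegE dV) pair_big /= -(big_enum_val F).
    by apply: eq_big => // -[i j].
  apply: eq_bigr => t _; rewrite /e /F; case: ifPn => // h.
  by rewrite dV -?ltnNge ?mul0r ?mulr0 // ltnNge.
pose S (a : 'cV[R]_n) := exists2 u, one_edge k u 0 0 & a = \col_i pairing u (e i).
have [M [A [SA kA]]] := test_family S.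
have /choice[U UP] : forall j, exists u, one_edge k u 0 0 /\ col j A = \col_i pairing u (e i).
  by move=> j; have [u] := SA j; exists u.
pose W (j : 'I_M) : bpoly R := \sum_i (pinvmx A j i)%:P%:P * e i.
pose C := 1 + \sum_j sqn (U j) + \sum_j hess (W j).
have s0 : 0 <= \sum_j sqn (U j) by apply: sumr_ge0 => j _; exact: sqn_ge0.
have h0 : 0 <= \sum_j hess (W j) by apply: sumr_ge0 => j _; exact: hess_ge0.
exists C; first by rewrite /C; lra.
move=> V dV; have [x VE] := expand V dV.
pose y (j : 'I_M) : R := pairing (U j) V.
have yE j : (\row_i x i *m A) 0 j = y j.
  rewrite /y VE pairing_sum !mxE; apply: eq_bigr => i _; rewrite !mxE; congr (_ * _).
  by have := congr1 (fun a : 'cV_n => a i 0) (UP j).2; rewrite !mxE.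
have pE : pairing (tfcomb y U) V = \sum_j y j ^+ 2.
  by rewrite pairing_comb; apply: eq_bigr => j _; rewrite expr2.
have y0 : 0 <= \sum_j y j ^+ 2 by apply: sumr_ge0 => j _; exact: sqr_ge0.
exists (tfcomb y U); split.
- have := one_edge_comb y k3 (fun j => (UP j).1).
  by rewrite big1 // => j _; rewrite mulr0.
- by rewrite pE; apply: (le_trans (sqn_comb_le _ _)); rewrite mulrC ler_wpM2r // /C; lra.
rewrite pE; pose V' := \sum_j (y j)%:P%:P * W j.
have dW j : bdeg (k - 2) (W j).
  by apply: bdeg_sum => i _; exact: bdegZ.
have dV' : bdeg (k - 2) V' by apply: bdeg_sum => j _; exact: bdegZ.
have [z1 z2 z3] : [/\ d1 (d1 (V - V')) = 0, d2 (d2 (V - V')) = 0 & d3 (d3 (V - V')) = 0].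
  apply: (bubble_nondeg k3 (bdegB dV dV')).
  move=> u bu; pose a : 'cV[R]_n := \col_i pairing u (e i).
  have Sa : S a by exists u.
  (* The coordinates of V - V', which no U_j sees; by [kA] no bubble sees them. *)
  pose x0 : 'rV[R]_n := \row_i x i - \row_i x i *m A *m pinvmx A.
  have x0A : x0 *m A = 0.
    rewrite mulmxBl mulmxKpV ?subrr //; exact: submxMl.
  have := kA x0 x0A a Sa => /matrixP/(_ 0 0); rewrite !mxE => E.
  transitivity (\sum_i x0 0 i * a i 0); last exact: E.
  have -> : V - V' = \sum_i (x0 0 i)%:P%:P * e i.
    have -> : V' = \sum_i ((\row_i x i *m A *m pinvmx A) 0 i)%:P%:P * e i.
      rewrite /V' /W; under eq_bigr do rewrite mulr_sumr.
      rewrite exchange_big /=; apply: eq_bigr => i _; rewrite mxE.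
      rewrite !rmorph_sum mulr_suml /=; apply: eq_bigr => j _.
      by rewrite yE !polyCM mulrA.
    rewrite VE -sumrB; apply: eq_bigr => i _.
    by rewrite -mulrBl -!polyCB /x0 !mxE.
  by rewrite pairing_sum; apply: eq_bigr => i _; rewrite !mxE.
have -> : hess V = hess V'.
  have dB (P Q : bpoly R) : [/\ d1 (d1 (P - Q)) = d1 (d1 P) - d1 (d1 Q),
      d2 (d2 (P - Q)) = d2 (d2 P) - d2 (d2 Q) & d3 (d3 (P - Q)) = d3 (d3 P) - d3 (d3 Q)].
    by rewrite /d1 /d2 /d3 !(dpxD, dpyD, dpxN, dpyN); split; ring.
  have [e1 e2 e3] := dB V V'.
  move: z1 z2 z3; rewrite e1 e2 e3 /hess => /subr0_eq -> /subr0_eq -> /subr0_eq ->.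
  by [].
by apply: (le_trans (hess_comb_le _ _)); rewrite mulrC ler_wpM2r // /C; lra.
Qed.

(** The weighted square of (1 + B) J - t Q is nonnegative, with B the weighted norm of Q and t the
    product with J. The summand 1 keeps the factor positive even when Q is zero. *)
Lemma I1_CS (R : realType) (w J Q : {poly R}) :
  (forall t, 0 <= t <= 1 -> 0 <= w.[t]) ->
  I1 (w * J * Q) ^+ 2 <= (1 + I1 (w * Q * Q)) * I1 (w * J * J).
Proof.
move=> w0; set t := I1 (w * J * Q); set B := I1 (w * Q * Q); set A := I1 (w * J * J).
have sq0 P : 0 <= I1 (w * P * P).
  by apply: I1_ge0 => s s01; rewrite -mulrA !hornerM mulr_ge0 ?w0 // -expr2 sqr_ge0.
have := sq0 ((1 + B)%:P * J - t%:P * Q).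
have E (a b x y z : {poly R}) : x * (a * y - b * z) * (a * y - b * z) =
   (a * a) * (x * y * y) - (a * b + a * b) * (x * y * z) + (b * b) * (x * z * z) by ring.
rewrite E -!polyCM -polyCD.
rewrite I1D I1B !I1Z -/A -/B -/t => h.
have B0 : 0 <= B by exact: sq0.
have S0 : 0 < 1 + B by lra.
rewrite -subr_ge0 -(pmulr_rge0 _ S0); apply: le_trans h _.
rewrite -subr_ge0.
by rewrite (_ : _ - _ = t ^+ 2); [exact: sqr_ge0|ring].
Qed.

Lemma size_comb (R : realType) n (J : {poly R}) : (size J <= n)%N ->
  J = \sum_(a < n) (J`_a)%:P * 'X^a.
Proof.
move=> sJ; rewrite -{1}[J]coefK poly_def.
under [RHS]eq_bigr do rewrite mul_polyC.
rewrite (big_ord_widen n (fun a => J`_a *: 'X^a)) // big_mkcond; apply: eq_bigr => a _.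
by case: ltnP => // h; rewrite nth_default // scale0r.
Qed.

(** Equivalence of norms: the weighted Gram matrix of the monomials is invertible, since w J^2 = 0
    forces J = 0, and its inverse recovers the coefficients from the moments of J. It is applied
    with w = 1 and with w = x (1 - x). *)
Lemma coef_bound (R : realType) n (w : {poly R}) : w != 0 ->
  (forall t, 0 <= t <= 1 -> 0 <= w.[t]) ->
  exists2 C : R, 0 < C & forall J : {poly R}, (size J <= n)%N ->
    \sum_(a < n) J`_a ^+ 2 <= C * I1 (w * J * J).
Proof.
move=> wn0 w0.
pose G : 'M[R]_n := \matrix_(a, b) I1 (w * 'X^a * 'X^b).
have expand (x : 'rV[R]_n) b : (x *m G) 0 b = I1 (w * (\sum_(a < n) (x 0 a)%:P * 'X^a) * 'X^b).
  rewrite mxE mulr_sumr mulr_suml I1_sum; apply: eq_bigr => a _; rewrite mxE -I1Z.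
  by congr I1; ring.
have Gu : G \in unitmx.
  rewrite -row_free_unit -kermx_eq0; apply/eqP/row_matrixP => i; rewrite row0.
  set x := row i (kermx G).
  have xG : x *m G = 0 by rewrite /x -row_mul mulmx_ker row0.
  set J := \sum_(a < n) (x 0 a)%:P * 'X^a.
  have IJ : I1 (w * J * J) = 0.
    rewrite [in X in _ * X]/J mulr_sumr I1_sum big1 // => b _.
    by rewrite mulrCA I1Z -expand xG [X in _ * X]mxE mulr0.
  have wJ : w * J * J = 0.
    by apply: I1_eq0 IJ => t t01; rewrite -mulrA !hornerM mulr_ge0 ?w0 // -expr2 sqr_ge0.
  have J0 : J = 0.
    by move/eqP: wJ; rewrite !mulf_eq0 (negPf wn0) /= orbb => /eqP.
  apply/rowP => a; rewrite [RHS]mxE; transitivity J`_a; last by rewrite J0 coef0.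
  rewrite /J coef_sum (bigD1 a) //= big1 ?addr0 => [|b ba].
    by rewrite coefCM coefXn eqxx mulr1.
  by rewrite coefCM coefXn eq_sym (inj_eq val_inj) (negPf ba) mulr0.
pose C1 := \sum_(b < n) (1 + I1 (w * 'X^b * 'X^b)).
pose C2 := \sum_(a < n) \sum_(b < n) invmx G b a ^+ 2.
have B0 (b : 'I_n) : 0 <= I1 (w * 'X^b * 'X^b).
  by apply: I1_ge0 => s s01; rewrite -mulrA !hornerM mulr_ge0 ?w0 // -expr2 sqr_ge0.
have C10 : 0 <= C1 by apply: sumr_ge0 => b _; rewrite addr_ge0.
have C20 : 0 <= C2 by apply: sumr_ge0 => a _; apply: sumr_ge0 => b _; exact: sqr_ge0.
exists (1 + C1 * C2); first by rewrite ltr_pwDl // mulr_ge0.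
move=> J sJ; pose x : 'rV[R]_n := \row_a J`_a.
have xE : x = x *m G *m invmx G by rewrite mulmxK.
have A0 : 0 <= I1 (w * J * J).
  by apply: I1_ge0 => s s01; rewrite -mulrA !hornerM mulr_ge0 ?w0 // -expr2 sqr_ge0.
have yE b : (x *m G) 0 b = I1 (w * J * 'X^b).
  by rewrite expand [in RHS](size_comb sJ); under eq_bigr do rewrite mxE.
have y2 : \sum_b (x *m G) 0 b ^+ 2 <= C1 * I1 (w * J * J).
  by rewrite mulr_suml; apply: ler_sum => b _; rewrite yE; exact: I1_CS.
apply: (@le_trans _ _ (\sum_(a < n) (\sum_b (x *m G) 0 b ^+ 2) * \sum_b invmx G b a ^+ 2)).
  apply: ler_sum => a _; have := congr1 (fun M : 'rV_n => M 0 a) xE.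
  by rewrite /= mxE => ->; rewrite mxE; exact: sum_CS.
rewrite -mulr_sumr; apply: (@le_trans _ _ (C1 * I1 (w * J * J) * C2)).
  by rewrite ler_wpM2r.
by rewrite mulrDl mul1r mulrAC lerDr.
Qed.

Lemma one_edge_eq (R : realType) k (u : tfield R) f g f' g' :
  one_edge k u f g -> f = f' -> g = g' -> one_edge k u f' g'.
Proof. by move=> h <- <-. Qed.

(** On the first edge l3 is the parameter, so g = l3^a in [edge_shear_field] gives every positive
    power after division by 12; the power 0 comes from [edge_shear_field0]. *)
Lemma edge_shear_basis (R : realType) k a : (3 <= k)%N -> (a < k - 1)%N ->
  exists u, one_edge k u 0 ('X^a : {poly R}).
Proof.
move=> k3; case: a => [_|a ak].
  have e : 2^-1%:P * 2 = 'X^0 :> {poly R}.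
    by rewrite -[2]/(1 *+ 2) -polyC1 -polyCMn -polyCM mulVf ?pnatr_eq0.
  by eexists; apply: (one_edge_eq (one_edgeZ 2^-1 (edge_shear_field0 R k3)) _ e); rewrite mulr0.
have d : bdeg (k - 3) (l3 R ^+ a).
  rewrite l3.unlock; have := @bdeg_mono R 0 a; rewrite /mono expr0 mul1r.
  by apply: bdegW; lia.
have e : 12^-1%:P * (tr1 (l3 R * l3 R ^+ a) *+ 12) = 'X^(a.+1).
  rewrite -exprS /tr1 rmorphXn /= -/(tr1 (l3 R)) bary_table mulrnAr -mulrnAl -polyCMn.
  by rewrite -[12^-1 *+ 12]mulr_natr mulVf ?pnatr_eq0 // mul1r.
by eexists; apply: (one_edge_eq (one_edgeZ 12^-1 (edge_shear_field k3 d erefl)) _ e); rewrite mulr0.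
Qed.

Lemma ref_shear (R : realType) k : (3 <= k)%N ->
  exists2 C : R, 0 < C & forall J : {poly R}, (size J <= k - 1)%N ->
  exists u, one_edge k u 0 J /\ sqn u <= C * \sum_(a < k - 1) J`_a ^+ 2.
Proof.
move=> k3.
have /choice[U UP] : forall a : 'I_(k - 1), exists u, one_edge k u 0 ('X^a : {poly R}).
  by move=> a; exact: edge_shear_basis.
have s0 : 0 <= \sum_j sqn (U j) by apply: sumr_ge0 => j _; exact: sqn_ge0.
exists (1 + \sum_j sqn (U j)); first by lra.
move=> J sJ; exists (tfcomb (fun a : 'I_(k - 1) => J`_a) U); split.
  have := one_edge_comb (fun a : 'I_(k - 1) => J`_a) k3 UP.
  by rewrite -size_comb // big1 // => a _; rewrite mulr0.
apply: (le_trans (sqn_comb_le _ _)); rewrite mulrC ler_wpM2r ?lerDr //.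
by apply: sumr_ge0 => a _; exact: sqr_ge0.
Qed.

Lemma sqnD (R : realType) (u v : tfield R) : sqn (tfD u v) <= 2 * sqn u + 2 * sqn v.
Proof.
have h (P Q : bpoly R) : I2 ((P + Q) * (P + Q)) <= 2 * I2 (P * P) + 2 * I2 (Q * Q).
  have := I2_sqr_ge0 (P - Q).
  have -> : (P - Q) * (P - Q) = (P * P) *+ 2 + (Q * Q) *+ 2 - (P + Q) * (P + Q) by ring.
  by rewrite I2B I2D !I2Mn -!(mulr_natl (I2 _)) subr_ge0.
have := h (tf1 u) (tf1 v); have := h (tf2 u) (tf2 v); have := h (tf3 u) (tf3 v).
by rewrite /sqn /tfD /=; lra.
Qed.

(** [edge_normal_field] realises the normal trace with some shear h; the difference between the
    prescribed c f' and h is supplied by a shear field, which leaves the normal trace alone. The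
    dependence on c is explicit because c later encodes the slant of each actual triangle. *)
Lemma ref_normal (R : realType) k : (3 <= k)%N ->
  exists2 C : R, 0 < C & forall (r : {poly R}) (c : R), (size r <= k - 2)%N ->
  exists u, one_edge k u (('X - 'X ^+ 2) * r) (c%:P * (('X - 'X ^+ 2) * r)^`()) /\
     sqn u <= C * (1 + c ^+ 2) * \sum_(a < k - 2) r`_a ^+ 2.
Proof.
move=> k3; have [C0 C0p shear] := ref_shear R k3.
have [C1 C1p coefb] := @coef_bound R (k - 1) 1 (oner_neq0 _) (fun t _ => ltac:(by rewrite hornerC ler01)).
pose g (a : 'I_(k - 2)) : bpoly R := 2^-1%:P%:P * l3 R ^+ a.
have dg a : bdeg (k - 3) (g a).
  apply: bdegZ; rewrite l3.unlock; have := @bdeg_mono R 0 a; rewrite /mono expr0 mul1r.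
  by apply: bdegW; have := ltn_ord a; lia.
have tg a : tr1 (b1 R * g a) *+ 2 = ('X - 'X ^+ 2) * 'X^a.
  rewrite /g tr1E bary_table -mulrnAr; congr (_ * _).
  rewrite /tr1 rmorphM /= sub2C comp_polyC rmorphXn /= -/(tr1 (l3 R)) bary_table.
  by rewrite -mulrnAl -polyCMn -[2^-1 *+ 2]mulr_natr mulVf ?pnatr_eq0 // mul1r.
pose U a := TField (- b1 R * g a) (b1 R * g a) (b1 R * g a).
pose f (a : 'I_(k - 2)) : {poly R} := ('X - 'X ^+ 2) * 'X^a.
pose h a := - tr1 (dpx (b1 R * g a) + dpy (b1 R * g a)) *+ 2.
have UP a : one_edge k (U a) (f a) (h a) by apply: (one_edge_eq (edge_normal_field k3 (dg a))).
have [db1 _ _] := bdeg_b R.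
have sh a : (size (h a) <= k - 1)%N.
  have db : bdeg (k - 1) (b1 R * g a) by apply: (bdegMW db1 (dg a)); lia.
  rewrite /h mulNrn size_polyN -raddfMn.
  apply: leq_trans (size_tr1 (bdegMn _ (bdegD (bdeg_dpx db) (bdeg_dpy db)))) _.
  by lia.
have sf a : (size (f a)^`() <= k - 1)%N.
  have db : bdeg (k - 1) (b1 R * g a) by apply: (bdegMW db1 (dg a)); lia.
  apply: leq_trans (size_poly _ _) _; rewrite /f -tg -raddfMn -/(tr1 _).
  by have := size_tr1 (bdegMn 2 db); move: (size _) => m; lia.
pose G := \sum_a (I1 ((f a)^`() * (f a)^`()) + I1 (h a * h a)).
have G0 : 0 <= G by apply: sumr_ge0 => a _; rewrite addr_ge0 // I1_sqr_ge0.
pose N := \sum_a sqn (U a).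
have N0 : 0 <= N by apply: sumr_ge0 => a _; exact: sqn_ge0.
exists (2 * N + 2 * C0 * C1 * G + 1).
  by have := mulr_ge0 (mulr_ge0 (ltW C0p) (ltW C1p)) G0; nra.
move=> r c sr; pose y (a : 'I_(k - 2)) := r`_a.
have FE : \sum_a (y a)%:P * f a = ('X - 'X ^+ 2) * r.
  by rewrite [in RHS](size_comb sr) mulr_sumr; apply: eq_bigr => a _; rewrite mulrCA.
pose w a := c%:P * (f a)^`() - h a.
pose J := \sum_a (y a)%:P * w a.
have sJ : (size J <= k - 1)%N.
  apply: leq_trans (size_sum _ _ _) _; apply/bigmax_leqP => a _.
  rewrite mul_polyC; apply: leq_trans (size_scale_leq _ _) _.
  apply: leq_trans (size_polyD _ _) _; rewrite size_polyN geq_max sh andbT.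
  by rewrite mul_polyC; apply: leq_trans (size_scale_leq _ _) _.
have [v [vJ vn]] := shear J sJ.
exists (tfD (tfcomb y U) v); split.
  apply: (one_edge_eq (one_edgeD (one_edge_comb y k3 UP) vJ)); first by rewrite addr0.
  rewrite /J -big_split /= -FE raddf_sum mulr_sumr; apply: eq_bigr => a _ /=.
  by rewrite derivM derivC /w; ring.
set S := \sum_(a < k - 2) r`_a ^+ 2.
have S0 : 0 <= S by apply: sumr_ge0 => a _; exact: sqr_ge0.
have nu : sqn (tfcomb y U) <= S * N by exact: sqn_comb_le.
have nJ : I1 (J * J) <= S * ((1 + c ^+ 2) * G).
  apply: (le_trans (I1_comb_le _ _)); rewrite ler_wpM2l // mulr_sumr.
  apply: ler_sum => a _; rewrite -I1D -I1Z; apply: I1_le => t _.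
  rewrite /w; move: (h a) ((f a)^`()) => p q; rewrite !(hornerM, hornerD, hornerN, hornerC).
  by rewrite -subr_ge0 (_ : _ - _ = (q.[t] + c * p.[t]) ^+ 2); [exact: sqr_ge0|ring].
have nv : sqn v <= C0 * (C1 * (S * ((1 + c ^+ 2) * G))).
  apply: (le_trans vn); rewrite ler_wpM2l ?(ltW C0p) //.
  by apply: (le_trans (coefb _ sJ)); rewrite mul1r ler_wpM2l ?(ltW C1p).
apply: (le_trans (sqnD _ _)).
have c1 : 0 <= c ^+ 2 by exact: sqr_ge0.
have p1 : 0 <= S * N * c ^+ 2 := mulr_ge0 (mulr_ge0 S0 N0) c1.
have p2 : 0 <= S * (1 + c ^+ 2) := mulr_ge0 S0 (addr_ge0 ler01 c1).
clearbody S N G; rewrite -subr_ge0; set Z := (X in 0 <= X).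
have -> : Z = 2 * (S * N - sqn (tfcomb y U)) + 2 * (C0 * (C1 * (S * ((1 + c ^+ 2) * G))) - sqn v)
   + 2 * (S * N * c ^+ 2) + S * (1 + c ^+ 2) by rewrite /Z; ring.
by rewrite !addr_ge0 // mulr_ge0 // subr_ge0.
Qed.

(** Young's inequality; the weight t stays free, to be matched with the size of each triangle in
    [cross_le]. *)
Lemma pairing_le (R : realType) (u : tfield R) V (t : R) : 0 < t ->
  `|pairing u V| *+ 2 <= t * sqn u + t^-1 * hess V.
Proof.
move=> t0.
have key (P Q : bpoly R) : `|I2 (P * Q)| *+ 2 <= t * I2 (P * P) + t^-1 * I2 (Q * Q).
  have h (s : R) : s ^+ 2 = 1 -> s * I2 (P * Q) *+ 2 <= t * I2 (P * P) + t^-1 * I2 (Q * Q).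
    move=> s1; rewrite -subr_ge0 -!I2Z -I2Mn -I2D -I2B; apply: I2_ge0 => z _.
    rewrite !(evE z) -(pmulr_rge0 _ t0); set Z := (X in 0 <= X).
    rewrite (_ : Z = (t * ev P z - s * ev Q z) ^+ 2 + (1 - s ^+ 2) * ev Q z ^+ 2); last first.
      by rewrite /Z; field; rewrite gt_eqF.
    by rewrite s1 subrr mul0r addr0 sqr_ge0.
  have := h 1 (expr1n _ _); have := h (-1) (sqrr_sign _ 1).
  by case: (ger0P (I2 (P * Q))) => _; lra.
have := key (tf1 u) (d1 (d1 V)); have := key (tf2 u) (d2 (d2 V)); have := key (tf3 u) (d3 (d3 V)).
rewrite /pairing /sqn /hess !I2D.
move: (I2 (tf1 u * d1 (d1 V))) (I2 (tf2 u * d2 (d2 V))) (I2 (tf3 u * d3 (d3 V))) => x y z.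
by have := ler_normD (x + y) z; have := ler_normD x y; rewrite !mulrDr; lra.
Qed.

(** * Splitting symmetric polynomial matrices into sym curl and x x^T parts *)

Lemma dpx_mono (R : realType) i j : dpx (mono R i j) = mono R i.-1 j *+ i.
Proof.
rewrite /mono dpxM; have -> : dpx (py ^+ j : bpoly R) = 0.
  elim: j => [|j IH]; first by rewrite expr0 dpxE.
  by rewrite exprS dpxM IH mulr0 addr0 dpxE mul0r.
rewrite mulr0 addr0 -mulrnAl; congr (_ * _).
case: i => [|i]; first by rewrite expr0 dpxE.
elim: i => [|i IH]; first by rewrite expr1 dpxE.
by rewrite exprS dpxM IH dpxE mul1r mulrnAr -exprS -mulrS.
Qed.

Lemma dpy_mono (R : realType) i j : dpy (mono R i j) = mono R i j.-1 *+ j.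
Proof.
rewrite /mono dpyM; have -> : dpy (px ^+ i : bpoly R) = 0.
  elim: i => [|i IH]; first by rewrite expr0 dpyE.
  by rewrite exprS dpyM IH mulr0 addr0 dpyE mul0r.
by rewrite mul0r add0r -mulrnAr /dpy derivXn.
Qed.

(* Formal counterpart of [Sigma_loc], in coordinates centred at the origin of the
   cell: a matrix field is given by its entries of indices 11, 12 and 22. *)
Definition sig (R : realType) (m : nat) (A11 A12 A22 : bpoly R) : Prop :=
  exists f g p, [/\ bdeg m.+1 f, bdeg m.+1 g, bdeg m.-1 p &
    [/\ A11 = dpy f + p * (px * px), A12 *+ 2 = dpy g - dpx f + p * (px * py) *+ 2 &
        A22 = - dpx g + p * (py * py)]].

Lemma sigD (R : realType) m (A B C A' B' C' : bpoly R) :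
  sig m A B C -> sig m A' B' C' -> sig m (A + A') (B + B') (C + C').
Proof.
move=> [f [g [p [df dg dp [e1 e2 e3]]]]] [f' [g' [p' [df' dg' dp' [e1' e2' e3']]]]].
exists (f + f'), (g + g'), (p + p'); split; try exact: bdegD.
by split; rewrite ?mulrnDl ?(e1, e2, e3) ?(e1', e2', e3') !(dpxD, dpyD); ring.
Qed.

Lemma sigZ (R : realType) m c (A B C : bpoly R) :
  sig m A B C -> sig m (c%:P%:P * A) (c%:P%:P * B) (c%:P%:P * C).
Proof.
move=> [f [g [p [df dg dp [e1 e2 e3]]]]].
exists (c%:P%:P * f), (c%:P%:P * g), (c%:P%:P * p); split; try exact: bdegZ.
by split; rewrite -?mulrnAr ?(e1, e2, e3) !(dpxZ, dpyZ); ring.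
Qed.

Lemma sig0 (R : realType) m : sig m (0 : bpoly R) 0 0.
Proof.
by exists 0, 0, 0; split; try exact: bdeg0; split; rewrite !(dpxE, dpyE) mul0r ?mul0rn !(oppr0, addr0).
Qed.

(** Monomial by monomial. When both exponents are positive, the diagonal entries produced by f and g
    are cancelled by p x x^T, and the three contributions to the off-diagonal entry add up with
    positive coefficients; the resulting integer [c] is divided out. *)
Lemma sig12 (R : realType) m (A : bpoly R) : bdeg m A -> sig m 0 A 0.
Proof.
move=> dA; rewrite (bdegE dA).
have D (B B' : bpoly R) : sig m 0 B 0 -> sig m 0 B' 0 -> sig m 0 (B + B') 0.
  by move=> s s'; have := sigD s s'; rewrite !addr0.
have Z (c : R) B : sig m 0 B 0 -> sig m 0 (c%:P%:P * B) 0.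
  by move=> /(sigZ c); rewrite !mulr0.
apply: (big_ind (fun B => sig m 0 B 0)) => // [|i _]; first exact: sig0.
apply: (big_ind (fun B => sig m 0 B 0)) => // [|j _]; first exact: sig0.
have [ij|ij] := ltnP m (i + j); first by rewrite dA // mul0r; exact: sig0.
apply: Z; rewrite -/(mono R i j); move: (nat_of_ord i) (nat_of_ord j) ij => {i j} i j ij.
have half (c : nat) : (c%:R / 2)%:P%:P * mono R i j *+ 2 = mono R i j *+ c.
  by rewrite -mulrnAl -!polyCMn -[_ *+ 2]mulr_natr divfK ?pnatr_eq0 // !polyCMn mulrnAl mul1r.
suff [c c0 h] : exists2 c : nat, (0 < c)%N & sig m 0 ((c%:R / 2)%:P%:P * mono R i j) 0.
  have := sigZ (2 / c%:R) h; rewrite !mulr0 mulrA -!polyCM.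
  by rewrite (_ : 2 / c%:R * (c%:R / 2) = 1) ?mul1r //; field; rewrite pnatr_eq0 -lt0n.
have dm a b c : (a + b <= c)%N -> bdeg c (mono R a b).
  by move=> h; apply: bdegW h (@bdeg_mono R _ _).
case: i j ij half => [|i] [|j] ij half.
- exists 1%N => //; exists 0, (mono R 0 1), 0; split; try exact: bdeg0.
    by apply: dm; lia.
  rewrite half dpx_mono dpy_mono dpxE dpyE /=; split; ring.
- exists j.+2 => //; exists 0, (mono R 0 j.+2), 0; split; try exact: bdeg0.
    by apply: dm; lia.
  rewrite half dpx_mono dpy_mono dpxE dpyE /=; split; ring.
- exists i.+2 => //; exists (- mono R i.+2 0), 0, 0; split; try exact: bdeg0.
    by apply: bdegN; apply: dm; lia.
  rewrite half dpxN dpyN dpx_mono dpy_mono dpxE dpyE /=; split; ring.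
exists (j.+1 * j.+2 + i.+1 * i.+2 + 2 * (i.+1 * j.+1))%N => //.
exists (- mono R i.+2 j.+1 *+ i.+1), (mono R i.+1 j.+2 *+ j.+1), (mono R i j *+ (i.+1 * j.+1)).
split; [apply: bdegMn; apply: bdegN|apply: bdegMn|apply: bdegMn|]; try (apply: dm; lia).
rewrite half !dpxMn !dpyMn dpxN dpyN !dpx_mono !dpy_mono /=.
have e1 a b : mono R a.+1 b = px * mono R a b by rewrite /mono exprS mulrA.
have e2 a b : mono R a b.+1 = py * mono R a b by rewrite /mono exprS mulrCA.
rewrite !e1 !e2; move: (mono R i j) px py => w x y.
split; ring.
Qed.

(** A diagonal entry is an antiderivative away from a sym curl, at the price of an off-diagonal
    entry that [sig12] removes. *)
Lemma sig_complete (R : realType) m (A B C : bpoly R) :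
  bdeg m A -> bdeg m B -> bdeg m C -> sig m A B C.
Proof.
move=> dA dB dC.
have dm a b c : (a + b <= c)%N -> bdeg c (mono R a b).
  by move=> h; apply: bdegW h (@bdeg_mono R _ _).
have scal (c : nat) (P : bpoly R) : (c.+1%:R^-1)%:P%:P * (P *+ c.+1) = P.
  by rewrite mulrnAr -mulrnAl -!polyCMn -[_ *+ _]mulr_natr mulVf ?pnatr_eq0 // mul1r.
have half (P : bpoly R) : 2^-1%:P%:P * P *+ 2 = P by rewrite -mulrnAr; exact: (scal 1%N).
have s11 : sig m A 0 0.
  rewrite (bdegE dA).
  apply: (big_ind (fun P => sig m P 0 0)) => [|P Q sP sQ|i _]; [exact: sig0|by have := sigD sP sQ; rewrite !addr0|].
  apply: (big_ind (fun P => sig m P 0 0)) => [|P Q sP sQ|j _]; [exact: sig0|by have := sigD sP sQ; rewrite !addr0|].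
  have [ij|ij] := ltnP m (i + j); first by rewrite dA // mul0r; exact: sig0.
  suff h : sig m (mono R i j) 0 0 by have := sigZ ((A`_j)`_i) h; rewrite !mulr0.
  pose g := mono R i j.+1.
  have dg : bdeg m.+1 g by apply: dm; rewrite addnS.
  have s : sig m (mono R i j *+ j.+1) (2^-1%:P%:P * - dpx g) 0.
    exists g, 0, 0; split; try exact: bdeg0; first by [].
    by rewrite half dpy_mono !(dpxE, dpyE) /=; split; ring.
  have s12 : sig m 0 (2^-1%:P%:P * dpx g) 0.
    by apply: sig12; apply: bdegZ; exact: (bdeg_dpx dg).
  have := sigZ (j.+1%:R^-1) (sigD s s12).
  by rewrite !addr0 scal -mulrDr addNr !mulr0.
have s22 : sig m 0 0 C.
  rewrite (bdegE dC).
  apply: (big_ind (fun P => sig m 0 0 P)) => [|P Q sP sQ|i _]; [exact: sig0|by have := sigD sP sQ; rewrite !addr0|].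
  apply: (big_ind (fun P => sig m 0 0 P)) => [|P Q sP sQ|j _]; [exact: sig0|by have := sigD sP sQ; rewrite !addr0|].
  have [ij|ij] := ltnP m (i + j); first by rewrite dC // mul0r; exact: sig0.
  suff h : sig m 0 0 (mono R i j) by have := sigZ ((C`_j)`_i) h; rewrite !mulr0.
  pose g := mono R i.+1 j.
  have dg : bdeg m.+1 g by apply: dm; rewrite addSn.
  have s : sig m 0 (2^-1%:P%:P * - dpy g) (mono R i j *+ i.+1).
    exists 0, (- g), 0; split; try exact: bdeg0; first exact: bdegN.
    by rewrite half dpxN dpyN dpx_mono !(dpxE, dpyE) /=; split; ring.
  have s12 : sig m 0 (2^-1%:P%:P * dpy g) 0.
    by apply: sig12; apply: bdegZ; exact: (bdeg_dpy dg).
  have := sigZ (i.+1%:R^-1) (sigD s s12).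
  by rewrite !addr0 scal -mulrDr addNr !mulr0.
have := sigD (sigD s11 (sig12 dB)) s22.
by rewrite !addr0 !add0r.
Qed.

Definition mx2 (R : realType) (a b c : R) : 'M[R]_2 :=
  \matrix_(i, j) (if i == j then (if i == 0 then a else c) else b).

Lemma mx2P (R : realType) (A : 'M[R]_2) a b c :
  A 0 0 = a -> A 0 1 = b -> A 1 0 = b -> A 1 1 = c -> A = mx2 a b c.
Proof.
move=> h00 h01 h10 h11; apply/matrixP => i j; rewrite mxE.
have o (m : 'I_2) : m = 0 \/ m = 1.
  by case: m => [[|[|//]] p]; [left|right]; exact: val_inj.
by case: (o i) => ->; case: (o j) => ->.
Qed.

Definition shift_frame (R : realType) (x0 : R * R) : frame R :=
  Frame x0 (x0.1 + 1, x0.2) (x0.1, x0.2 + 1).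

Lemma shift_frameE (R : realType) (x0 : R * R) :
  [/\ fdet (shift_frame x0) = 1, grad2 (shift_frame x0) = (1, 0) &
      grad3 (shift_frame x0) = (0, 1)].
Proof.
have e : fdet (shift_frame x0) = 1 by rewrite /fdet /det2 /te2 /te3 /=; ring.
by rewrite /grad2 /grad3 e; split=> //; rewrite /te2 /te3 /=; congr pair; field.
Qed.

Lemma bary_shift (R : realType) (x0 x : R * R) : bary (shift_frame x0) x = x - x0.
Proof.
have [_ g2 g3] := shift_frameE x0.
by rewrite /bary g2 g3 /dotp /=; apply: injective_projections => /=; ring.
Qed.

Lemma pd_shift (R : realType) (x0 : R * R) (P : bpoly R) x :
  pd 0 (plift (shift_frame x0) P) x = plift (shift_frame x0) (dpx P) x /\
  pd 1 (plift (shift_frame x0) P) x = plift (shift_frame x0) (dpy P) x.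
Proof.
have [_ g2 g3] := shift_frameE x0.
rewrite /pd /basis_vec !D_liftE g2 g3 /dotp /plift !(evE (bary _ x)) /=.
by split; ring.
Qed.

Lemma dyad_mx2 (R : realType) (a : R * R) :
  colvec a *m (colvec a)^T = mx2 (a.1 * a.1) (a.1 * a.2) (a.2 * a.2).
Proof. by apply: mx2P; rewrite !mxE big_ord1 !mxE /= ?[a.2 * _]mulrC. Qed.

(** * The local shape function space *)

(** P_{k-1}(S) + x x^T P_{k-2}, the form in which the test fields are obtained. The order l is
    compared with k only in [mform_Sigma_loc], where P_k has to lie in P_{l+1}. *)
Definition mform (R : realType) (k : nat) (x0 : R * R) (tau : R * R -> 'M[R]_2) : Prop :=
  exists a b c p : R * R -> R,
  [/\ [/\ Poly_le (k - 1) a, Poly_le (k - 1) b & Poly_le (k - 1) c], Poly_le (k - 2) p &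
      forall x, tau x = mx2 (a x) (b x) (c x) +
                        p x *: (colvec (x - x0) *m (colvec (x - x0))^T)].

Lemma mx2D (R : realType) (a b c a' b' c' : R) :
  mx2 a b c + mx2 a' b' c' = mx2 (a + a') (b + b') (c + c').
Proof. by apply: mx2P; rewrite !mxE. Qed.

Lemma mformD (R : realType) k (x0 : R * R) (s t : R * R -> 'M[R]_2) :
  mform k x0 s -> mform k x0 t -> mform k x0 (fun x => s x + t x).
Proof.
move=> [a [b [c [p [[da db dc] dp sE]]]]] [a' [b' [c' [p' [[da' db' dc'] dp' tE]]]]].
exists (fun x => a x + a' x), (fun x => b x + b' x), (fun x => c x + c' x), (fun x => p x + p' x).
split; [by split; exact: Poly_leD|exact: Poly_leD|move=> x].
by rewrite sE tE -mx2D scalerDl addrACA.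
Qed.

Lemma mx2Z (R : realType) (s a b c : R) : s *: mx2 a b c = mx2 (s * a) (s * b) (s * c).
Proof. by apply: mx2P; rewrite !mxE. Qed.

Lemma sym_curl (R : realType) (phi : 'I_2 -> R * R -> R) x :
  sym (curl_rows phi x) = mx2 (pd 1 (phi 0) x)
    (2^-1 * (pd 1 (phi 1) x - pd 0 (phi 0) x)) (- pd 0 (phi 1) x).
Proof. by apply: mx2P; rewrite !mxE /=; field. Qed.

Lemma mform_Sigma_loc (R : realType) k l (x0 : R * R) tau :
  (3 <= k)%N -> (k - 1 <= l)%N -> mform k x0 tau -> Sigma_loc l k x0 tau.
Proof.
move=> k3 kl [a [b [c [p [[da db dc] dp tE]]]]].
have [d1 _ _] := shift_frameE x0; have d0 : fdet (shift_frame x0) != 0 by rewrite d1 oner_neq0.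
have [A dA aE] := Poly_le_liftP d0 da; have [B dB bE] := Poly_le_liftP d0 db.
have [C dC cE] := Poly_le_liftP d0 dc.
have [f [g [q [df dg dq [eA eB eC]]]]] := sig_complete dA dB dC.
exists (fun i => if i == 0 then plift (shift_frame x0) f else plift (shift_frame x0) g).
exists (fun x => p x + plift (shift_frame x0) q x); split.
- move=> i; have kl' : ((k - 1).+1 <= l.+1)%N by lia.
  by case: ifP => _; apply: (Poly_leW kl'); exact: Poly_le_lift.
- apply: Poly_leD => //; rewrite (_ : (k - 2 = (k - 1).-1)%N); last by lia.
  exact: Poly_le_lift.
move=> x; rewrite tE scalerDl addrA addrAC; congr (_ + _).
have [pf0 pf1] := pd_shift x0 f x; have [pg0 pg1] := pd_shift x0 g x.
have xy : ev (px : bpoly R) (bary (shift_frame x0) x) = x.1 - x0.1 /\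
          ev (py : bpoly R) (bary (shift_frame x0) x) = x.2 - x0.2.
  by rewrite bary_shift !evE.
rewrite dyad_mx2 mx2Z sym_curl mx2D /= pf0 pf1 pg0 pg1 aE bE cE.
rewrite /plift; case: xy; move: (bary _ x) => z xE yE; rewrite -xE -yE eA eC; congr mx2.
- by rewrite !(evE z).
- have : ev (B *+ 2) z = ev (dpy g - dpx f + q * (px * py) *+ 2) z by rewrite eB.
  rewrite !(evE z) => h; apply: (mulIf (_ : (2 : R) != 0)); first by rewrite pnatr_eq0.
  by rewrite mulr_natr h; field.
by rewrite !(evE z).
Qed.

Definition field11 (R : realType) (F : frame R) (u : tfield R) : bpoly R :=
  ((te1 F).1 ^+ 2)%:P%:P * tf1 u + ((te2 F).1 ^+ 2)%:P%:P * tf2 u + ((te3 F).1 ^+ 2)%:P%:P * tf3 u.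
Definition field12 (R : realType) (F : frame R) (u : tfield R) : bpoly R :=
  ((te1 F).1 * (te1 F).2)%:P%:P * tf1 u + ((te2 F).1 * (te2 F).2)%:P%:P * tf2 u +
  ((te3 F).1 * (te3 F).2)%:P%:P * tf3 u.
Definition field22 (R : realType) (F : frame R) (u : tfield R) : bpoly R :=
  ((te1 F).2 ^+ 2)%:P%:P * tf1 u + ((te2 F).2 ^+ 2)%:P%:P * tf2 u + ((te3 F).2 ^+ 2)%:P%:P * tf3 u.
Definition mfield (R : realType) (F : frame R) (u : tfield R) (x : R * R) : 'M[R]_2 :=
  mx2 (plift F (field11 F u) x) (plift F (field12 F u) x) (plift F (field22 F u) x).

(** Variance identity for barycentric weights: the sum of b_j t_j t_j^T equals the sum of l_i (p_i -
    x0)(p_i - x0)^T minus (x - x0)(x - x0)^T, with p_i the vertices. A common factor q thus yields -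
    q x x^T and entries of degree k - 1, which explains the definition of [shape]. *)
Lemma mform_mfield (R : realType) k (F : frame R) (u : tfield R) x0 :
  (3 <= k)%N -> fdet F != 0 -> shape k u -> mform k x0 (mfield F u).
Proof.
move=> k3 d0 [q [a1 [a2 [a3 [dq [da1 da2 da3] ->]]]]].
pose Q (c d : R * R -> R) := (c (te1 F) * d (te1 F))%:P%:P * a1 +
  (c (te2 F) * d (te2 F))%:P%:P * a2 + (c (te3 F) * d (te3 F))%:P%:P * a3 +
  q * ((c (fp1 F - x0) * d (fp1 F - x0))%:P%:P * l1 R +
       (c (fp2 F - x0) * d (fp2 F - x0))%:P%:P * l2 R +
       (c (fp3 F - x0) * d (fp3 F - x0))%:P%:P * l3 R).
have dQ c d : bdeg (k - 1) (Q c d).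
  have [dl1 dl2 dl3] := bdeg_l R.
  apply: bdegD; last first.
    apply: (bdegMW dq (n := 1)); last by lia.
    by apply: bdegD; [apply: bdegD|]; exact: bdegZ.
  by apply: bdegD; [apply: bdegD|]; exact: bdegZ.
exists (plift F (Q fst fst)), (plift F (Q fst snd)), (plift F (Q snd snd)), (plift F (- q)).
split; [by split; exact: Poly_le_lift|by apply: Poly_le_lift; exact: bdegN|].
move=> x; rewrite /mfield dyad_mx2 mx2Z mx2D.
have <- : unbary F (bary F x) = x by exact: baryK.
rewrite /plift unbaryK //; move: (bary F x) => z.
rewrite /unbary /field11 /field12 /field22 /Q /te1 /te2 /te3 /=.
congr (mx2 _ _ _); rewrite /GRing.scale /= !(evE z) !ev_bary; ring.
Qed.

Lemma grad_te (R : realType) (F : frame R) : fdet F != 0 ->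
  ((dotp (grad2 F) (te1 F) = -1) * (dotp (grad3 F) (te1 F) = 1)) *
  ((dotp (grad2 F) (te2 F) = 0) * (dotp (grad3 F) (te2 F) = -1)) *
  ((dotp (grad2 F) (te3 F) = 1) * (dotp (grad3 F) (te3 F) = 0)).
Proof.
case: F => -[a1 a2] [b1 b2] [c1 c2].
rewrite /dotp /grad2 /grad3 /fdet /det2 /te1 /te2 /te3 /= => d0.
by do !split; field.
Qed.

Lemma D_te (R : realType) (F : frame R) (P : bpoly R) x : fdet F != 0 ->
  ('D_(te1 F) (plift F P) x = plift F (d1 P) x) *
  ('D_(te2 F) (plift F P) x = plift F (d2 P) x) *
  ('D_(te3 F) (plift F P) x = plift F (d3 P) x).
Proof.
move=> d0; rewrite !D_liftE /plift !(grad_te d0) /d1 /d2 /d3.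
by move: (bary F x) => z; rewrite !(evE z); do !split; ring.
Qed.

Lemma D_comb3 (R : realType) (F : frame R) (a b c : R) (P Q S : bpoly R) w x :
  'D_w (plift F (a%:P%:P * P + b%:P%:P * Q + c%:P%:P * S)) x =
  a * 'D_w (plift F P) x + b * 'D_w (plift F Q) x + c * 'D_w (plift F S) x.
Proof.
rewrite !D_liftE /plift !(dpxD, dpyD, dpxZ, dpyZ); move: (bary F x) => z.
move: (dpx P) (dpx Q) (dpx S) (dpy P) (dpy Q) (dpy S) => P1 Q1 S1 P2 Q2 S2.
rewrite !(evE z); ring.
Qed.

Lemma pd_comb3 (R : realType) (F : frame R) (a b c : R) (P Q S : bpoly R) i x :
  pd i (plift F (a%:P%:P * P + b%:P%:P * Q + c%:P%:P * S)) x =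
  a * pd i (plift F P) x + b * pd i (plift F Q) x + c * pd i (plift F S) x.
Proof. exact: D_comb3. Qed.

Lemma D_dir (R : realType) (F : frame R) (P : bpoly R) w x :
  'D_w (plift F P) x = w.1 * pd 0 (plift F P) x + w.2 * pd 1 (plift F P) x.
Proof.
rewrite /pd !D_liftE /basis_vec /plift /dotp /=; move: (bary F x) => z.
rewrite !(evE z); ring.
Qed.

(** * Traces and divdiv of sums of dyads *)

Lemma bilin_mx2 (R : realType) (a b : R * R) p q r :
  bilin a (mx2 p q r) b = a.1 * p * b.1 + a.1 * q * b.2 + a.2 * q * b.1 + a.2 * r * b.2.
Proof.
rewrite /bilin !mxE !big_ord_recl big_ord0 !mxE !big_ord_recl !big_ord0 !mxE /=; ring.
Qed.

Lemma nn_mfield (R : realType) (F : frame R) (u : tfield R) n x :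
  bilin n (mfield F u x) n = dotp n (te1 F) ^+ 2 * plift F (tf1 u) x +
    dotp n (te2 F) ^+ 2 * plift F (tf2 u) x + dotp n (te3 F) ^+ 2 * plift F (tf3 u) x.
Proof.
rewrite bilin_mx2 /plift /field11 /field12 /field22 /dotp; move: (bary F x) => z.
rewrite !(evE z); ring.
Qed.

Definition tnval (R : realType) (n : R * R) (tau : R * R -> 'M[R]_2) (x : R * R) : R :=
  'D_(rot90 n) (fun y => bilin (rot90 n) (tau y) n) x + ((colvec n)^T *m div_rows tau x) 0 0.

Lemma div_rowsE (R : realType) (a b c : R * R -> R) x :
  let tau y := mx2 (a y) (b y) (c y) in
  div_rows tau x 0 0 = pd 0 a x + pd 1 b x /\ div_rows tau x 1 0 = pd 0 b x + pd 1 c x.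
Proof.
move=> tau.
have h00 : (fun y => tau y 0 0) = a by apply/funext => y; rewrite mxE.
have h01 : (fun y => tau y 0 1) = b by apply/funext => y; rewrite mxE.
have h10 : (fun y => tau y 1 0) = b by apply/funext => y; rewrite mxE.
have h11 : (fun y => tau y 1 1) = c by apply/funext => y; rewrite mxE.
by split; rewrite mxE !big_ord_recl big_ord0 addr0 (_ : lift _ _ = 1); try exact: val_inj;
  rewrite ?(h00, h01, h10, h11).
Qed.

Lemma colvecM (R : realType) (n : R * R) (A : 'cV[R]_2) :
  ((colvec n)^T *m A) 0 0 = n.1 * A 0 0 + n.2 * A 1 0.
Proof.
rewrite mxE !big_ord_recl big_ord0 addr0 !mxE /=; congr (_ * A _ _ + _ * A _ _); exact: val_inj.
Qed.

(** The divergence of u t t^T is the derivative of u along t times t, so each dyad enters with the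
    factor n . t_j. *)
Lemma tn_mfield (R : realType) (F : frame R) (u : tfield R) n x :
  let D w P := 'D_w (plift F P) x in
  tnval n (mfield F u) x =
    dotp n (te1 F) * (dotp (rot90 n) (te1 F) * D (rot90 n) (tf1 u) + D (te1 F) (tf1 u)) +
    dotp n (te2 F) * (dotp (rot90 n) (te2 F) * D (rot90 n) (tf2 u) + D (te2 F) (tf2 u)) +
    dotp n (te3 F) * (dotp (rot90 n) (te3 F) * D (rot90 n) (tf3 u) + D (te3 F) (tf3 u)).
Proof.
move=> /=; rewrite /tnval colvecM.
have [-> ->] := div_rowsE (plift F (field11 F u)) (plift F (field12 F u)) (plift F (field22 F u)) x.
rewrite (_ : (fun y => _) = plift F
  ((dotp (rot90 n) (te1 F) * dotp n (te1 F))%:P%:P * tf1 u +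
   (dotp (rot90 n) (te2 F) * dotp n (te2 F))%:P%:P * tf2 u +
   (dotp (rot90 n) (te3 F) * dotp n (te3 F))%:P%:P * tf3 u)); last first.
  apply/funext => y; rewrite bilin_mx2 /plift /field11 /field12 /field22 /dotp.
  by move: (bary F y) => z; rewrite !(evE z) /=; ring.
rewrite !D_comb3 !(D_dir F _ (rot90 n)) !(D_dir F _ (te1 F)) !(D_dir F _ (te2 F)) !(D_dir F _ (te3 F)).
rewrite !pd_comb3.
move: (pd 0 (plift F (tf1 u)) x) (pd 1 (plift F (tf1 u)) x) => a1 a2.
move: (pd 0 (plift F (tf2 u)) x) (pd 1 (plift F (tf2 u)) x) => b1 b2.
move: (pd 0 (plift F (tf3 u)) x) (pd 1 (plift F (tf3 u)) x) => c1 c2.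
move: (te1 F) (te2 F) (te3 F) => t1 t2 t3; rewrite /dotp /=; ring.
Qed.

Lemma div_mfield (R : realType) (F : frame R) (u : tfield R) x : fdet F != 0 ->
  div_rows (mfield F u) x 0 0 = plift F ((te1 F).1%:P%:P * d1 (tf1 u) +
    (te2 F).1%:P%:P * d2 (tf2 u) + (te3 F).1%:P%:P * d3 (tf3 u)) x /\
  div_rows (mfield F u) x 1 0 = plift F ((te1 F).2%:P%:P * d1 (tf1 u) +
    (te2 F).2%:P%:P * d2 (tf2 u) + (te3 F).2%:P%:P * d3 (tf3 u)) x.
Proof.
move=> d0.
have [-> ->] := div_rowsE (plift F (field11 F u)) (plift F (field12 F u)) (plift F (field22 F u)) x.
have E (a b c : R) P Q S : plift F (a%:P%:P * P + b%:P%:P * Q + c%:P%:P * S) x =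
    a * plift F P x + b * plift F Q x + c * plift F S x.
  by rewrite /plift !(evE (bary F x)).
rewrite !E -!(D_te _ _ d0).1.1 -!(D_te _ _ d0).1.2 -!(D_te _ _ d0).2.
rewrite !(D_dir F _ (te1 F)) !(D_dir F _ (te2 F)) !(D_dir F _ (te3 F)).
rewrite !pd_comb3.
move: (pd 0 (plift F (tf1 u)) x) (pd 1 (plift F (tf1 u)) x) => a1 a2.
move: (pd 0 (plift F (tf2 u)) x) (pd 1 (plift F (tf2 u)) x) => b1 b2.
move: (pd 0 (plift F (tf3 u)) x) (pd 1 (plift F (tf3 u)) x) => c1 c2.
by split; ring.
Qed.

Lemma divdivE (R : realType) (tau : R * R -> 'M[R]_2) x :
  divdiv tau x = pd 0 (fun y => div_rows tau y 0 0) x + pd 1 (fun y => div_rows tau y 1 0) x.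
Proof.
rewrite /divdiv !big_ord_recl big_ord0 addr0; congr (_ + _).
by rewrite (_ : lift _ _ = 1) //; exact: val_inj.
Qed.

Lemma divdiv_mfield (R : realType) (F : frame R) (u : tfield R) x : fdet F != 0 ->
  divdiv (mfield F u) x = plift F (divdiv_ref u) x.
Proof.
move=> d0; rewrite divdivE.
rewrite (funext (fun y => (div_mfield u y d0).1)) (funext (fun y => (div_mfield u y d0).2)).
rewrite !pd_comb3 /divdiv_ref.
have -> : plift F (d1 (d1 (tf1 u)) + d2 (d2 (tf2 u)) + d3 (d3 (tf3 u))) x =
    plift F (d1 (d1 (tf1 u))) x + plift F (d2 (d2 (tf2 u))) x + plift F (d3 (d3 (tf3 u))) x.
  by rewrite /plift !(evE (bary F x)).
rewrite -(D_te _ _ d0).1.1 -(D_te _ _ d0).1.2 -(D_te _ _ d0).2.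
rewrite !(D_dir F _ (te1 F)) !(D_dir F _ (te2 F)) !(D_dir F _ (te3 F)).
move: (pd 0 (plift F (d1 (tf1 u))) x) (pd 1 (plift F (d1 (tf1 u))) x) => a1 a2.
move: (pd 0 (plift F (d2 (tf2 u))) x) (pd 1 (plift F (d2 (tf2 u))) x) => b1 b2.
move: (pd 0 (plift F (d3 (tf3 u))) x) (pd 1 (plift F (d3 (tf3 u))) x) => c1 c2.
ring.
Qed.

(* The tangential offset of the opposite vertex from the midpoint of an edge [ta], in
   units of that edge. *)
Definition tratio (R : realType) (n ta tb : R * R) : R :=
  dotp (rot90 n) tb / dotp (rot90 n) ta + 2^-1.

Lemma dotp_rot90 (R : realType) (n v w : R * R) : dotp n n = 1 ->
  dotp n v * dotp (rot90 n) w - dotp (rot90 n) v * dotp n w = det2 v w.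
Proof.
case: n v w => [n1 n2] [v1 v2] [w1 w2]; rewrite /dotp /rot90 /det2 /= => e.
rewrite -[RHS]mul1r -e; ring.
Qed.

Lemma dotp_split (R : realType) (n v : R * R) : dotp n n = 1 ->
  v = dotp n v *: n + dotp (rot90 n) v *: rot90 n.
Proof.
case: n v => [n1 n2] [v1 v2]; rewrite /dotp /rot90 /= => e.
apply: injective_projections; rewrite /= /GRing.scale /=.
  rewrite -[LHS]mul1r -e; ring.
rewrite -[LHS]mul1r -e; ring.
Qed.

Lemma te_cycle (R : realType) (F : frame R) :
  [/\ te1 F + te2 F + te3 F = 0, fdet F = det2 (te1 F) (te2 F) & fdet F = det2 (te3 F) (te1 F)].
Proof.
rewrite /fdet /det2 /te1 /te2 /te3; split; last 2 first.
- by rewrite /=; ring.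
- by rewrite /=; ring.
by apply: injective_projections; rewrite /=; ring.
Qed.

Lemma edge_numbers (R : realType) (n ta tb tc : R * R) : dotp n n = 1 -> ta + tb + tc = 0 -> det2 ta tb != 0 ->
  dotp n ta = 0 ->
  [/\ dotp n tc = - dotp n tb, det2 ta tb = - (dotp (rot90 n) ta * dotp n tb),
      dotp (rot90 n) ta != 0, dotp n tb != 0 &
      rot90 n = (dotp (rot90 n) ta)^-1 *: ta].
Proof.
move=> nn s0 d0 na.
have dE : det2 ta tb = - (dotp (rot90 n) ta * dotp n tb).
  by rewrite -(dotp_rot90 ta tb nn) na mul0r sub0r.
have [m0 a0] : dotp (rot90 n) ta != 0 /\ dotp n tb != 0.
  by move: d0; rewrite dE oppr_eq0 mulf_eq0 negb_or => /andP.
split=> //.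
- have : dotp n (ta + tb + tc) = 0 by rewrite s0 /dotp /= !mulr0 addr0.
  have -> : dotp n (ta + tb + tc) = dotp n ta + dotp n tb + dotp n tc by rewrite /dotp /=; ring.
  by rewrite na add0r => /eqP; rewrite addrC addr_eq0 => /eqP.
have e := dotp_split ta nn; rewrite na scale0r add0r in e.
by apply: (scalerI m0); rewrite -e scalerA mulfV // scale1r.
Qed.

Lemma D_scale (R : realType) (F : frame R) (P : bpoly R) c w x :
  'D_(c *: w) (plift F P) x = c * 'D_w (plift F P) x.
Proof. rewrite !(D_dir F P); move: (pd 0 _ x) (pd 1 _ x) => a b.
by rewrite /= /GRing.scale /=; ring. Qed.

Lemma plift_d (R : realType) (F : frame R) (P Q : bpoly R) x :
  [/\ plift F (d1 (P + Q)) x = plift F (d1 P) x + plift F (d1 Q) x,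
      plift F (d2 (P + Q)) x = plift F (d2 P) x + plift F (d2 Q) x &
      plift F (d3 (P + Q)) x = plift F (d3 P) x + plift F (d3 Q) x].
Proof.
rewrite /plift /d1 /d2 /d3 !(dpxD, dpyD); move: (bary F x) => z.
by rewrite !(evE z); split; ring.
Qed.

Lemma plift_aff (R : realType) (F : frame R) (P Q : bpoly R) x :
  [/\ plift F (aff1 P Q) x =
        plift F (d1 Q) x - plift F (d1 P) x + (plift F (d2 P) x - plift F (d3 Q) x) * 2,
      plift F (aff2 P Q) x =
        plift F (d2 Q) x - plift F (d2 P) x + (plift F (d3 P) x - plift F (d1 Q) x) * 2 &
      plift F (aff3 P Q) x =
        plift F (d3 Q) x - plift F (d3 P) x + (plift F (d1 P) x - plift F (d2 Q) x) * 2].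
Proof.
rewrite /plift /aff1 /aff2 /aff3 /d1 /d2 /d3 !(dpxD, dpyD, dpxN, dpyN).
by move: (bary F x) => z; rewrite !(evE z); split; ring.
Qed.

(** Seen from an edge, its own dyad drops out and the other two have opposite heights. Separating
    half sums from half differences of their coefficients leaves an affine-invariant term and one
    tangential derivative weighted by the slant. *)
Lemma edge_trace (R : realType) (F : frame R) (u : tfield R) n x :
  fdet F != 0 -> dotp n n = 1 ->
  [/\ dotp n (te1 F) = 0 ->
    bilin n (mfield F u x) n = dotp n (te2 F) ^+ 2 * plift F (tf2 u + tf3 u) x /\
    tnval n (mfield F u) x = dotp n (te2 F) * (2^-1 * plift F (aff1 (tf2 u) (tf3 u)) x +
      tratio n (te1 F) (te2 F) * plift F (d1 (tf2 u + tf3 u)) x),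
    dotp n (te2 F) = 0 ->
    bilin n (mfield F u x) n = dotp n (te3 F) ^+ 2 * plift F (tf3 u + tf1 u) x /\
    tnval n (mfield F u) x = dotp n (te3 F) * (2^-1 * plift F (aff2 (tf3 u) (tf1 u)) x +
      tratio n (te2 F) (te3 F) * plift F (d2 (tf3 u + tf1 u)) x) &
    dotp n (te3 F) = 0 ->
    bilin n (mfield F u x) n = dotp n (te1 F) ^+ 2 * plift F (tf1 u + tf2 u) x /\
    tnval n (mfield F u) x = dotp n (te1 F) * (2^-1 * plift F (aff3 (tf1 u) (tf2 u)) x +
      tratio n (te3 F) (te1 F) * plift F (d3 (tf1 u + tf2 u)) x)].
Proof.
move=> d0 nn; have [s0 dE dE'] := te_cycle F.
have [a1 a2 a3] := plift_aff F (tf2 u) (tf3 u) x; have [b1 b2 b3] := plift_aff F (tf3 u) (tf1 u) x.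
have [c1 c2 c3] := plift_aff F (tf1 u) (tf2 u) x.
have [e1 e2 e3] := plift_d F (tf2 u) (tf3 u) x; have [f1 f2 f3] := plift_d F (tf3 u) (tf1 u) x.
have [g1 g2 g3] := plift_d F (tf1 u) (tf2 u) x.
have third a b c : a + b + c = 0 -> dotp (rot90 n) c = - dotp (rot90 n) a - dotp (rot90 n) b.
  move=> s; have : dotp (rot90 n) (a + b + c) = 0 by rewrite s /dotp /= !mulr0 addr0.
  by rewrite /dotp /= => e; apply/eqP; rewrite -subr_eq0 -e; apply/eqP; ring.
(* m and b are the tangential components of the edge and of the next one; the third edge has
   component - m - b. Apart from the height A, only b / m + 1 / 2 depends on the triangle. *)
have alg (A m b p q y z : R) : m != 0 ->
  A * (b * (m^-1 * p) + y) + - A * ((- m - b) * (m^-1 * q) + z) =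
  A * (2^-1 * (q - p + (y - z) * 2) + (b / m + 2^-1) * (p + q)) by move=> ?; field.
split=> na.
- have [n3 _ m0 _ tE] := edge_numbers nn s0 (ltac:(by rewrite -dE)) na.
  split; first by rewrite nn_mfield na n3 sqrrN /plift !(evE (bary F x)); ring.
  have Dt P : 'D_(rot90 n) (plift F P) x = (dotp (rot90 n) (te1 F))^-1 * plift F (d1 P) x.
    by rewrite {1}tE D_scale (D_te _ _ d0).
  rewrite tn_mfield na n3 mul0r add0r (third _ _ _ s0) !Dt !(D_te _ _ d0) /tratio a1 e1.
  exact: alg.
- have s1 : te2 F + te3 F + te1 F = 0 by rewrite -s0 addrC addrA.
  have [n3 _ m0 _ tE] := edge_numbers nn s1 d0 na.
  split; first by rewrite nn_mfield na n3 sqrrN /plift !(evE (bary F x)); ring.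
  have Dt P : 'D_(rot90 n) (plift F P) x = (dotp (rot90 n) (te2 F))^-1 * plift F (d2 P) x.
    by rewrite {1}tE D_scale (D_te _ _ d0).
  rewrite tn_mfield na n3 mul0r addr0 (third _ _ _ s1) !Dt !(D_te _ _ d0) /tratio b2 f2.
  by rewrite addrC; exact: alg.
have s1 : te3 F + te1 F + te2 F = 0 by rewrite -s0 -addrA addrC.
have [n3 _ m0 _ tE] := edge_numbers nn s1 (ltac:(by rewrite -dE')) na.
split; first by rewrite nn_mfield na n3 sqrrN /plift !(evE (bary F x)); ring.
have Dt P : 'D_(rot90 n) (plift F P) x = (dotp (rot90 n) (te3 F))^-1 * plift F (d3 P) x.
  by rewrite {1}tE D_scale (D_te _ _ d0).
rewrite tn_mfield na n3 mul0r addr0 (third _ _ _ s1) !Dt !(D_te _ _ d0) /tratio c3 g3.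
exact: alg.
Qed.

Lemma plift_tr (R : realType) (F : frame R) (P : bpoly R) x s :
  [/\ bary F x = (1 - s, s) -> plift F P x = (tr1 P).[s],
      bary F x = (0, 1 - s) -> plift F P x = (tr2 P).[s] &
      bary F x = (s, 0) -> plift F P x = (tr3 P).[s]].
Proof.
by split => e; rewrite /plift e /tr1 /tr2 /tr3 horner_sub2 !hornerE.
Qed.

Lemma one_edge_trace (R : realType) k (F : frame R) (u : tfield R) f g n x s :
  fdet F != 0 -> dotp n n = 1 -> one_edge k u f g ->
  [/\ dotp n (te1 F) = 0 -> bary F x = (1 - s, s) ->
        bilin n (mfield F u x) n = dotp n (te2 F) ^+ 2 * f.[s] /\
        tnval n (mfield F u) x = dotp n (te2 F) *
          (2^-1 * g.[s] + tratio n (te1 F) (te2 F) * f^`().[s]),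
      dotp n (te2 F) = 0 -> bary F x = (0, 1 - s) ->
        bilin n (mfield F u x) n = 0 /\ tnval n (mfield F u) x = 0 &
      dotp n (te3 F) = 0 -> bary F x = (s, 0) ->
        bilin n (mfield F u x) n = 0 /\ tnval n (mfield F u) x = 0].
Proof.
move=> d0 nn [_ _ [n1 n2 n3] [t1 t2 t3]].
have [T1 T2 T3] := edge_trace u x d0 nn.
split=> na bx.
- have L P : plift F P x = (tr1 P).[s] by have [h _ _] := plift_tr F P x s; exact: h.
  by have [-> ->] := T1 na; rewrite !L -deriv_tr1 -n1 -t1.
- have L P : plift F P x = (tr2 P).[s] by have [_ h _] := plift_tr F P x s; exact: h.
  have [-> ->] := T2 na; rewrite !L -deriv_tr2.
  rewrite -/(nn2 u) -/(tn2 u) n2 t2 -polyC0 derivC hornerC; split; ring.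
have L P : plift F P x = (tr3 P).[s] by have [_ _ h] := plift_tr F P x s; exact: h.
have [-> ->] := T3 na; rewrite !L -deriv_tr3.
rewrite -/(nn3 u) -/(tn3 u) n3 t3 -polyC0 derivC hornerC; split; ring.
Qed.

(** The derivative along n on the first edge ([normal_traceE]), split into the median derivative
    that occurs in [green] and a tangential correction. *)
Definition normal_trace (R : realType) (F : frame R) (n : R * R) (V : bpoly R) : {poly R} :=
  (dotp n (te2 F))^-1%:P * (2^-1%:P * tr1 (d2 V - d3 V) -
     (tratio n (te1 F) (te2 F))%:P * tr1 (d1 V)).

Lemma normal_traceE (R : realType) (F : frame R) n (V : bpoly R) x s :
  fdet F != 0 -> dotp n n = 1 -> dotp n (te1 F) = 0 -> bary F x = (1 - s, s) ->
  'D_n (plift F V) x = (normal_trace F n V).[s].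
Proof.
move=> d0 nn na bx; have [s0 dE _] := te_cycle F.
have dE0 : det2 (te1 F) (te2 F) != 0 by rewrite -dE.
have [n3 _ m0 a0 tE] := edge_numbers nn s0 dE0 na.
have L P : plift F P x = (tr1 P).[s] by have [h _ _] := plift_tr F P x s; exact: h.
have nE : n = (dotp n (te2 F))^-1 *: te2 F +
   (- ((dotp n (te2 F))^-1 * (dotp (rot90 n) (te2 F) / dotp (rot90 n) (te1 F)))) *: te1 F.
  apply: (scalerI a0); rewrite scalerDr !scalerA mulfV // scale1r mulrN mulrA mulfV // mul1r.
  by rewrite scaleNr -scalerA -tE [X in _ = X - _](dotp_split (te2 F) nn) addrK.
rewrite {1}nE.
have -> (a b : R) (v w : R * R) : 'D_(a *: v + b *: w) (plift F V) x =
    a * 'D_v (plift F V) x + b * 'D_w (plift F V) x.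
  rewrite -!D_scale !(D_dir F V); move: (pd 0 _ x) (pd 1 _ x) => c d.
  by rewrite /= /GRing.scale /=; ring.
rewrite !(D_te _ _ d0) !L /normal_trace.
have -> : tr1 (d2 V - d3 V) = tr1 (d2 V) *+ 2 + tr1 (d1 V).
  have -> : d2 V - d3 V = d2 V *+ 2 + d1 V by rewrite /d1 /d2 /d3; ring.
  by rewrite !tr1E.
move: (tr1 (d2 V)) (tr1 (d1 V)) => p q; rewrite /tratio !(hornerD, hornerM, hornerN, hornerC, hornerMn).
move: m0 a0; move: (dotp n (te2 F)) (dotp (rot90 n) (te1 F)) => a m m0 a0.
by field; apply/andP.
Qed.

Lemma I1_parts (R : realType) (p q : {poly R}) : p.[0] = 0 -> p.[1] = 0 ->
  I1 (p^`() * q) = - I1 (p * q^`()).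
Proof.
move=> p0 p1; apply/eqP; rewrite -addr_eq0 -I1D -derivM I1_deriv !hornerM p0 p1 !mul0r subrr //.
Qed.

(** The factor of f' is the one that makes the effective shear in [one_edge_trace] vanish. As f is
    zero at both end points, integrating f' by parts produces exactly the tangential part of
    [normal_trace]. *)
Lemma green_normal (R : realType) k (F : frame R) n (u : tfield R) (r : {poly R}) (V : bpoly R) :
  dotp n (te2 F) != 0 -> let f := ('X - 'X ^+ 2) * r in
  one_edge k u f ((- (2 * tratio n (te1 F) (te2 F)))%:P * f^`()) ->
  I2 (divdiv_ref u * V) = pairing u V + dotp n (te2 F) * I1 (f * normal_trace F n V).
Proof.
move=> a0 f; rewrite /normal_trace => /(green_edge V); move: (tratio _ _ _) => c e.
have f0 : f.[0] = 0 by rewrite /f !hornerE; ring.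
have f1 : f.[1] = 0 by rewrite /f !hornerE; ring.
clearbody f; move: e; rewrite -(mulrA _ f^`()) I1Z (I1_parts _ f0 f1) deriv_tr1 mulrNN => e.
apply: (mulIf (_ : (2 : R) != 0)); first by rewrite pnatr_eq0.
rewrite !mulr_natr e mulrnDl; congr (_ + _).
have E (p q : {poly R}) : f * ((dotp n (te2 F))^-1%:P * (2^-1%:P * p - c%:P * q)) =
    ((dotp n (te2 F))^-1 * 2^-1)%:P * (f * p) - ((dotp n (te2 F))^-1 * c)%:P * (f * q).
  by rewrite !polyCM; ring.
rewrite E I1B !I1Z; move: (I1 _) (I1 _) (dotp _ _) a0 => p q a a0.
by field.
Qed.

Lemma green_shear (R : realType) k (u : tfield R) g (V : bpoly R) : one_edge k u 0 g ->
  I2 (divdiv_ref u * V) = pairing u V - 2^-1 * I1 (g * tr1 V).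
Proof.
move=> /(green_edge V); have -> (p : {poly R}) : I1 (0 * p) = 0 by rewrite mul0r I1_0.
move: (I2 _) (pairing u V) (I1 (g * _)) => a b c; rewrite sub0r -(mulr_natr a) -(mulr_natr b) => e.
apply: (mulIf (_ : (2 : R) != 0)); first by rewrite pnatr_eq0.
by rewrite e; field.
Qed.

Definition frame_size (R : realType) (F : frame R) : R :=
  dotp (te1 F) (te1 F) + dotp (te2 F) (te2 F) + dotp (te3 F) (te3 F).

(** Cauchy-Schwarz in each entry; the squared entries of the dyads add up to the sum of (t_j .
    t_j)^2, at most [frame_size F ^+ 2]. *)
Lemma mfield_sqr (R : realType) (F : frame R) (u : tfield R) x :
  plift F (field11 F u) x ^+ 2 + plift F (field12 F u) x ^+ 2 *+ 2 + plift F (field22 F u) x ^+ 2 <=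
  frame_size F ^+ 2 * plift F (tf1 u * tf1 u + tf2 u * tf2 u + tf3 u * tf3 u) x.
Proof.
rewrite /plift /field11 /field12 /field22 /frame_size /dotp; move: (bary F x) => z.
rewrite !(evE z); move: (ev (tf1 u) z) (ev (tf2 u) z) (ev (tf3 u) z) => u1 u2 u3.
move: (te1 F) (te2 F) (te3 F) => [a1 a2] [b1 b2] [c1 c2] /=.
have cs (x1 x2 x3 : R) :
    (x1 * u1 + x2 * u2 + x3 * u3) ^+ 2 <= (x1 ^+ 2 + x2 ^+ 2 + x3 ^+ 2) * (u1 * u1 + u2 * u2 + u3 * u3).
  rewrite -subr_ge0.
  rewrite (_ : _ - _ = (x1 * u2 - x2 * u1) ^+ 2 + (x1 * u3 - x3 * u1) ^+ 2 + (x2 * u3 - x3 * u2) ^+ 2);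
    last by ring.
  by rewrite !addr_ge0 ?sqr_ge0.
have := cs (a1 ^+ 2) (b1 ^+ 2) (c1 ^+ 2); have := cs (a1 * a2) (b1 * b2) (c1 * c2).
have := cs (a2 ^+ 2) (b2 ^+ 2) (c2 ^+ 2).
set U := u1 * u1 + u2 * u2 + u3 * u3; have U0 : 0 <= U by rewrite !addr_ge0 // -expr2 sqr_ge0.
clearbody U.
set A := (a1 ^+ 2) ^+ 2 + _ + _; set B := (a1 * a2) ^+ 2 + _ + _; set C := (a2 ^+ 2) ^+ 2 + _ + _.
move=> hC hB hA; set T := (a1 * a1 + a2 * a2 + (b1 * b1 + b2 * b2) + (c1 * c1 + c2 * c2)) ^+ 2.
have K : A + B * 2 + C <= T.
  rewrite -subr_ge0 (_ : _ - _ = 2 * ((a1 * a1 + a2 * a2) * (b1 * b1 + b2 * b2) +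
    (a1 * a1 + a2 * a2) * (c1 * c1 + c2 * c2) + (b1 * b1 + b2 * b2) * (c1 * c1 + c2 * c2))).
    by rewrite mulr_ge0 // !addr_ge0 // mulr_ge0 // addr_ge0 // -expr2 sqr_ge0.
  by rewrite /A /B /C /T; ring.
have L : A * U + B * U * 2 + C * U <= T * U.
  by rewrite mulrAC -!mulrDl ler_wpM2r.
clearbody A B C T; apply: le_trans L; move: hA hB hC.
move: (A * U) (B * U) (C * U) => X Y Z; lra.
Qed.

(** * Edges of a triangulation *)

(* The frame of K whose second and third points are the endpoints of e, in the order
   of [endpoints]; it is meaningful only when e is an edge of K. *)
Definition tri_frame (R : realType) (Omega : set (R * R)) (T : triangulation Omega)
    (e K : {set 'I_(nvert T)}) : frame R :=
  Frame ([seq vert i | i <- enum (K :\: e)]`_0) (endpoints e).1 (endpoints e).2.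

Lemma sum_set3 (V : nmodType) (I : finType) (d i j : I) (G : I -> V) : uniq [:: d; i; j] ->
  \sum_(m in [set d; i; j]%SET) G m = G d + G i + G j.
Proof.
rewrite /= !inE !andbT negb_or => /andP[/andP[di dj] ij].
rewrite (bigD1 d) ?inE ?eqxx //= (bigD1 i) ?inE ?eqxx ?orbT //= 1?eq_sym ?di //.
rewrite (bigD1 j) ?inE ?eqxx ?orbT //= 1?eq_sym ?dj 1?eq_sym ?ij //.
rewrite big1 ?addr0 ?addrA // => m; rewrite !inE; case: (m =P d) => //= _.
by case: (m =P i) => //= _; case: (m =P j).
Qed.

Lemma tri_frameP (R : realType) (Omega : set (R * R)) (T : triangulation Omega)
    (e K : {set 'I_(nvert T)}) : K \in cells T -> e \subset K -> #|e| = 2%N ->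
  exists d i j, [/\ uniq [:: d; i; j], e = [set i; j]%SET, K = [set d; i; j]%SET,
    endpoints e = (vert i, vert j) & tri_frame e K = Frame (vert d) (vert i) (vert j)].
Proof.
move=> KT eK e2; have K3 := card_cell KT.
have Ke1 : #|K :\: e| = 1%N by rewrite cardsD (finset.setIidPr eK) K3 e2.
have [i [j es]] : exists i j, enum e = [:: i; j].
  by move: e2; rewrite cardE; case: (enum e) => [|i [|j [|]]] // _; exists i, j.
have [d ds] : exists d, enum (K :\: e) = [:: d].
  by move: Ke1; rewrite cardE; case: (enum _) => [|d [|]] // _; exists d.
have eE : e = [set i; j]%SET.
  by apply/setP => m; rewrite -mem_enum es !inE.
have dE m : (m \in K :\: e) = (m == d) by rewrite -mem_enum ds !inE.
have ij : i != j by have := enum_uniq e; rewrite es /= inE andbT.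
have : d \in K :\: e by rewrite dE.
rewrite !inE {1}eE !inE negb_or => /andP[/andP[di dj] dK].
exists d, i, j; split=> //.
- by rewrite /= !inE negb_or di dj ij.
- apply/setP => m; have := dE m; have := fintype.subsetP eK m.
  rewrite {1 2}eE !inE; case: (m =P i) => [_ ->//|_]; first by rewrite orbT.
  case: (m =P j) => [_ ->//|_]; first by rewrite !orbT.
  by move=> _ /=; rewrite !orbF => <-.
- by rewrite /endpoints es.
by rewrite /tri_frame ds /endpoints es.
Qed.

Lemma affine_free_fdet (R : realType) (n : nat) (p : 'I_n -> R * R) d i j :
  uniq [:: d; i; j] -> affine_free p [set d; i; j]%SET -> fdet (Frame (p d) (p i) (p j)) != 0.
Proof.
move=> u af; move: (u); rewrite /= !inE !andbT negb_or => /andP[/andP[di dj] ij].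
have key (a b c : R) : a + b + c = 0 -> a *: p d + b *: p i + c *: p j = 0 ->
    [/\ a = 0, b = 0 & c = 0].
  move=> s0 v0; pose w m := if m == d then a else if m == i then b else c.
  have wd : w d = a by rewrite /w eqxx.
  have wi : w i = b by rewrite /w eq_sym (negPf di) eqxx.
  have wj : w j = c by rewrite /w eq_sym (negPf dj) eq_sym (negPf ij).
  have H := af w; rewrite !sum_set3 // wd wi wj in H.
  by have {}H := H s0 v0; split; rewrite -?wd -?wi -?wj; apply: H; rewrite !inE eqxx ?orbT.
apply/eqP; rewrite /fdet /det2 /te2 /te3 /=; move: key.
move: (p d) (p i) (p j) => [d1 d2] [i1 i2] [j1 j2] /= key D0.
(* If the determinant is zero, the coordinates of the edge vectors are themselves coefficients of
   affine relations. Freeness makes these vectors vanish, and then p d - p i = 0 is a nontrivial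
   relation. *)
have [||_ x1 x2] := key ((i1 - d1) + (d1 - j1)) (- (d1 - j1)) (- (i1 - d1)).
- by ring.
- apply: injective_projections; rewrite /= /GRing.scale /=; first by ring.
  by rewrite -[RHS]oppr0 -D0; ring.
have [||_ y1 y2] := key ((i2 - d2) + (d2 - j2)) (- (d2 - j2)) (- (i2 - d2)).
- by ring.
- apply: injective_projections; rewrite /= /GRing.scale /=; last by ring.
  by rewrite -D0; ring.
have [||/eqP] := key 1 (- 1) 0; first by ring.
  apply: injective_projections; rewrite /= /GRing.scale /=; lra.
by rewrite oner_eq0.
Qed.

Lemma hull_reft (R : realType) (n : nat) (p : 'I_n -> R * R) d i j :
  uniq [:: d; i; j] -> let F := Frame (p d) (p i) (p j) in fdet F != 0 ->
  hull p [set d; i; j]%SET = bary F @^-1` @reft R.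
Proof.
move=> u F F0; move: (u); rewrite /= !inE !andbT negb_or => /andP[/andP[di dj] ij].
apply/seteqP; split => x /=.
  move=> [w [w0]]; rewrite !sum_set3 // => s1 ->.
  have -> : w d *: p d + w i *: p i + w j *: p j = unbary F (w i, w j).
    rewrite /unbary /te2 /te3 /F /= (_ : w d = 1 - w i - w j); last by rewrite -s1; ring.
    by apply: injective_projections; rewrite /= /GRing.scale /=; ring.
  by rewrite unbaryK // /reft /=; split; rewrite ?w0 //; have := w0 d; lra.
rewrite -{2}(baryK F0 x); move: (bary F x) => [a b]; rewrite /reft /= => -[a0 b0 ab].
exists (fun m => if m == d then 1 - a - b else if m == i then a else b); split.
- by move=> m; case: ifP => _; [lra|case: ifP].
- by rewrite sum_set3 // eqxx (eq_sym i) (negPf di) eqxx (eq_sym j) (negPf dj) (eq_sym j) (negPf ij); ring.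
rewrite sum_set3 // eqxx (eq_sym i) (negPf di) eqxx (eq_sym j) (negPf dj) (eq_sym j) (negPf ij).
rewrite /unbary /te2 /te3 /F /=.
by apply: injective_projections; rewrite /= /GRing.scale /=; ring.
Qed.

Lemma bary_unbary (R : realType) (F : frame R) x a b : fdet F != 0 ->
  x = unbary F (a, b) -> bary F x = (a, b).
Proof. by move=> F0 ->; rewrite unbaryK. Qed.

Lemma enorm1 (R : realType) (x : R * R) : enorm x = 1 -> dotp x x = 1.
Proof.
move=> x1; have x0 : 0 <= dotp x x by rewrite addr_ge0 // -expr2 sqr_ge0.
by rewrite -(sqr_sqrtr x0) -/(enorm x) x1 expr1n.
Qed.

Lemma dotp_ge0 (R : realType) (x : R * R) : 0 <= dotp x x.
Proof. by rewrite addr_ge0 // -expr2 sqr_ge0. Qed.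

Section cell_frame.
Context (R : realType) (Omega : set (R * R)) (T : triangulation Omega).
Context (e K : {set 'I_(nvert T)}) (KT : K \in cells T) (eK : e \subset K) (e2 : #|e| = 2%N).
Let F := tri_frame e K.
Let n := edge_normal e.

Lemma tri_frame_fdet : fdet F != 0.
Proof.
have [d [i [j [u eE KE _ FE]]]] := tri_frameP KT eK e2.
by rewrite /F FE; apply: affine_free_fdet => //; rewrite -KE; exact: cell_nondegenerate.
Qed.

Lemma cell_reft : cell K = bary F @^-1` @reft R.
Proof.
have F0 := tri_frame_fdet; have [d [i [j [u eE KE _ FE]]]] := tri_frameP KT eK e2.
by rewrite /cell {1}KE /F FE; apply: hull_reft => //; rewrite -FE.
Qed.

Lemma cell_int_plift P : cell_int K (plift F P) = `|fdet F| * I2 P.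
Proof. by rewrite /cell_int cell_reft; exact: (lift_int P tri_frame_fdet).2. Qed.

Lemma edge_normal_dotp : dotp n n = 1.
Proof. by apply: enorm1; exact: (edge_normal_unit KT eK e2). Qed.

Lemma edge_normal_te1 : dotp n (te1 F) = 0.
Proof.
have [d [i [j [u eE KE _ FE]]]] := tri_frameP KT eK e2.
rewrite /te1 /F FE /=; apply: (edge_normal_orth KT eK e2); rewrite eE !inE eqxx ?orbT //.
Qed.

Lemma edge_lengthE : edge_length e = enorm (te1 F).
Proof. by []. Qed.

Lemma height_neq0 : dotp n (te2 F) != 0.
Proof.
have [s0 dE _] := te_cycle F.
by have [] := edge_numbers edge_normal_dotp s0 (ltac:(by rewrite -dE; exact: tri_frame_fdet)) edge_normal_te1.
Qed.

Lemma edge_length_height : 0 < edge_length e /\ `|fdet F| = edge_length e * `|dotp n (te2 F)|.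
Proof.
have [s0 dE _] := te_cycle F; have F0 := tri_frame_fdet.
have [_ e1 m0 _ tE] := edge_numbers edge_normal_dotp s0 (ltac:(by rewrite -dE)) edge_normal_te1.
have h : edge_length e = `|dotp (rot90 n) (te1 F)|.
  rewrite edge_lengthE /enorm -sqrtr_sqr; congr Num.sqrt.
  have L v : dotp n n * dotp v v = dotp n v ^+ 2 + dotp (rot90 n) v ^+ 2.
    by rewrite /dotp /rot90 /=; ring.
  by rewrite -[LHS]mul1r -edge_normal_dotp L edge_normal_te1 expr0n add0r.
by rewrite dE e1 normrN normrM h normr_gt0.
Qed.

Lemma bary_edge t : bary F ((endpoints e).1 + t *: ((endpoints e).2 - (endpoints e).1)) = (1 - t, t).
Proof.
have F0 := tri_frame_fdet; apply: bary_unbary => //; rewrite /unbary /te2 /te3 /F /=.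
by apply: injective_projections; rewrite /= /GRing.scale /=; ring.
Qed.

End cell_frame.

Lemma edge_intE (R : realType) (Omega : set (R * R)) (T : triangulation Omega)
    (e : {set 'I_(nvert T)}) f (q : {poly R}) :
  (forall t, f ((endpoints e).1 + t *: ((endpoints e).2 - (endpoints e).1)) = q.[t]) ->
  edge_int e f = edge_length e * I1 q.
Proof.
move=> fE; rewrite /edge_int [endpoints e]surjective_pairing /=; congr (_ * _).
by rewrite -Rintegral01; apply: eq_Rintegral => t _; rewrite fE.
Qed.

(** In the frame of another edge e' of K, the edge e is the second or the third one, where the
    contribution of e' has no traces. The parameter s accounts for a possibly reversed
    orientation. *)
Lemma other_edge (R : realType) (Omega : set (R * R)) (T : triangulation Omega)
    (e e' K : {set 'I_(nvert T)}) t :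
  K \in cells T -> e \subset K -> #|e| = 2%N -> e' \subset K -> #|e'| = 2%N -> e != e' ->
  let x := (endpoints e).1 + t *: ((endpoints e).2 - (endpoints e).1) in
  let F' := tri_frame e' K in
  exists s, (dotp (edge_normal e) (te2 F') = 0 /\ bary F' x = (0, 1 - s)) \/
            (dotp (edge_normal e) (te3 F') = 0 /\ bary F' x = (s, 0)).
Proof.
move=> KT eK e2 eK' e2' ee x F'.
have F0 : fdet F' != 0 by exact: tri_frame_fdet.
have orth a b : a \in e -> b \in e -> dotp (edge_normal e) (vert b - vert a) = 0.
  by move=> ae be; exact: (edge_normal_orth KT eK e2).
have [d [i [j [u eE _ epE _]]]] := tri_frameP KT eK e2.
have [d' [i' [j' [u' eE' KE' _ FE']]]] := tri_frameP KT eK' e2'.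
have ie : i \in e by rewrite eE !inE eqxx.
have je : j \in e by rewrite eE !inE eqxx orbT.
have ij : i != j by move: u; rewrite /= !inE negb_or => /and3P[/andP[]].
have := fintype.subsetP eK i ie; have := fintype.subsetP eK j je.
move: F0; rewrite /x /F' FE' epE KE' !inE /= => F0.
have nee : ~ (i = i' /\ j = j') /\ ~ (i = j' /\ j = i').
  by split=> -[a b]; move: ee; rewrite eE eE' a b ?eqxx // finset.setUC eqxx.
move=> /orP[/orP[]|] /eqP jj /orP[/orP[]|] /eqP ii.
- by move: ij; rewrite ii jj eqxx.
- exists (1 - t); right; split; first by rewrite /te3 /= -ii -jj; exact: orth.
  apply: bary_unbary => //; rewrite /unbary /te2 /te3 /= ii jj.
  by apply: injective_projections; rewrite /= /GRing.scale /=; ring.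
- exists t; left; split; first by rewrite /te2 /= -ii -jj; exact: orth.
  apply: bary_unbary => //; rewrite /unbary /te2 /te3 /= ii jj.
  by apply: injective_projections; rewrite /= /GRing.scale /=; ring.
- exists t; right; split; first by rewrite /te3 /= -ii -jj; exact: orth.
  apply: bary_unbary => //; rewrite /unbary /te2 /te3 /= ii jj.
  by apply: injective_projections; rewrite /= /GRing.scale /=; ring.
- by move: ij; rewrite ii jj eqxx.
- by case: nee => _ [].
- exists (1 - t); left; split; first by rewrite /te2 /= -ii -jj; exact: orth.
  apply: bary_unbary => //; rewrite /unbary /te2 /te3 /= ii jj.
  by apply: injective_projections; rewrite /= /GRing.scale /=; ring.
- by case: nee => [] [].
by move: ij; rewrite ii jj eqxx.
Qed.

(* Otherwise a point close to the midpoint of e would belong to both triangles, while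
   conformity confines their intersection to e. *)
Lemma opposite_heights (R : realType) (Omega : set (R * R)) (T : triangulation Omega)
    (e K K' : {set 'I_(nvert T)}) :
  K \in cells T -> K' \in cells T -> e \subset K -> e \subset K' -> #|e| = 2%N -> K != K' ->
  dotp (edge_normal e) (te2 (tri_frame e K)) * dotp (edge_normal e) (te2 (tri_frame e K')) < 0.
Proof.
move=> KT KT' eK eK' e2 KK; set n := edge_normal e; set F := tri_frame e K; set F' := tri_frame e K'.
have a0 : dotp n (te2 F) != 0 by exact: height_neq0.
have a0' : dotp n (te2 F') != 0 by exact: height_neq0.
rewrite ltNge; apply/negP => pos.
have F0 : fdet F != 0 by exact: tri_frame_fdet.
have F0' : fdet F' != 0 by exact: tri_frame_fdet.
have [a [b cE]] : exists a b, fp1 F = unbary F' (a, b).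
  by exists (bary F' (fp1 F)).1, (bary F' (fp1 F)).2; rewrite -surjective_pairing baryK.
have p23 : fp2 F' = fp2 F /\ fp3 F' = fp3 F by [].
have n1 : dotp n (te1 F') = 0 by exact: edge_normal_te1.
have hE : dotp n (te2 F) = (1 - a - b) * dotp n (te2 F').
  have -> : te2 F = (1 - a - b) *: te2 F' - a *: te1 F'.
    rewrite /te2 cE /unbary /te1 /te2 /te3 (_ : fp3 F = fp3 F') //.
    by apply: injective_projections; rewrite /= /GRing.scale /=; ring.
  by move: n1; rewrite /dotp /= /GRing.scale /= => n1; rewrite -[RHS](subr0) -(mulr0 a) -n1; ring.
have c0 : 0 < 1 - a - b.
  rewrite lt_neqAle eq_sym; apply/andP; split; first by apply: contra_neq a0 => c0; rewrite hE c0 mul0r.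
  move: pos; rewrite hE -mulrA pmulr_lge0 // lt_neqAle eq_sym -expr2 sqr_ge0 andbT.
  by rewrite sqrf_eq0.
(* Chosen so that (1 - t) / 2 = t |a| + t |b|, which keeps the barycentric coordinates of x in the
   second triangle nonnegative. *)
pose t := (1 + `|a| *+ 2 + `|b| *+ 2)^-1.
have q0 : 0 < 1 + `|a| *+ 2 + `|b| *+ 2.
  by have := normr_ge0 a; have := normr_ge0 b; lra.
have t0 : 0 < t by rewrite invr_gt0.
have t1 : t * (1 + `|a| *+ 2 + `|b| *+ 2) = 1 by rewrite mulVf // gt_eqF.
have ta : - t * `|a| <= t * a by rewrite mulNr lerNl -mulrN ler_pM2l // ler_normr lexx orbT.
have tb : - t * `|b| <= t * b by rewrite mulNr lerNl -mulrN ler_pM2l // ler_normr lexx orbT.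
have ta0 : 0 <= t * `|a| by rewrite mulr_ge0 // ltW.
have tb0 : 0 <= t * `|b| by rewrite mulr_ge0 // ltW.
clearbody t; have tE : t + t * `|a| *+ 2 + t * `|b| *+ 2 = 1 by rewrite -t1; ring.
pose x := unbary F ((1 - t) / 2, (1 - t) / 2).
have xF : bary F x = ((1 - t) / 2, (1 - t) / 2) by exact: bary_unbary.
have xF' : bary F' x = ((1 - t) / 2 + t * a, (1 - t) / 2 + t * b).
  apply: bary_unbary => //; rewrite /x /unbary /te2 /te3 cE /unbary /te2 /te3.
  rewrite (_ : fp2 F = fp2 F') // (_ : fp3 F = fp3 F') //.
  by apply: injective_projections; rewrite /= /GRing.scale /=; field.
have xK : cell K x.
  by rewrite (cell_reft KT eK e2) -/F /= xF /reft /=; split; lra.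
have xK' : cell K' x.
  rewrite (cell_reft KT' eK' e2) -/F' /= xF' /reft /=.
  have : t * (1 - a - b) > 0 by rewrite mulr_gt0.
  by rewrite !mulrBr mulr1 => tc; split; lra.
have : hull (@vert _ _ T) (K :&: K') x by rewrite -(cells_conforming KT KT').
have -> : (K :&: K')%SET = e.
  apply/eqP; rewrite eq_sym eqEcard finset.subsetI eK eK' e2 /=.
  rewrite -ltnS -(card_cell KT); apply: proper_card; rewrite finset.properEneq finset.subsetIl andbT.
  apply: contra KK => /eqP/finset.setIidPl KsK.
  by rewrite eqEcard KsK (card_cell KT) (card_cell KT').
move=> [w [_]]; have [d [i [j [u eE KE epE FE]]]] := tri_frameP KT eK e2.
have ij : i != j by move: u; rewrite /= !inE negb_or => /and3P[].
rewrite eE !finset.big_setU1 ?inE // !big_set1 => w1 xE.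
have {}w1 : w i + w j = 1 := w1; have {}xE : x = w i *: vert i + w j *: vert j := xE.
have : dotp n (x - fp3 F) = t * dotp n (te2 F).
  rewrite /x /unbary; have := edge_normal_te1 KT eK e2; rewrite -/F -/n => n1'.
  rewrite -[RHS]addr0 -(mulr0 (- ((1 - t) / 2))) -n1' /dotp /te1 /te2 /te3 /= /GRing.scale /=.
  by field.
have -> : dotp n (x - fp3 F) = 0.
  have := edge_normal_te1 KT eK e2; rewrite -/F -/n xE /F FE /te1 /= => n1'.
  rewrite -(mulr0 (- w i)) -n1' (_ : w j = 1 - w i); last by rewrite -w1; ring.
  by rewrite /dotp /= /GRing.scale /=; ring.
by move/esym/eqP; rewrite mulf_eq0 (negPf a0) gt_eqF.
Qed.

Definition side (R : realType) (Omega : set (R * R)) (T : triangulation Omega)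
    (e K : {set 'I_(nvert T)}) : R :=
  Num.sg (dotp (edge_normal e) (te2 (tri_frame e K))).

Lemma side_sqr (R : realType) (Omega : set (R * R)) (T : triangulation Omega)
    (e K : {set 'I_(nvert T)}) : K \in cells T -> e \subset K -> #|e| = 2%N ->
  side e K ^+ 2 = 1.
Proof. by move=> KT eK e2; rewrite /side sqr_sg (height_neq0 KT eK e2). Qed.

Lemma side_opp (R : realType) (Omega : set (R * R)) (T : triangulation Omega)
    (e K K' : {set 'I_(nvert T)}) :
  K \in cells T -> K' \in cells T -> e \subset K -> e \subset K' -> #|e| = 2%N -> K != K' ->
  side e K' = - side e K.
Proof.
move=> KT KT' eK eK' e2 KK; have := opposite_heights KT KT' eK eK' e2 KK.
rewrite /side; set a := dotp _ _; set b := dotp _ _ => ab.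
by case: (sgrP a) ab => [->|a0|a0]; rewrite ?mul0r ?ltxx // ?(nmulr_rlt0 _ a0) ?(pmulr_rlt0 _ a0)
  => b0; rewrite ?opprK ?(gtr0_sg b0) ?(ltr0_sg b0).
Qed.

(** Two cells at e lie on opposite sides, so the signed sum is the jump up to sign. Three cells
    would have pairwise opposite nonzero signs, which is impossible. *)
Lemma jump_sqr (R : realType) (Omega : set (R * R)) (T : triangulation Omega)
    (v : broken T R) (e : {set 'I_(nvert T)}) x : e \in edges T ->
  jump v e x ^+ 2 = (\sum_(K in cells T | e \subset K) side e K * v K x) ^+ 2.
Proof.
rewrite inE => /andP[/eqP e2 _].
have SE K : (K \in [set K in cells T | e \subset K]%SET) = (K \in cells T) && (e \subset K).
  by rewrite inE.
rewrite (eq_bigl _ _ (fun K => esym (SE K))) -big_enum /jump /=.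
have : {subset enum [set K in cells T | e \subset K]%SET <= [pred K | (K \in cells T) && (e \subset K)]}.
  by move=> K; rewrite mem_enum SE.
have := enum_uniq (mem [set K in cells T | e \subset K]%SET).
case: (enum _) => [|K [|K' [|K'' s]]]; first by rewrite big_nil.
- move=> _ /(_ K (mem_head _ _)) /andP[KT eK].
  by rewrite big_seq1 exprMn side_sqr // mul1r.
- rewrite /= inE andbT => KK H.
  have /andP[KT eK] := H K (mem_head _ _).
  have /andP[KT' eK'] : (K' \in cells T) && (e \subset K') by apply: H; rewrite !inE eqxx orbT.
  rewrite big_cons big_seq1 (side_opp KT KT') // mulNr -mulrBr exprMn side_sqr //.
  by rewrite mul1r.
rewrite /= !inE !negb_or => /and3P[/and3P[k1 k2 _] /andP[k3 _] _] H.
have /andP[KT eK] := H K (mem_head _ _).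
have /andP[KT' eK'] : (K' \in cells T) && (e \subset K') by apply: H; rewrite !inE eqxx orbT.
have /andP[KT'' eK''] : (K'' \in cells T) && (e \subset K'') by apply: H; rewrite !inE eqxx !orbT.
have := side_opp KT' KT'' eK' eK'' e2 k3; rewrite (side_opp KT KT'') // (side_opp KT KT') // opprK => h.
have : side e K = 0 by lra.
by move=> s0; have := side_sqr KT eK e2; rewrite s0 expr0n /= => /eqP; rewrite eq_sym oner_eq0.
Qed.

(** * Shape regularity in terms of edges and determinant *)

Lemma enorm_sqr (R : realType) (x : R * R) : enorm x ^+ 2 = dotp x x.
Proof. by rewrite /enorm sqr_sqrtr // dotp_ge0. Qed.

Lemma enorm_ge0 (R : realType) (x : R * R) : 0 <= enorm x.
Proof. exact: sqrtr_ge0. Qed.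

(** An affine function with gradient g varies by d |g| over a disc of diameter d, but by at most 1
    on A. A degenerate disc shows that the set of diameters is nonempty, so [sup] has its usual
    meaning. *)
Lemma indiam_le (R : realType) (F : frame R) (g : R * R) (c : R) A : fdet F != 0 ->
  A = bary F @^-1` @reft R -> 0 < dotp g g ->
  (forall x, A x -> 0 <= dotp g x + c <= 1) -> A !=set0 ->
  indiam A <= (enorm g)^-1 /\ 0 <= indiam A.
Proof.
move=> F0 AE g0 gA [x0 x0A].
have e0 : 0 < enorm g by rewrite sqrtr_gt0.
have zero : [set d | exists c r, [/\ 0 <= r, [set x | enorm (x - c) <= r] `<=` A & d = 2 * r]] 0.
  exists x0, 0; split=> //; last by rewrite mulr0.
  move=> x /= xx0; suff -> : x = x0 by [].
  have : dotp (x - x0) (x - x0) = 0.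
    by rewrite -enorm_sqr (_ : enorm _ = 0) ?expr0n //; apply/eqP; rewrite eq_le xx0 enorm_ge0.
  rewrite /dotp => /eqP; rewrite paddr_eq0 -?expr2 ?sqr_ge0 // !sqrf_eq0 => /andP[/eqP a /eqP b].
  by apply/eqP; rewrite -subr_eq0; apply/eqP; exact: injective_projections.
have ub : ubound [set d | exists c r, [/\ 0 <= r, [set x | enorm (x - c) <= r] `<=` A & d = 2 * r]] (enorm g)^-1.
  move=> _ [y [r [r0 yA ->]]].
  have mem s : `|s| = 1 -> A (y + (s * (r / enorm g)) *: g).
    move=> s1; apply: yA => /=; rewrite addrC addKr /enorm.
    have -> : dotp ((s * (r / enorm g)) *: g) ((s * (r / enorm g)) *: g) = r ^+ 2 * s ^+ 2.
      rewrite (_ : dotp _ _ = (s * (r / enorm g)) ^+ 2 * dotp g g); last first.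
        by rewrite /dotp /= /GRing.scale /=; ring.
      rewrite -enorm_sqr; field; exact: lt0r_neq0.
    by rewrite -[s ^+ 2]real_normK ?num_real // s1 expr1n mulr1 sqrtr_sqr ger0_norm.
  have E s : dotp g (y + (s * (r / enorm g)) *: g) = dotp g y + s * (r * enorm g).
    rewrite (_ : dotp g _ = dotp g y + s * (r / enorm g) * dotp g g); last first.
      by rewrite /dotp /= /GRing.scale /=; ring.
    rewrite -enorm_sqr; field; exact: lt0r_neq0.
  have := gA _ (mem 1 (normr1 _)); have := gA _ (mem (-1) (normrN1 _)).
  rewrite !E => /andP[h _] /andP[_ h']; rewrite -(ler_pM2r e0) mulVf ?gt_eqF //.
  by rewrite -mulrA; lra.
split; first by apply: ge_sup => //; exists 0.
by apply: ub_le_sup => //; exists (enorm g)^-1.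
Qed.

(** What has to be checked is that the distances are bounded, so that [sup] is an upper bound; the
    differences of barycentric coordinates are at most 1. *)
Lemma diam_ge (R : realType) (F : frame R) A x y : fdet F != 0 ->
  A = bary F @^-1` @reft R -> A x -> A y -> enorm (x - y) <= diam A.
Proof.
move=> F0 AE xA yA; apply: ub_le_sup; last by exists x, y.
exists (Num.sqrt (2 * (dotp (te2 F) (te2 F) + dotp (te3 F) (te3 F)))) => _ [a [b [aA bA ->]]].
rewrite /enorm ler_sqrt; last by rewrite mulr_ge0 // addr_ge0 // dotp_ge0.
have -> : a - b = ((bary F a).1 - (bary F b).1) *: te3 F - ((bary F a).2 - (bary F b).2) *: te2 F.
  rewrite -{1}(baryK F0 a) -{1}(baryK F0 b) /unbary.
  by apply: injective_projections; rewrite /= /GRing.scale /=; ring.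
have : reft (bary F a) by move: aA; rewrite AE.
have : reft (bary F b) by move: bA; rewrite AE.
move: (bary F b) (bary F a) => [b1 b2] [a1 a2] [/= b10 b20 b3] [/= a10 a20 a3].
have p : (a1 - b1) ^+ 2 <= 1 by nra.
have q : (a2 - b2) ^+ 2 <= 1 by nra.
move: (te2 F) (te3 F) (a1 - b1) (a2 - b2) p q => t s c d p q.
have : 0 <= dotp (d *: t + c *: s) (d *: t + c *: s) by exact: dotp_ge0.
have : (1 - c ^+ 2) * dotp s s >= 0 by rewrite mulr_ge0 ?dotp_ge0 // subr_ge0.
have : (1 - d ^+ 2) * dotp t t >= 0 by rewrite mulr_ge0 ?dotp_ge0 // subr_ge0.
rewrite /dotp /= /GRing.scale /=; lra.
Qed.

(** The gradient of a barycentric coordinate has length |t| / |det|, with t the opposite edge, so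
    [indiam_le] gives |t| <= diam <= |sigma| |det| / |t|. This is used for two edges; the third is
    bounded by them, hence 6 |sigma|. The summand 1 makes the constant positive. *)
Lemma shape_regular_frame (R : realType) (Omega : set (R * R)) (I : Type)
    (Th : I -> triangulation Omega) : shape_regular Th ->
  exists2 C : R, 0 < C & forall i (e K : {set 'I_(nvert (Th i))}),
    K \in cells (Th i) -> e \subset K -> #|e| = 2%N ->
    frame_size (tri_frame e K) <= C * `|fdet (tri_frame e K)|.
Proof.
move=> [sigma H]; exists (6 * `|sigma| + 1); first by have := normr_ge0 sigma; lra.
move=> i e K KT eK e2; have F0 := tri_frame_fdet KT eK e2; have AE := cell_reft KT eK e2.
have HK := H _ _ KT; move: F0 AE; set F := tri_frame e K; set A := cell K in HK *; move=> F0 AE.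
have v1 : A (fp1 F).
  rewrite AE /= (bary_unbary (a := 0) (b := 0)) //; first by split; rewrite /= ?addr0.
  by rewrite /unbary /= !scale0r addr0 subr0.
have v2 : A (fp2 F).
  rewrite AE /= (bary_unbary (a := 1) (b := 0)) //; first by split; rewrite /= ?addr0.
  by rewrite /unbary /= scale0r scale1r subr0 /te3 addrC subrK.
have v3 : A (fp3 F).
  rewrite AE /= (bary_unbary (a := 0) (b := 1)) //; first by split; rewrite /= ?add0r.
  by rewrite /unbary /= scale0r scale1r addr0 /te2 opprB addrC subrK.
have D0 : 0 < `|fdet F| by rewrite normr_gt0.
have core g te : dotp g g = dotp te te / fdet F ^+ 2 -> 0 < dotp te te ->
    enorm te <= diam A -> (exists c, forall x, A x -> 0 <= dotp g x + c <= 1) ->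
    dotp te te <= `|sigma| * `|fdet F|.
  move=> gE te0 ted [c gA].
  have g0 : 0 < dotp g g by rewrite gE divr_gt0 // exprn_even_gt0.
  have [i1 i0] := indiam_le F0 AE g0 gA (ex_intro _ _ v1).
  have eg : enorm g = enorm te / `|fdet F|.
    rewrite /enorm gE sqrtrM ?dotp_ge0 // sqrtrV ?sqr_ge0 // sqrtr_sqr //.
  have et0 : 0 < enorm te by rewrite sqrtr_gt0.
  rewrite -enorm_sqr expr2.
  have h : enorm te <= `|sigma| * (`|fdet F| / enorm te).
    apply: (le_trans ted); apply: (le_trans HK).
    apply: (@le_trans _ _ (`|sigma| * indiam A)).
      by apply: ler_wpM2r => //; exact: ler_norm.
    by apply: ler_wpM2l => //; rewrite (le_trans i1) // eg invf_div.
  have := ler_wpM2r (ltW et0) h; rewrite -mulrA divfK //; exact: lt0r_neq0.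
have sqn0 (v : R * R) : v != 0 -> 0 < dotp v v.
  move=> v0; rewrite lt_neqAle dotp_ge0 andbT eq_sym; apply: contra v0.
  rewrite /dotp paddr_eq0 -?expr2 ?sqr_ge0 // !sqrf_eq0 => /andP[/eqP a /eqP b].
  by apply/eqP; exact: injective_projections.
have t2 : te2 F != 0 by apply: contra_neq F0 => z; rewrite /fdet /det2 z /= !mul0r subrr.
have t3 : te3 F != 0 by apply: contra_neq F0 => z; rewrite /fdet /det2 z /= !mulr0 subrr.
have b2 : dotp (te2 F) (te2 F) <= `|sigma| * `|fdet F|.
  apply: (core (grad2 F)); [|exact: sqn0|exact: (diam_ge F0 AE)|].
    by rewrite /dotp /grad2 /=; field.
  exists (- dotp (grad2 F) (fp1 F)) => x; rewrite AE /= => -[].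
  rewrite /bary /= => h1 h2 h3.
  have -> : dotp (grad2 F) x - dotp (grad2 F) (fp1 F) = dotp (grad2 F) (x - fp1 F).
    by rewrite /dotp /=; ring.
  lra.
have b3 : dotp (te3 F) (te3 F) <= `|sigma| * `|fdet F|.
  apply: (core (grad3 F)); [|exact: sqn0|exact: (diam_ge F0 AE)|].
    by rewrite /dotp /grad3 /=; field.
  exists (- dotp (grad3 F) (fp1 F)) => x; rewrite AE /= => -[].
  rewrite /bary /= => h1 h2 h3.
  have -> : dotp (grad3 F) x - dotp (grad3 F) (fp1 F) = dotp (grad3 F) (x - fp1 F).
    by rewrite /dotp /=; ring.
  lra.
have : dotp (te1 F) (te1 F) <= 2 * dotp (te2 F) (te2 F) + 2 * dotp (te3 F) (te3 F).
  have := dotp_ge0 (te2 F - te3 F).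
  have -> : te1 F = - te2 F - te3 F by rewrite /te1 /te2 /te3; apply: injective_projections; rewrite /=; ring.
  by rewrite /dotp /=; lra.
rewrite /frame_size (_ : (6 * `|sigma| + 1) * `|fdet F| = 6 * (`|sigma| * `|fdet F|) + `|fdet F|).
  by move: b2 b3 D0; move: (`|sigma| * _) (dotp (te1 F) _) => *; lra.
by ring.
Qed.

(** * Assembled test fields and the inf-sup condition *)

Lemma D_sum (R : realType) (I : Type) (r : seq I) (P : pred I) (f : I -> R * R -> R) w x :
  (forall i, P i -> polyf (f i)) ->
  'D_w (fun y => \sum_(i <- r | P i) f i y) x = \sum_(i <- r | P i) 'D_w (f i) x.
Proof.
move=> pf; elim: r => [|i r IH].
  under eq_fun do rewrite big_nil; by rewrite big_nil; exact: derive_cst.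
under eq_fun do rewrite big_cons; rewrite big_cons; case: ifP => // Pi.
have := congr1 (fun h => h x) (DD_polyf w (pf i Pi) (@polyf_sum _ _ r _ f pf)).
by move=> /= ->; rewrite IH.
Qed.

Definition mpolyf (R : realType) (tau : R * R -> 'M[R]_2) : Prop :=
  forall i j, polyf (fun x => tau x i j).

Lemma mpolyf_mfield (R : realType) (F : frame R) u : mpolyf (mfield F u).
Proof.
move=> i j; have E : forall x, mfield F u x i j = if i == j then if i == 0 then plift F (field11 F u) x
    else plift F (field22 F u) x else plift F (field12 F u) x by move=> x; rewrite mxE.
rewrite (funext E); case: (i == j); last exact: polyf_lift.
by case: (i == 0); exact: polyf_lift.
Qed.

Lemma bilinE (R : realType) (a b : R * R) (A : 'M[R]_2) :
  bilin a A b = a.1 * A 0 0 * b.1 + a.1 * A 0 1 * b.2 + a.2 * A 1 0 * b.1 + a.2 * A 1 1 * b.2.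
Proof.
rewrite /bilin -mulmxA colvecM !mxE !big_ord_recl !big_ord0 !mxE /=.
rewrite (_ : lift _ _ = 1); last exact: val_inj.
ring.
Qed.

Section matrix_sum.
Context (R : realType) (I : finType) (P : pred I) (tau : I -> R * R -> 'M[R]_2).
Hypothesis tp : forall e, P e -> mpolyf (tau e).
Let sigma x := \sum_(e | P e) tau e x.

Lemma mpolyf_sum : mpolyf sigma.
Proof.
move=> i j; have E x : sigma x i j = \sum_(e | P e) tau e x i j by rewrite summxE.
by rewrite (funext E); apply: polyf_sum => e /tp.
Qed.

Lemma div_rows_sum x : div_rows sigma x = \sum_(e | P e) div_rows (tau e) x.
Proof.
apply/matrixP => i j; rewrite summxE mxE.
under [RHS]eq_bigr do rewrite mxE; rewrite exchange_big /=; apply: eq_bigr => m _.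
rewrite /pd -D_sum; last by move=> e /tp.
by congr ('D__ _ _); apply/funext => y; rewrite summxE.
Qed.

Lemma polyf_div_rows (s : R * R -> 'M[R]_2) i : mpolyf s -> polyf (fun x => div_rows s x i 0).
Proof.
move=> sp; have E x : div_rows s x i 0 = \sum_(j < 2) pd j (fun y => s y i j) x by rewrite mxE.
by rewrite (funext E); apply: polyf_sum => j _; apply: polyf_D.
Qed.

Lemma divdiv_sum x : divdiv sigma x = \sum_(e | P e) divdiv (tau e) x.
Proof.
rewrite /divdiv exchange_big /=; apply: eq_bigr => i _; rewrite /pd -D_sum; last first.
  by move=> e /tp te; exact: polyf_div_rows.
by congr ('D__ _ _); apply/funext => y; rewrite div_rows_sum summxE.
Qed.

Lemma bilin_sum a b x : bilin a (sigma x) b = \sum_(e | P e) bilin a (tau e x) b.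
Proof. by rewrite /bilin /sigma mulmx_sumr mulmx_suml summxE. Qed.

Lemma tnval_sum n x : tnval n sigma x = \sum_(e | P e) tnval n (tau e) x.
Proof.
rewrite /tnval big_split /=; congr (_ + _); last by rewrite div_rows_sum mulmx_sumr summxE.
rewrite -D_sum; last first.
  move=> e /tp te; have E y : bilin (rot90 n) (tau e y) n = (rot90 n).1 * tau e y 0 0 * n.1 +
     (rot90 n).1 * tau e y 0 1 * n.2 + (rot90 n).2 * tau e y 1 0 * n.1 +
     (rot90 n).2 * tau e y 1 1 * n.2.
    exact: bilinE.
  rewrite (funext E).
  by do 3 (apply: polyfD; last by apply: polyfM (polyfC _); apply: polyfM (polyfC _) _);
    apply: polyfM (polyfC _); apply: polyfM (polyfC _) _.
by congr ('D__ _ _); apply/funext => y; rewrite bilin_sum.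
Qed.

End matrix_sum.

Definition cell_edge (R : realType) (Omega : set (R * R)) (T : triangulation Omega)
    (e K : {set 'I_(nvert T)}) : bool := [&& K \in cells T, e \subset K & #|e| == 2%N].

Definition edge_fields (R : realType) (Omega : set (R * R)) (T : triangulation Omega) :=
  {set 'I_(nvert T)} -> {set 'I_(nvert T)} -> tfield R.

(** One contribution per edge of K, written in the frame where that edge comes first. *)
Definition assembled (R : realType) (Omega : set (R * R)) (T : triangulation Omega)
    (u : edge_fields T) : broken T 'M[R]_2 :=
  fun K x => \sum_(e | cell_edge e K) mfield (tri_frame e K) (u e K) x.

Definition edge_pt (R : realType) (Omega : set (R * R)) (T : triangulation Omega)
    (e : {set 'I_(nvert T)}) (s : R) : R * R :=
  (endpoints e).1 + s *: ((endpoints e).2 - (endpoints e).1).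

Definition height (R : realType) (Omega : set (R * R)) (T : triangulation Omega)
    (e K : {set 'I_(nvert T)}) : R := dotp (edge_normal e) (te2 (tri_frame e K)).

Definition obliquity (R : realType) (Omega : set (R * R)) (T : triangulation Omega)
    (e K : {set 'I_(nvert T)}) : R :=
  tratio (edge_normal e) (te1 (tri_frame e K)) (te2 (tri_frame e K)).

Lemma mform_sum (R : realType) k (x0 : R * R) (I : Type) (r : seq I) (P : pred I)
    (s : I -> R * R -> 'M[R]_2) :
  (forall i, P i -> mform k x0 (s i)) -> mform k x0 (fun x => \sum_(i <- r | P i) s i x).
Proof.
move=> H; elim: r => [|i r IH].
  under eq_fun do rewrite big_nil.
  exists (fun=> 0), (fun=> 0), (fun=> 0), (fun=> 0); split; first by split; exact: Poly_leC.
    exact: Poly_leC.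
  by move=> x; rewrite scale0r addr0; apply: mx2P; rewrite mxE.
case Pi : (P i); under eq_fun do rewrite big_cons Pi; last exact: IH.
exact: mformD (H i Pi) IH.
Qed.

Lemma mfield_vert (R : realType) (F : frame R) u : fdet F != 0 -> tvert0 u ->
  [/\ mfield F u (fp1 F) = 0, mfield F u (fp2 F) = 0 & mfield F u (fp3 F) = 0].
Proof.
move=> F0 [[a1 a2 a3] [b1 b2 b3] [c1 c2 c3]].
have v1 : bary F (fp1 F) = (0, 0).
  by apply: bary_unbary => //; rewrite /unbary /= !scale0r addr0 subr0.
have v2 : bary F (fp2 F) = (1, 0).
  by apply: bary_unbary => //; rewrite /unbary /= scale0r scale1r subr0 /te3 addrC subrK.
have v3 : bary F (fp3 F) = (0, 1).
  by apply: bary_unbary => //; rewrite /unbary /= scale0r scale1r addr0 /te2 opprB addrC subrK.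
have z : (0 : 'M[R]_2) = mx2 0 0 0 by apply: mx2P; rewrite mxE.
rewrite /mfield /plift v1 v2 v3 z /field11 /field12 /field22.
rewrite !(evE (0, 0)) !(evE (1, 0)) !(evE (0, 1)) a1 a2 a3 b1 b2 b3 c1 c2 c3.
by rewrite !mulr0 !addr0.
Qed.

Section assembled_field.
Context (R : realType) (Omega : set (R * R)) (T : triangulation Omega) (k l : nat).
Context (u : edge_fields T) (f g : {set 'I_(nvert T)} -> {set 'I_(nvert T)} -> {poly R}).
Hypothesis k3 : (3 <= k)%N.
Hypothesis kl : (k - 1 <= l)%N.
Hypothesis uP : forall e K, cell_edge e K -> one_edge k (u e K) (f e K) (g e K).

Lemma assembled_trace e K s : cell_edge e K ->
  bilin (edge_normal e) (assembled u K (edge_pt e s)) (edge_normal e) =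
    height e K ^+ 2 * (f e K).[s] /\
  tnval (edge_normal e) (assembled u K) (edge_pt e s) =
    height e K * (2^-1 * (g e K).[s] + obliquity e K * ((f e K)^`()).[s]).
Proof.
move=> eKv; have /and3P[KT eK /eqP e2] := eKv.
have nn := edge_normal_dotp KT eK e2.
have mp e' : cell_edge e' K -> mpolyf (mfield (tri_frame e' K) (u e' K)).
  by move=> _; exact: mpolyf_mfield.
pose F e' x := mfield (tri_frame e' K) (u e' K) x.
have [b1 t1] : bilin (edge_normal e) (F e (edge_pt e s)) (edge_normal e) =
    height e K ^+ 2 * (f e K).[s] /\ tnval (edge_normal e) (F e) (edge_pt e s) =
    height e K * (2^-1 * (g e K).[s] + obliquity e K * ((f e K)^`()).[s]).
  have [H _ _] := one_edge_trace (edge_pt e s) s (tri_frame_fdet KT eK e2) nn (uP eKv).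
  exact: H (edge_normal_te1 KT eK e2) (bary_edge KT eK e2 s).
have other e' : cell_edge e' K && (e' != e) ->
    bilin (edge_normal e) (F e' (edge_pt e s)) (edge_normal e) = 0 /\
    tnval (edge_normal e) (F e') (edge_pt e s) = 0.
  move=> /andP[eKv' ee]; have /and3P[_ eK' /eqP e2'] := eKv'; rewrite eq_sym in ee.
  have [r [[w b]|[w b]]] := other_edge s KT eK e2 eK' e2' ee.
    by have [_ /(_ w b) H _] := one_edge_trace (edge_pt e s) r (tri_frame_fdet KT eK' e2') nn (uP eKv').
  by have [_ _ /(_ w b) H] := one_edge_trace (edge_pt e s) r (tri_frame_fdet KT eK' e2') nn (uP eKv').
rewrite -b1 -t1; split.
  rewrite [LHS](@bilin_sum _ _ (fun e' => cell_edge e' K) F) (bigD1 e) //= big1 ?addr0 //.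
  by move=> e' /other [].
rewrite [LHS](@tnval_sum _ _ (fun e' => cell_edge e' K) F mp) (bigD1 e) //= big1 ?addr0 //.
by move=> e' /other [].
Qed.

Lemma assembled_Sigma :
  (forall e K K' s, cell_edge e K -> cell_edge e K' ->
    height e K ^+ 2 * (f e K).[s] = height e K' ^+ 2 * (f e K').[s] /\
    height e K * (2^-1 * (g e K).[s] + obliquity e K * ((f e K)^`()).[s]) =
    height e K' * (2^-1 * (g e K').[s] + obliquity e K' * ((f e K')^`()).[s])) ->
  Sigma_h l k (assembled u).
Proof.
move=> single; split.
- move=> K KT; apply: mform_Sigma_loc => //; apply: mform_sum => e eKv.
  have /and3P[_ eK /eqP e2] := eKv; have [sh _ _ _] := uP eKv.
  by apply: mform_mfield => //; exact: tri_frame_fdet.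
- have vz (d : 'I_(nvert T)) K : K \in cells T -> d \in K -> assembled u K (vert d) = 0.
    move=> KT dK; rewrite /assembled big1 // => e eKv.
    have /and3P[_ eK /eqP e2] := eKv; have [_ tv _ _] := uP eKv.
    have [d' [i [j [_ _ KE _ FE]]]] := tri_frameP KT eK e2.
    have [] := mfield_vert (tri_frame_fdet KT eK e2) tv; rewrite {2 4 6}FE /=.
    by move: dK; rewrite KE !inE => /orP[/orP[]|] /eqP ->.
  by move=> d K K' KT KT' dK dK'; rewrite !vz.
move=> e K K' eT KT KT' eK eK' n t nn tn.
have e2 : #|e| == 2%N by move: eT; rewrite inE => /andP[].
have eKv : cell_edge e K by apply/and3P.
have eKv' : cell_edge e K' by apply/and3P.
have E (h h' : R * R -> R) : (forall s, h (edge_pt e s) = h' (edge_pt e s)) ->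
    edge_int e h = edge_int e h'.
  move=> hh; rewrite /edge_int [endpoints e]surjective_pairing /=; congr (_ * _).
  by apply: eq_Rintegral => s _; exact: hh.
have tE L : tn L = tnval n (assembled u L) by [].
split=> q _; apply: E => s.
  apply: (congr1 (fun z => z * q (edge_pt e s))).
  by rewrite /nn (assembled_trace s eKv).1 (assembled_trace s eKv').1 (single e K K' s eKv eKv').1.
apply: (congr1 (fun z => z * q (edge_pt e s))).
by rewrite !tE (assembled_trace s eKv).2 (assembled_trace s eKv').2 (single e K K' s eKv eKv').2.
Qed.

End assembled_field.

Lemma ex_cell_edge (R : realType) (Omega : set (R * R)) (T : triangulation Omega)
    (K : {set 'I_(nvert T)}) : K \in cells T -> exists e, cell_edge e K.
Proof.
move=> KT; have := card_cell KT; rewrite cardE => K3.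
have := mem_enum (mem K); have := enum_uniq (mem K).
case: (enum K) K3 => [|a [|b [|c [|]]]] // _ /= /and3P[ab _ _] K_.
have {}ab : a != b by move: ab; rewrite !inE negb_or => /andP[].
exists [set a; b]%SET; rewrite /cell_edge KT /= cards2 ab andbT.
by apply/fintype.subsetP => m; rewrite !inE -K_ !inE => /orP[] ->; rewrite ?orbT.
Qed.

Lemma evD (R : realType) (P Q : bpoly R) z : ev (P + Q) z = ev P z + ev Q z.
Proof. by rewrite evE. Qed.

Section cell_integral.
Context (R : realType) (Omega : set (R * R)) (T : triangulation Omega).
Context (K : {set 'I_(nvert T)}) (KT : K \in cells T).

Lemma cell_int_frame : exists2 F : frame R, fdet F != 0 &
  forall P, cell_int K (plift F P) = `|fdet F| * I2 P.
Proof.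
have [e /and3P[_ eK /eqP e2]] := ex_cell_edge KT.
by exists (tri_frame e K); [exact: tri_frame_fdet|exact: cell_int_plift].
Qed.

Lemma cell_int_sum (I : Type) (r : seq I) (P : pred I) (f : I -> R * R -> R) :
  (forall i, P i -> polyf (f i)) ->
  cell_int K (fun x => \sum_(i <- r | P i) f i x) = \sum_(i <- r | P i) cell_int K (f i).
Proof.
have [F F0 FE] := cell_int_frame.
move=> pf; elim: r => [|i r IH].
  rewrite (_ : (fun _ => _) = plift F 0) ?FE ?I2_0 ?mulr0 ?big_nil //.
  by apply/funext => x; rewrite big_nil /plift evE.
case Pi : (P i); under eq_fun do rewrite big_cons Pi; rewrite big_cons Pi // -IH.
have [A AE] := polyf_liftP F0 (pf i Pi).
have [B BE] := polyf_liftP F0 (@polyf_sum _ _ r _ f pf).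
rewrite AE BE !FE -mulrDr -I2D -FE; congr (cell_int K _).
apply/funext => x; rewrite /plift evD.
by rewrite -[ev A _]/(plift F A x) -[ev B _]/(plift F B x) -AE -BE.
Qed.

Lemma cell_int_le (f g : R * R -> R) : polyf f -> polyf g -> (forall x, f x <= g x) ->
  cell_int K f <= cell_int K g.
Proof.
have [F F0 FE] := cell_int_frame.
move=> /(polyf_liftP F0)[A ->] /(polyf_liftP F0)[B ->] fg.
rewrite !FE ler_wpM2l //; apply: I2_le => z _.
by have := fg (unbary F z); rewrite /plift unbaryK.
Qed.

Lemma cell_int_sqr0 (f : R * R -> R) : polyf f -> cell_int K (fun x => f x ^+ 2) <= 0 ->
  forall x, f x = 0.
Proof.
have [F F0 FE] := cell_int_frame.
move=> /(polyf_liftP F0)[A ->] fg x.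
suff -> : A = 0 by rewrite /plift evE.
apply: I2_sqr_eq0; apply/eqP; rewrite eq_le I2_sqr_ge0 andbT.
have D0 : 0 < `|fdet F| by rewrite normr_gt0.
rewrite -(pmulr_rle0 _ D0) -FE; congr (_ <= 0) : fg; congr (cell_int K _).
by apply/funext => y; rewrite /plift evM.
Qed.

End cell_integral.

Lemma form_assembled (R : realType) (Omega : set (R * R)) (T : triangulation Omega)
    (u : edge_fields T) (v : broken T R) (V : {set 'I_(nvert T)} -> {set 'I_(nvert T)} -> bpoly R) :
  (forall e K, cell_edge e K -> v K = plift (tri_frame e K) (V e K)) ->
  divdiv_form (assembled u) v =
  \sum_(K in cells T) \sum_(e | cell_edge e K)
    `|fdet (tri_frame e K)| * I2 (divdiv_ref (u e K) * V e K).
Proof.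
move=> vE; apply: eq_bigr => K KT.
transitivity (cell_int K (fun x => \sum_(e | cell_edge e K)
    plift (tri_frame e K) (divdiv_ref (u e K) * V e K) x)).
  apply: eq_Rintegral => x _; rewrite divdiv_sum; last by move=> e _; exact: mpolyf_mfield.
  rewrite mulr_suml; apply: eq_bigr => e eKv; have /and3P[_ eK /eqP e2] := eKv.
  by rewrite divdiv_mfield ?(tri_frame_fdet KT eK e2) // (vE e K eKv) /plift evM.
rewrite cell_int_sum //; last by move=> e _; exact: polyf_lift.
by apply: eq_bigr => e /and3P[_ eK /eqP e2]; exact: cell_int_plift.
Qed.

Lemma plift_scale (R : realType) (F : frame R) c P x : plift F (c%:P%:P * P) x = c * plift F P x.
Proof. by rewrite /plift evE evE. Qed.

Lemma frob2 (R : realType) (a b c : R) :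
  \sum_i \sum_j (mx2 a b c i j) ^+ 2 = a ^+ 2 + b ^+ 2 *+ 2 + c ^+ 2.
Proof. by rewrite !big_ord_recl !big_ord0 !mxE /=; ring. Qed.

Lemma frob_polyf (R : realType) (tau : R * R -> 'M[R]_2) : mpolyf tau ->
  polyf (fun x => \sum_i \sum_j (tau x i j) ^+ 2).
Proof.
move=> mp; apply: polyf_sum => i _; apply: polyf_sum => j _.
under eq_fun do rewrite expr2; exact: polyfM.
Qed.

Lemma sqr_sum_le (R : realType) (I : finType) (P : pred I) (F : I -> R) :
  (\sum_(i | P i) F i) ^+ 2 <= #|P|%:R * \sum_(i | P i) F i ^+ 2.
Proof.
have E (G : I -> R) : \sum_(i | P i) G i = \sum_(j < #|P|) G (enum_val j).
  by rewrite -(big_enum_val G); apply: eq_bigl.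
rewrite !E; have := sum_CS (fun=> 1) (fun j : 'I_#|P| => F (enum_val j)).
under eq_bigr do rewrite mul1r.
by under [X in _ <= X * _ -> _]eq_bigr do rewrite expr1n; rewrite sumr_const card_ord.
Qed.

Lemma card_cell_edge (R : realType) (Omega : set (R * R)) (T : triangulation Omega)
    (K : {set 'I_(nvert T)}) : K \in cells T -> (#|[pred e | cell_edge e K]| <= 8)%N.
Proof.
move=> KT; rewrite -[8%N]/(2 ^ 3)%N -(card_cell KT) -card_powerset; apply: subset_leq_card.
by apply/fintype.subsetP => e; rewrite !inE => /and3P[].
Qed.

(** The factor 8 is the number of subsets of K, a crude bound on the number of contributions. *)
Lemma L2norm_assembled (R : realType) (Omega : set (R * R)) (T : triangulation Omega)
    (u : edge_fields T) :
  L2norm (assembled u) ^+ 2 <= 8 * \sum_(K in cells T) \sum_(e | cell_edge e K)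
    frame_size (tri_frame e K) ^+ 2 * (`|fdet (tri_frame e K)| * sqn (u e K)).
Proof.
have mp K : mpolyf (assembled u K).
  by apply: mpolyf_sum => e _; exact: mpolyf_mfield.
have pos x K : 0 <= \sum_i \sum_j (assembled u K x i j) ^+ 2.
  by apply: sumr_ge0 => i _; apply: sumr_ge0 => j _; exact: sqr_ge0.
rewrite /L2norm sqr_sqrtr; last first.
  by apply: sumr_ge0 => K _; apply: Rintegral_ge0 => x _; exact: pos.
rewrite mulr_sumr; apply: ler_sum => K KT.
pose G e := (frame_size (tri_frame e K) ^+ 2)%:P%:P *
  (tf1 (u e K) * tf1 (u e K) + tf2 (u e K) * tf2 (u e K) + tf3 (u e K) * tf3 (u e K)).
apply: (@le_trans _ _ (cell_int K (fun x => 8 * \sum_(e | cell_edge e K) plift (tri_frame e K) (G e) x))).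
  apply: cell_int_le => //; first exact: frob_polyf.
    by apply: polyfM (polyfC _) _; apply: polyf_sum => e _; exact: polyf_lift.
  move=> x; rewrite /assembled.
  apply: (@le_trans _ _ (\sum_i \sum_j 8 * \sum_(e | cell_edge e K) mfield (tri_frame e K) (u e K) x i j ^+ 2)).
    apply: ler_sum => i _; apply: ler_sum => j _; rewrite summxE.
    apply: (le_trans (sqr_sum_le _ _)); apply: ler_wpM2r.
      by apply: sumr_ge0 => e _; exact: sqr_ge0.
    by rewrite ler_nat; exact: card_cell_edge.
  under eq_bigr do rewrite -mulr_sumr exchange_big /=.
  rewrite -mulr_sumr exchange_big /= ler_wpM2l //; apply: ler_sum => e _.
  rewrite /G plift_scale; apply: le_trans (mfield_sqr _ _ _).
  by rewrite le_eqVlt; apply/orP; left; apply/eqP; exact: frob2.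
rewrite (_ : (fun x => _) = fun x => \sum_(e | cell_edge e K) 8 * plift (tri_frame e K) (G e) x);
  last by apply/funext => x; rewrite mulr_sumr.
rewrite cell_int_sum; last by move=> // e _; apply: polyfM (polyfC _) (polyf_lift _ _).
  rewrite mulr_sumr le_eqVlt; apply/orP; left; apply/eqP; apply: eq_bigr => e /and3P[_ eK /eqP e2].
  rewrite (_ : (fun x => _) = plift (tri_frame e K) (8%:P%:P * G e)).
    by rewrite cell_int_plift // I2Z I2Z /sqn !I2D; ring.
  by apply/funext => x; rewrite plift_scale.
by [].
Qed.

Lemma divdiv_cst (R : realType) (A : 'M[R]_2) x : divdiv (fun=> A) x = 0.
Proof.
have z y i : div_rows (fun=> A) y i 0 = 0.
  by rewrite mxE big1 // => j _; exact: derive_cst.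
rewrite /divdiv big1 // => i _.
by rewrite /pd (_ : (fun y => _) = fun=> 0) ?derive_cst //; apply/funext => y; exact: z.
Qed.

(** * The supremum, and energies with their scaling *)

Section global.
Context (R : realType) (Omega : set (R * R)) (T : triangulation Omega).

Lemma L2norm_ge0 (tau : broken T 'M[R]_2) : 0 <= L2norm tau.
Proof. exact: sqrtr_ge0. Qed.

Lemma frob_ge0 (A : 'M[R]_2) : 0 <= \sum_i \sum_j (A i j) ^+ 2.
Proof. by apply: sumr_ge0 => i _; apply: sumr_ge0 => j _; exact: sqr_ge0. Qed.

Lemma L2norm_eq0 (tau : broken T 'M[R]_2) : (forall K, mpolyf (tau K)) -> L2norm tau = 0 ->
  forall K, K \in cells T -> tau K = fun=> 0.
Proof.
move=> mp t0 K KT.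
have c0 K' : 0 <= cell_int K' (fun x => \sum_i \sum_j (tau K' x i j) ^+ 2).
  by apply: Rintegral_ge0 => x _; exact: frob_ge0.
have := t0; rewrite /L2norm => /eqP; rewrite sqrtr_eq0 => s0.
have : \sum_(K in cells T) cell_int K (fun x => \sum_i \sum_j (tau K x i j) ^+ 2) = 0.
  by apply/eqP; rewrite eq_le s0 sumr_ge0.
move=> /(psumr_eq0P (fun K _ => c0 K))/(_ K KT) E.
apply/funext => x; apply/matrixP => i j; rewrite [RHS]mxE.
suff le0 : cell_int K (fun y => (fun z => tau K z i j) y ^+ 2) <= 0.
  exact: (cell_int_sqr0 KT (mp K i j) le0 x).
have p2 : polyf (fun y => tau K y i j ^+ 2).
  under eq_fun do rewrite expr2; exact: polyfM (mp K i j) (mp K i j).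
rewrite -E; apply: cell_int_le => //=; first exact: frob_polyf.
move=> y; rewrite (bigD1 i) //= (bigD1 j) //= -addrA lerDl addr_ge0 //.
  by apply: sumr_ge0 => m _; exact: sqr_ge0.
by apply: sumr_ge0 => m _; apply: sumr_ge0 => m' _; exact: sqr_ge0.
Qed.

Lemma L2norm_nonzero (tau : broken T 'M[R]_2) : L2norm tau != 0 -> nonzero tau.
Proof.
apply: contra_neqP => nz; rewrite /L2norm big1 ?sqrtr0 // => K KT.
have [F F0 FE] := cell_int_frame KT.
transitivity (cell_int K (plift F 0)); last by rewrite FE I2_0 mulr0.
apply: eq_Rintegral => x /set_mem xK; rewrite /plift evE big1 // => i _; rewrite big1 // => j _.
have [->|t0] := eqVneq (tau K x) 0; first by rewrite mxE expr0n.
by case: nz; exists K, x.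
Qed.

(** Spares checking that test fields are nonzero: a piecewise polynomial field of zero norm vanishes
    on each cell, and both sides are 0. *)
Lemma form_le (k l : nat) (v : broken T R) (S : R) (tau : broken T 'M[R]_2) :
  (forall tau, Sigma_h l k tau -> nonzero tau -> divdiv_form tau v / L2norm tau <= S) ->
  Sigma_h l k tau -> (forall K, mpolyf (tau K)) -> divdiv_form tau v <= S * L2norm tau.
Proof.
move=> H st mp; have [t0|t0] := eqVneq (L2norm tau) 0.
  rewrite t0 mulr0 /divdiv_form big1 // => K KT; rewrite (L2norm_eq0 mp t0 KT).
  have [F F0 FE] := cell_int_frame KT.
  transitivity (cell_int K (plift F 0)); last by rewrite FE I2_0 mulr0.
  by apply: eq_Rintegral => x _; rewrite divdiv_cst mul0r /plift evE.
have tp : 0 < L2norm tau by rewrite lt_neqAle eq_sym t0 L2norm_ge0.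
by rewrite -ler_pdivrMr //; apply: H => //; exact: L2norm_nonzero.
Qed.

(** The constant identity field is a nonzero competitor with zero divdiv; it makes the supremum
    nonnegative. *)
Lemma identity_Sigma k l : (3 <= k)%N -> (k - 1 <= l)%N ->
  Sigma_h l k ((fun _ _ => mx2 1 0 1) : broken T 'M[R]_2).
Proof.
move=> k3 kl; split=> // K KT; apply: mform_Sigma_loc => //.
exists (fun=> 1), (fun=> 0), (fun=> 1), (fun=> 0).
split; [by split; exact: Poly_leC|exact: Poly_leC|by move=> x; rewrite scale0r addr0].
Qed.

Lemma identity_nonzero K : K \in cells T -> nonzero ((fun _ _ => mx2 1 0 1) : broken T 'M[R]_2).
Proof.
move=> KT; exists K, (origin K); split=> //; first exact: origin_in.
by apply/eqP => /matrixP/(_ 0 0); rewrite !mxE /= => /eqP; rewrite oner_eq0.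
Qed.

Lemma identity_form (v : broken T R) :
  divdiv_form ((fun _ _ => mx2 1 0 1) : broken T 'M[R]_2) v = 0.
Proof.
rewrite /divdiv_form big1 // => K KT; have [F F0 FE] := cell_int_frame KT.
transitivity (cell_int K (plift F 0)); last by rewrite FE I2_0 mulr0.
by apply: eq_Rintegral => x _; rewrite divdiv_cst mul0r /plift evE.
Qed.

(** Weights dictated by scaling: squared dyads count as |det|^2 and the Jacobian as |det|. The
    exponents 3 and - 1 of the two energies average to the exponent 1 of the cross term. *)
Definition fields_energy (u : edge_fields T) : R :=
  \sum_(K in cells T) \sum_(e | cell_edge e K) `|fdet (tri_frame e K)| ^+ 3 * sqn (u e K).
Definition hess_energy (V : {set 'I_(nvert T)} -> {set 'I_(nvert T)} -> bpoly R) : R :=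
  \sum_(K in cells T) \sum_(e | cell_edge e K) `|fdet (tri_frame e K)|^-1 * hess (V e K).
Definition cross_energy (u : edge_fields T) (V : {set 'I_(nvert T)} -> {set 'I_(nvert T)} -> bpoly R) : R :=
  \sum_(K in cells T) \sum_(e | cell_edge e K) `|fdet (tri_frame e K)| * pairing (u e K) (V e K).

Lemma cell_edge_fdet e K : cell_edge e K -> 0 < `|fdet (@tri_frame _ _ T e K)|.
Proof. by move=> /and3P[KT eK /eqP e2]; rewrite normr_gt0 tri_frame_fdet. Qed.

Lemma cross_le u V (C : R) : 0 < C ->
  `|cross_energy u V| *+ 2 <= C^-1 * fields_energy u + C * hess_energy V.
Proof.
move=> C0; rewrite /cross_energy /fields_energy /hess_energy !mulr_sumr -big_split /=.
apply: (@le_trans _ _ (\sum_(K in cells T) `|\sum_(e | cell_edge e K)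
   `|fdet (tri_frame e K)| * pairing (u e K) (V e K)| *+ 2)).
  by rewrite sumrMnl lerMn2r /= ler_norm_sum.
apply: ler_sum => K KT; rewrite !mulr_sumr -big_split /=.
apply: (@le_trans _ _ (\sum_(e | cell_edge e K)
    `| `|fdet (tri_frame e K)| * pairing (u e K) (V e K)| *+ 2)).
  by rewrite sumrMnl lerMn2r /= ler_norm_sum.
apply: ler_sum => e /cell_edge_fdet; set D := `|fdet _| => D0.
rewrite normrM gtr0_norm // -mulrnAr.
(* This weight sends D to D^3 in one term of Young's inequality and to 1 / D in the other. *)
have t0 : 0 < C^-1 * D ^+ 2 by rewrite mulr_gt0 ?invr_gt0 // exprn_gt0.
apply: (le_trans (ler_wpM2l (ltW D0) (pairing_le (u e K) (V e K) t0))).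
rewrite le_eqVlt; apply/orP; left; apply/eqP; field.
by rewrite !gt_eqF.
Qed.

Lemma norm_le (u : edge_fields T) (kappa : R) :
  (forall e K, @cell_edge _ _ T e K -> frame_size (tri_frame e K) <= kappa * `|fdet (tri_frame e K)|) ->
  L2norm (assembled u) ^+ 2 <= 8 * kappa ^+ 2 * fields_energy u.
Proof.
move=> H; apply: (le_trans (L2norm_assembled u)); rewrite -mulrA ler_wpM2l //.
rewrite mulr_sumr; apply: ler_sum => K KT; rewrite mulr_sumr; apply: ler_sum => e eK.
have D0 := cell_edge_fdet eK; have s0 := sqn_ge0 (u e K).
have f0 : 0 <= frame_size (tri_frame e K) := addr_ge0 (addr_ge0 (dotp_ge0 _) (dotp_ge0 _)) (dotp_ge0 _).
have -> : kappa ^+ 2 * (`|fdet (tri_frame e K)| ^+ 3 * sqn (u e K)) =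
   (kappa * `|fdet (tri_frame e K)|) ^+ 2 * (`|fdet (tri_frame e K)| * sqn (u e K)) by ring.
apply: ler_wpM2r; first by rewrite mulr_ge0 // ltW.
by rewrite ler_pXn2r ?nnegrE // ?(le_trans f0) // H.
Qed.

End global.

(* Young's inequality absorbs both the cross terms and the right-hand side into M. *)
Lemma absorb (R : realType) (N M A P L S kappa C : R) : 0 < C -> 0 < kappa ->
  N <= C * M -> L ^+ 2 <= 8 * kappa ^+ 2 * N -> `|P| *+ 2 <= C^-1 * N + C * A ->
  P + M <= S * L -> M <= 32 * kappa ^+ 2 * C * S ^+ 2 + 2 * C * A.
Proof.
move=> C0 k0 NM LN PN form.
set B := 8 * kappa ^+ 2 * C; have B0 : 0 < B by rewrite !mulr_gt0 // exprn_gt0.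
have LM : L ^+ 2 <= B * M.
  apply: (le_trans LN); rewrite /B -[X in _ <= X]mulrA ler_wpM2l //.
  by rewrite mulr_ge0 // sqr_ge0.
have PM : `|P| *+ 2 <= M + C * A.
  apply: (le_trans PN); rewrite lerD2r -ler_pdivlMl ?invr_gt0 // invrK //.
(* P takes half of M and S L a quarter; the remaining quarter gives the factors 4 B = 32 kappa^2 C
   and 2 C. *)
have SL : S * L <= B * S ^+ 2 + M / 4.
  have : 0 <= (2 * B * S - L) ^+ 2 by exact: sqr_ge0.
  move=> sq; rewrite -(ler_pM2l B0); nra.
have -> : 32 * kappa ^+ 2 * C * S ^+ 2 = 4 * (B * S ^+ 2) by rewrite /B; ring.
have := ler_norm (- P); rewrite normrN; rewrite -[2 * C * A]mulrA.
clearbody B; move: SL PM form; move: (C * A) (B * S ^+ 2) (S * L) (`|P|) => a b c d; lra.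
Qed.

Lemma sqnZ (R : realType) c (u : tfield R) : sqn (tfZ c u) = c ^+ 2 * sqn u.
Proof.
have h (P : bpoly R) : I2 (c%:P%:P * P * (c%:P%:P * P)) = c ^+ 2 * I2 (P * P).
  by rewrite -I2Z; congr I2; rewrite !polyC_exp; ring.
by rewrite /sqn /tfZ /= !h; ring.
Qed.

Section edges.
Context (R : realType) (Omega : set (R * R)) (T : triangulation Omega).
Implicit Types e K : {set 'I_(nvert T)}.

Lemma sum_edges (G : {set 'I_(nvert T)} -> {set 'I_(nvert T)} -> R) :
  \sum_(K in cells T) \sum_(e | cell_edge e K) G e K =
  \sum_(e in edges T) \sum_(K in cells T | e \subset K) G e K.
Proof.
rewrite (exchange_big_dep (fun e => e \in edges T)) /=.
  apply: eq_bigr => e; rewrite inE => /andP[e2 _]; apply: eq_bigl => K.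
  by rewrite /cell_edge e2 andbT; case: (K \in cells T).
move=> K e KT /and3P[_ eK e2]; rewrite inE e2; apply/existsP; exists K; by rewrite KT.
Qed.

Lemma cell_edge_edges e K : cell_edge e K -> e \in edges T.
Proof. by move=> /and3P[KT eK e2]; rewrite inE e2; apply/existsP; exists K; rewrite KT. Qed.

(** The piecewise constant function [side e] has a jump of modulus at most 2, while by [jump_sqr]
    this modulus is the number of cells at e. *)
Lemma edge_cells_le2 e (c : R) : e \in edges T -> 0 <= c ->
  \sum_(K in cells T | e \subset K) c <= 2 * c.
Proof.
move=> eT c0; have := jump_sqr (fun K (_ : R * R) => side e K) 0 eT.
have e2 : #|e| = 2%N by move: eT; rewrite inE => /andP[/eqP].
rewrite [X in _ = X ^+ 2 -> _](eq_bigr (fun=> 1)); last first.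
  by move=> K /andP[KT eK]; rewrite -expr2 side_sqr.
have sle K : `|side e K| <= 1 by rewrite /side normr_sg; case: (_ == 0) => /=; rewrite ?ler01.
rewrite !sumr_const; set N := #|_| => jN.
suff : N%:R <= 2 :> R by move=> N2; rewrite -[c in X in X <= _]mul1r -mulrnAl ler_wpM2r.
rewrite -(ler_pXn2r (n := 2)) ?nnegrE // -jN -[X in X <= _]real_normK ?num_real // ler_pXn2r ?nnegrE //.
rewrite /jump; case: (enum _) => [|K [|K' s]]; rewrite ?normr0 //.
  by apply: (le_trans (sle K)); rewrite ler1n.
by apply: (le_trans (ler_normB _ _)); have := sle K; have := sle K'; lra.
Qed.

(** Shape regularity makes h^2 and D comparable and bounds the slant, a ratio of two lengths. *)
Lemma cell_edge_numbers (kappa : R) e K : cell_edge e K ->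
  0 < kappa -> frame_size (tri_frame e K) <= kappa * `|fdet (tri_frame e K)| ->
  let D : R := `|fdet (tri_frame e K)| in let h : R := edge_length e in let a : R := height e K in
  [/\ 0 < h, a != 0 /\ D = h * `|a|, D <= kappa * h ^+ 2, h ^+ 2 <= kappa * D &
      obliquity e K ^+ 2 <= 2 * kappa ^+ 2 + 2^-1].
Proof.
move=> /and3P[KT eK /eqP e2] k0 fs D h a.
have [h0 DE] := edge_length_height KT eK e2; have a0 := height_neq0 KT eK e2.
have nn := edge_normal_dotp KT eK e2; have n1 := edge_normal_te1 KT eK e2.
have t1 := dotp_ge0 (te1 (tri_frame e K)); have t2 := dotp_ge0 (te2 (tri_frame e K)).
have t3 := dotp_ge0 (te3 (tri_frame e K)).
have L v : dotp v v = dotp (edge_normal e) v ^+ 2 + dotp (rot90 (edge_normal e)) v ^+ 2.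
  by rewrite -[LHS]mul1r -nn /dotp /rot90 /=; ring.
have h2 : h ^+ 2 = dotp (te1 (tri_frame e K)) (te1 (tri_frame e K)).
  exact: enorm_sqr.
have hD : h ^+ 2 <= kappa * D.
  by apply: le_trans fs; rewrite h2 /frame_size -addrA lerDl addr_ge0.
have t2D : dotp (te2 (tri_frame e K)) (te2 (tri_frame e K)) <= kappa * D.
  by apply: le_trans fs; rewrite /frame_size [X in X + _]addrC -addrA lerDl addr_ge0.
have aD : a ^+ 2 <= kappa * D by apply: le_trans t2D; rewrite L lerDl sqr_ge0.
have ap : 0 < `|a| by rewrite normr_gt0.
have ah : `|a| <= kappa * h.
  rewrite -(ler_pM2r ap) -expr2 real_normK ?num_real //.
  by rewrite -mulrA -DE.
have Dh : D <= kappa * h ^+ 2.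
  have -> : D = h * `|a| := DE; have -> : kappa * h ^+ 2 = h * (kappa * h) by ring.
  by rewrite ler_pM2l.
split=> //; set b := dotp (rot90 (edge_normal e)) (te1 (tri_frame e K)).
have b2 : b ^+ 2 = h ^+ 2 by rewrite h2 L n1 expr0n /= add0r.
set c := dotp (rot90 (edge_normal e)) (te2 (tri_frame e K)).
have c2 : c ^+ 2 <= kappa ^+ 2 * h ^+ 2.
  apply: (@le_trans _ _ (kappa * D)); first by apply: le_trans t2D; rewrite [leRHS]L lerDr sqr_ge0.
  by rewrite expr2 -mulrA ler_pM2l.
have q : (c / b) ^+ 2 <= kappa ^+ 2.
  by rewrite expr_div_n b2 ler_pdivrMr // exprn_gt0.
rewrite /obliquity /tratio -/b -/c; have := sqr_ge0 (c / b - 2^-1); move: (c / b) q => x q; nra.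
Qed.

End edges.

Section steps.
Context (R : realType) (Omega : set (R * R)) (T : triangulation Omega) (k l : nat).
Hypothesis k3 : (3 <= k)%N.
Hypothesis kl : (k - 1 <= l)%N.
Context (kappa S : R) (v : broken T R).
Context (V : {set 'I_(nvert T)} -> {set 'I_(nvert T)} -> bpoly R).
Hypothesis kp : 0 < kappa.
Hypothesis sh : forall e K, @cell_edge _ _ T e K ->
  frame_size (tri_frame e K) <= kappa * `|fdet (tri_frame e K)|.
Hypothesis Vd : forall e K, @cell_edge _ _ T e K -> bdeg (k - 2) (V e K).
Hypothesis vE : forall e K, @cell_edge _ _ T e K -> v K = plift (tri_frame e K) (V e K).
Hypothesis fS : forall tau : broken T 'M[R]_2, Sigma_h l k tau -> (forall K, mpolyf (tau K)) ->
  divdiv_form tau v <= S * L2norm tau.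

Lemma mpolyf_assembled (u : edge_fields T) K : mpolyf (assembled u K).
Proof. by apply: mpolyf_sum => e _; exact: mpolyf_mfield. Qed.

(** Scheme shared by the two edge families; M is the jump term that Green's formula produces. *)
Lemma step (u : edge_fields T) f g (C M : R) : 0 < C ->
  (forall e K, cell_edge e K -> one_edge k (u e K) (f e K) (g e K)) ->
  (forall e K K' s, @cell_edge _ _ T e K -> @cell_edge _ _ T e K' ->
    height e K ^+ 2 * (f e K).[s] = height e K' ^+ 2 * (f e K').[s] /\
    height e K * (2^-1 * (g e K).[s] + obliquity e K * ((f e K)^`()).[s]) =
    height e K' * (2^-1 * (g e K').[s] + obliquity e K' * ((f e K')^`()).[s])) ->
  fields_energy u <= C * M -> divdiv_form (assembled u) v = cross_energy u V + M ->
  M <= 32 * kappa ^+ 2 * C * S ^+ 2 + 2 * C * hess_energy V.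
Proof.
move=> C0 uP single NM form.
have fL : cross_energy u V + M <= S * L2norm (assembled u).
  rewrite -form; apply: fS; last exact: mpolyf_assembled.
  exact: (assembled_Sigma k3 kl uP single).
exact: (absorb C0 kp NM (norm_le u sh) (cross_le u V C0) fL).
Qed.

(** The reference bubbles are scaled by D^-2, since D^3 (D^-2)^2 = D D^-2 puts the energy and the
    form on the same footing. C is used twice, for the energy and for the Hessian, hence its
    square. *)
Lemma bubble_step (C : R) : 0 < C ->
  (forall W, bdeg (k - 2) W -> exists u, [/\ one_edge k u 0 0,
    sqn u <= C * pairing u W & hess W <= C * pairing u W]) ->
  hess_energy V <= 32 * kappa ^+ 2 * C ^+ 2 * S ^+ 2.
Proof.
move=> C0 ref.
have /choice[U UP] : forall p : {set 'I_(nvert T)} * {set 'I_(nvert T)}, exists u,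
    cell_edge p.1 p.2 -> [/\ one_edge k u 0 0,
    sqn u <= C * pairing u (V p.1 p.2) & hess (V p.1 p.2) <= C * pairing u (V p.1 p.2)].
  move=> [e K]; have [eK|_] := boolP (cell_edge e K); last by exists (tf0 R).
  by have [u uP] := ref _ (Vd eK); exists u.
pose u e K := tfZ (`|fdet (tri_frame e K)| ^- 2) (U (e, K)).
have uP e K : cell_edge e K -> one_edge k (u e K) 0 0.
  by move=> eK; have [b _ _] := UP (e, K) eK; apply: (one_edge_eq (one_edgeZ _ b)); rewrite mulr0.
pose M := \sum_(K in cells T) \sum_(e | cell_edge e K)
  `|fdet (tri_frame e K)|^-1 * pairing (U (e, K)) (V e K).
have NM : fields_energy u <= C * M.
  rewrite /M mulr_sumr; apply: ler_sum => K _; rewrite mulr_sumr; apply: ler_sum => e eK.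
  have [_ s _] := UP (e, K) eK; have D0 := cell_edge_fdet eK.
  rewrite sqnZ [leRHS]mulrCA; have -> : `|fdet (tri_frame e K)| ^+ 3 * ((`|fdet (tri_frame e K)| ^- 2) ^+ 2 * sqn (U (e, K)))
    = `|fdet (tri_frame e K)|^-1 * sqn (U (e, K)) by field; rewrite gt_eqF.
  by rewrite ler_pM2l // invr_gt0.
have form : divdiv_form (assembled u) v = M.
  rewrite (form_assembled u vE); apply: eq_bigr => K _; apply: eq_bigr => e eK.
  have D0 := cell_edge_fdet eK.
  by rewrite (green_bubble _ (uP e K eK)) pairingZl; field; rewrite gt_eqF.
(* The pairing is itself the term to be bounded, so [absorb] is used without cross term or Hessian
   term. *)
have M0 : M <= 32 * kappa ^+ 2 * C * S ^+ 2 + 2 * C * 0.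
  apply: (@absorb _ _ _ _ 0 _ _ _ _ C0 kp NM (norm_le u sh)).
    have N0 : 0 <= fields_energy u.
      apply: sumr_ge0 => K _; apply: sumr_ge0 => e _.
      by rewrite mulr_ge0 ?sqn_ge0 // exprn_ge0.
    by rewrite normr0 mul0rn mulr0 addr0 mulr_ge0 // invr_ge0 ltW.
  rewrite add0r -form; apply: fS; last exact: mpolyf_assembled.
  apply: (assembled_Sigma k3 kl (f := fun _ _ => 0) (g := fun _ _ => 0)) => // e K K' s _ _.
  by rewrite -polyC0 derivC !hornerC !mulr0 addr0 !mulr0.
have HM : hess_energy V <= C * M.
  rewrite /M mulr_sumr; apply: ler_sum => K _; rewrite mulr_sumr; apply: ler_sum => e eK.
  have [_ _ s] := UP (e, K) eK; have D0 := cell_edge_fdet eK.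
  by rewrite mulrCA ler_pM2l // invr_gt0.
apply: (le_trans HM); rewrite mulr0 addr0 in M0.
by apply: (le_trans (ler_wpM2l (ltW C0) M0)); rewrite le_eqVlt; apply/orP; left; apply/eqP; ring.
Qed.

Definition edge_jump (e : {set 'I_(nvert T)}) : {poly R} :=
  \sum_(K in cells T | e \subset K) (side e K)%:P * tr1 (V e K).
Definition normal_jump (e : {set 'I_(nvert T)}) : {poly R} :=
  \sum_(K in cells T | e \subset K)
    (side e K)%:P * normal_trace (tri_frame e K) (edge_normal e) (V e K).

Lemma shear_step (C : R) : 0 < C ->
  (forall J : {poly R}, (size J <= k - 1)%N -> exists u, one_edge k u 0 J /\ sqn u <= C * I1 (J * J)) ->
  \sum_(e in edges T) edge_length e ^- 2 * I1 (edge_jump e * edge_jump e) <=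
    32 * kappa ^+ 2 * (8 * C * kappa) * S ^+ 2 + 2 * (8 * C * kappa) * hess_energy V.
Proof.
move=> C0 ref.
(* The effective shear is then [- h^-3] times the jump, seen from every cell. *)
pose g e K : {poly R} := (- (2 * (height e K)^-1 * edge_length e ^- 3))%:P * edge_jump e.
have sJ e : e \in edges T -> (size (edge_jump e) <= k - 1)%N.
  rewrite inE => /andP[e2 _]; apply: (leq_trans (size_sum _ _ _)).
  apply/bigmax_leqP => K /andP[KT eK].
  rewrite mul_polyC; apply: leq_trans (size_scale_leq _ _) _.
  have eKv : cell_edge e K by apply/and3P.
  by apply: leq_trans (size_tr1 (Vd eKv)) _; lia.
have /choice[U UP] : forall p : {set 'I_(nvert T)} * {set 'I_(nvert T)}, exists u,
    cell_edge p.1 p.2 -> one_edge k u 0 (g p.1 p.2) /\ sqn u <= C * I1 (g p.1 p.2 * g p.1 p.2).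
  move=> [e K]; have [eK|_] := boolP (cell_edge e K); last by exists (tf0 R).
  have [|u uP] := ref (g e K); last by exists u.
  by rewrite /g mul_polyC; apply: leq_trans (size_scale_leq _ _) _; exact: sJ (cell_edge_edges eK).
pose u e K := U (e, K).
apply: (step (u := u) (f := fun _ _ => 0) (g := g)).
- by rewrite !mulr_gt0.
- by move=> e K eK; have [] := UP (e, K) eK.
- move=> e K K' s eK eK'; rewrite -polyC0 derivC !hornerC !mulr0 !addr0; split=> //.
  have [_ [a0 _] _ _ _] := cell_edge_numbers eK kp (sh eK).
  have [_ [a0' _] _ _ _] := cell_edge_numbers eK' kp (sh eK').
  rewrite /g !hornerM !hornerC; move: (edge_jump e).[s] (edge_length e ^- 3) => x y.
  by field; apply/andP.
(* Since D = h |a|, the squared factor of the jump gives D^3 (2 / (a h^3))^2 = 4 D / h^4 <= 4 kappa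
   / h^2 on each of at most two cells. *)
- rewrite /fields_energy sum_edges mulr_sumr; apply: ler_sum => e eT.
  have e2 : #|e| == 2%N by move: eT; rewrite inE => /andP[].
  have J0 : 0 <= edge_length e ^- 2 * I1 (edge_jump e * edge_jump e).
    by rewrite mulr_ge0 ?I1_sqr_ge0 // invr_ge0 sqr_ge0.
  apply: (@le_trans _ _ (\sum_(K in cells T | e \subset K)
     (4 * C * kappa) * (edge_length e ^- 2 * I1 (edge_jump e * edge_jump e)))); last first.
    apply: (le_trans (edge_cells_le2 eT _)); first by rewrite mulr_ge0 // !mulr_ge0 // ltW.
    by rewrite le_eqVlt; apply/orP; left; apply/eqP; ring.
  apply: ler_sum => K /andP[KT eK]; have eKv : cell_edge e K by apply/and3P.
  have [_ s] := UP (e, K) eKv; have [h0 [a0 DE] Dh _ _] := cell_edge_numbers eKv kp (sh eKv).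
  have D0 := cell_edge_fdet eKv; rewrite /u.
  apply: (le_trans (ler_wpM2l _ s)); first by rewrite exprn_ge0.
  rewrite /= /g.
  have -> (c : R) (p : {poly R}) : I1 (c%:P * p * (c%:P * p)) = c ^+ 2 * I1 (p * p).
    by rewrite -I1Z; congr I1; rewrite polyC_exp; ring.
  have I0 : 0 <= I1 (edge_jump e * edge_jump e) by exact: I1_sqr_ge0.
  move: (I1 _) I0 h0 a0 DE Dh D0 => J I0; move: (edge_length e) (height e K) => h a h0 a0.
  set D := `|fdet _| => DE Dh D0.
  have -> : D ^+ 3 * (C * ((- (2 * a^-1 * h ^- 3)) ^+ 2 * J)) = 4 * C * (h ^- 4 * J) * D.
    have aE : a ^+ 2 = (D / h) ^+ 2.
      by rewrite DE [h * _]mulrC mulfK ?gt_eqF // real_normK ?num_real.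
    have -> : (- (2 * a^-1 * h ^- 3)) ^+ 2 = 4 * (a ^+ 2)^-1 * h ^- 6 by field; rewrite a0 gt_eqF.
    by rewrite aE; field; rewrite !gt_eqF.
  have -> : 4 * C * kappa * (h ^- 2 * J) = 4 * C * (h ^- 4 * J) * (kappa * h ^+ 2).
    by field; rewrite gt_eqF.
  apply: ler_wpM2l => //.
  by rewrite !mulr_ge0 // ?invr_ge0 ?exprn_ge0 // ltW.
(* The edge term of Green's formula carries D / (a h^3), which is the sign [side e K] over h^2;
   these signs recombine the traces of v from the cells at e into the jump. *)
rewrite (form_assembled u vE) /cross_energy.
rewrite (eq_bigr (fun K => \sum_(e | cell_edge e K) (`|fdet (tri_frame e K)| * pairing (u e K) (V e K) +
   edge_length e ^- 2 * I1 (edge_jump e * ((side e K)%:P * tr1 (V e K)))))); last first.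
  move=> K _; apply: eq_bigr => e eK; have [b _] := UP (e, K) eK.
  have [h0 [a0 DE] _ _ _] := cell_edge_numbers eK kp (sh eK).
  rewrite (green_shear _ b) mulrBr; apply: (congr1 (fun z => _ + z)).
  have E1 : I1 (g e K * tr1 (V e K)) =
      - (2 * (height e K)^-1 * edge_length e ^- 3) * I1 (edge_jump e * tr1 (V e K)).
    by rewrite -I1Z /g mulrA.
  have E2 : I1 (edge_jump e * ((side e K)%:P * tr1 (V e K))) =
      side e K * I1 (edge_jump e * tr1 (V e K)) by rewrite -I1Z mulrCA.
  rewrite E1 E2 DE normrEsg -/(side e K).
  move: (I1 _) (side e K) (height e K) (edge_length e) a0 h0 => J s a h a0 h0.
  by field; rewrite a0 gt_eqF.
under eq_bigr do rewrite big_split /=; rewrite big_split /=; apply: (congr1 (fun z => _ + z)).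
rewrite sum_edges; apply: eq_bigr => e eT.
by rewrite -mulr_sumr -I1_sum -mulr_sumr.
Qed.

Lemma size_normal_jump e : e \in edges T -> (size (normal_jump e) <= k - 2)%N.
Proof.
rewrite inE => /andP[e2 _]; apply: (leq_trans (size_sum _ _ _)).
apply/bigmax_leqP => K /andP[KT eK].
rewrite mul_polyC; apply: leq_trans (size_scale_leq _ _) _.
have eKv : cell_edge e K by apply/and3P.
rewrite /normal_trace mul_polyC; apply: leq_trans (size_scale_leq _ _) _.
have [v1 v2 v3] := bdeg_d (Vd eKv).
have km : ((k - 2).-1.+1 <= k - 2)%N by clear -k3; lia.
apply: leq_trans (size_polyD _ _) _; rewrite size_polyN geq_max !mul_polyC; apply/andP; split.
  apply: leq_trans (size_scale_leq _ _) _.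
  exact: leq_trans (size_tr1 (bdegB v2 v3)) km.
apply: leq_trans (size_scale_leq _ _) _.
exact: leq_trans (size_tr1 v1) km.
Qed.

Lemma normal_step (C C' : R) : 0 < C -> C' = 2 * C * (3 + 8 * kappa ^+ 2) * kappa ->
  (forall (r : {poly R}) c, (size r <= k - 2)%N -> exists u,
    one_edge k u (('X - 'X ^+ 2) * r) (c%:P * (('X - 'X ^+ 2) * r)^`()) /\
    sqn u <= C * (1 + c ^+ 2) * I1 (('X - 'X ^+ 2) * r * r)) ->
  \sum_(e in edges T) I1 (('X - 'X ^+ 2) * normal_jump e * normal_jump e) <=
    32 * kappa ^+ 2 * C' * S ^+ 2 + 2 * C' * hess_energy V.
Proof.
move=> C0 C'E ref.
(* The factor height^-2 makes n^T tau n the same from both sides; [g] below then cancels the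
   effective shear on each side. *)
pose c (e K : {set 'I_(nvert T)}) : R := (height e K ^- 2 * (edge_length e)^-1).
pose r e K : {poly R} := (c e K)%:P * normal_jump e.
pose f e K : {poly R} := ('X - 'X ^+ 2) * r e K.
pose g e K : {poly R} := (- (2 * obliquity e K))%:P * (f e K)^`().
have sJ e : e \in edges T -> (size (normal_jump e) <= k - 2)%N := size_normal_jump (e := e).
have /choice[U UP] : forall p : {set 'I_(nvert T)} * {set 'I_(nvert T)}, exists u,
    cell_edge p.1 p.2 -> one_edge k u (f p.1 p.2) (g p.1 p.2) /\
     sqn u <= C * (1 + (2 * obliquity p.1 p.2) ^+ 2) *
       I1 (('X - 'X ^+ 2) * r p.1 p.2 * r p.1 p.2).
  move=> [e K]; have [eK|_] := boolP (cell_edge e K); last by exists (tf0 R).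
  have [|u [u1 u2]] := ref (r e K) (- (2 * obliquity e K)).
    by rewrite /r mul_polyC; apply: leq_trans (size_scale_leq _ _) _; exact: sJ (cell_edge_edges eK).
  by exists u => _; split=> //; move: u2; rewrite sqrrN.
pose u e K := U (e, K).
have w0 (p : {poly R}) : 0 <= I1 (('X - 'X ^+ 2) * p * p).
  apply: I1_ge0 => t /andP[t0 t1]; rewrite -mulrA hornerM mulr_ge0 //.
    by rewrite !hornerE; nra.
  by rewrite hornerM -expr2 sqr_ge0.
have C'0 : 0 < C'.
  by rewrite C'E !mulr_gt0 // ltr_pwDl // mulr_ge0 // sqr_ge0.
apply: (step (u := u) (f := f) (g := g)) => //.
- by move=> e K eK; have [] := UP (e, K) eK.
- move=> e K K' s eK eK'.
  have [h0 [a0 _] _ _ _] := cell_edge_numbers eK kp (sh eK).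
  have [_ [a0' _] _ _ _] := cell_edge_numbers eK' kp (sh eK').
  have fz e' L : height e' L * (2^-1 * (g e' L).[s] + obliquity e' L * ((f e' L)^`()).[s]) = 0.
    by rewrite /g hornerM hornerC; move: (_^`()).[s] => x; field.
  split; last by rewrite !fz.
  rewrite /f /r /c !(hornerM (_ - _)) !(hornerM _%:P) !hornerC.
  move: (normal_jump e).[s] ('X - 'X^2).[s] => x y; move: (edge_length e) h0 => h h0.
  by field; rewrite a0 a0' gt_eqF.
(* Here D^3 c^2 = h^2 / D <= kappa, and 1 + 4 obliquity^2 <= 3 + 8 kappa^2; at most two cells give
   [C']. *)
- rewrite /fields_energy sum_edges mulr_sumr; apply: ler_sum => e eT.
  have e2 : #|e| == 2%N by move: eT; rewrite inE => /andP[].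
  have W := w0 (normal_jump e).
  apply: (@le_trans _ _ (\sum_(K in cells T | e \subset K)
     (C * (3 + 8 * kappa ^+ 2) * kappa) * I1 (('X - 'X ^+ 2) * normal_jump e * normal_jump e))); last first.
    apply: (le_trans (edge_cells_le2 eT _)).
      by rewrite mulr_ge0 // mulr_ge0 ?(ltW kp) // mulr_ge0 ?(ltW C0) // addr_ge0 // mulr_ge0 // sqr_ge0.
    by rewrite le_eqVlt; apply/orP; left; apply/eqP; rewrite C'E; ring.
  apply: ler_sum => K /andP[KT eK]; have eKv : cell_edge e K by apply/and3P.
  have [_ s] := UP (e, K) eKv; have [h0 [a0 DE] Dh hD ob] := cell_edge_numbers eKv kp (sh eKv).
  have D0 := cell_edge_fdet eKv; rewrite /u.
  apply: (le_trans (ler_wpM2l _ s)); first by rewrite exprn_ge0.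
  rewrite /= /r.
  have -> (b : R) (p : {poly R}) : I1 (('X - 'X ^+ 2) * (b%:P * p) * (b%:P * p)) =
      b ^+ 2 * I1 (('X - 'X ^+ 2) * p * p).
    by rewrite -I1Z; congr I1; rewrite polyC_exp; ring.
  rewrite /c; move: (I1 _) W => J W.
  move: (edge_length e) (height e K) (obliquity e K) h0 a0 DE Dh hD ob D0 => h a b h0 a0.
  set D := `|fdet _| => DE Dh hD ob D0.
  have aE : a ^+ 2 = (D / h) ^+ 2.
    by rewrite DE [h * _]mulrC mulfK ?gt_eqF // real_normK ?num_real.
  have -> : D ^+ 3 * (C * (1 + (2 * b) ^+ 2) * ((a ^- 2 * h^-1) ^+ 2 * J)) =
      C * J * ((1 + 4 * b ^+ 2) * (h ^+ 2 / D)).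
    by rewrite aE; field; rewrite !gt_eqF.
  have -> : C * (3 + 8 * kappa ^+ 2) * kappa * J = C * J * ((3 + 8 * kappa ^+ 2) * kappa) by ring.
  apply: ler_wpM2l; first by rewrite mulr_ge0 // ltW.
  have b0 : 0 <= 1 + 4 * b ^+ 2 by rewrite addr_ge0 // mulr_ge0 // sqr_ge0.
  apply: ler_pM => //; first by rewrite divr_ge0 // ?sqr_ge0 // ltW.
    by lra.
  by rewrite ler_pdivrMr.
rewrite (form_assembled u vE) /cross_energy.
rewrite (eq_bigr (fun K => \sum_(e | cell_edge e K) (`|fdet (tri_frame e K)| * pairing (u e K) (V e K) +
   I1 (('X - 'X ^+ 2) * normal_jump e *
     ((side e K)%:P * normal_trace (tri_frame e K) (edge_normal e) (V e K)))))); last first.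
  move=> K _; apply: eq_bigr => e eK; have [b _] := UP (e, K) eK.
  have [h0 [a0 DE] _ _ _] := cell_edge_numbers eK kp (sh eK).
  rewrite (green_normal _ a0 b) mulrDr; apply: (congr1 (fun z => _ + z)).
  rewrite -/(height e K) DE normrEsg -/(side e K).
  set nt := normal_trace _ _ _.
  have E1 : I1 (('X - 'X ^+ 2) * r e K * nt) = c e K * I1 (('X - 'X ^+ 2) * normal_jump e * nt).
    by rewrite -I1Z /r; congr I1; ring.
  have E2 : I1 (('X - 'X ^+ 2) * normal_jump e * ((side e K)%:P * nt)) =
      side e K * I1 (('X - 'X ^+ 2) * normal_jump e * nt) by rewrite -I1Z; congr I1; ring.
  rewrite E1 E2 /c.
  move: (I1 _) (side e K) (height e K) (edge_length e) a0 h0 => J s a h a0 h0.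
  by field; rewrite a0 gt_eqF.
under eq_bigr do rewrite big_split /=; rewrite big_split /=; apply: (congr1 (fun z => _ + z)).
rewrite sum_edges; apply: eq_bigr => e eT.
by rewrite -I1_sum -mulr_sumr.
Qed.

End steps.

Lemma ref_shear_L2 (R : realType) k : (3 <= k)%N ->
  exists2 C : R, 0 < C & forall J : {poly R}, (size J <= k - 1)%N ->
  exists u, one_edge k u 0 J /\ sqn u <= C * I1 (J * J).
Proof.
move=> k3; have [C0 C0p H] := ref_shear R k3.
have [|C1 C1p H1] := @coef_bound R (k - 1) 1 (oner_neq0 _).
  by move=> t _; rewrite hornerC ler01.
exists (C0 * C1); first by rewrite mulr_gt0.
move=> J sJ; have [u [u1 u2]] := H J sJ; exists u; split=> //.
apply: (le_trans u2); rewrite -mulrA ler_wpM2l ?(ltW C0p) //.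
by have := H1 J sJ; rewrite mul1r.
Qed.

Lemma edge_weight (R : realType) :
  ('X - 'X ^+ 2 : {poly R}) != 0 /\ forall t : R, 0 <= t <= 1 -> 0 <= ('X - 'X ^+ 2).[t].
Proof.
split; last by move=> t /andP[t0 t1]; rewrite !hornerE; nra.
apply/eqP => /(congr1 (fun p : {poly R} => p`_1)); rewrite coefB coefX coefXn coef0 subr0.
by move/eqP; rewrite oner_eq0.
Qed.

(** The normal family controls the jump only with the weight x (1 - x); on polynomials of bounded
    degree the unweighted norm is recovered from it. *)
Lemma ref_normal_L2 (R : realType) k : (3 <= k)%N ->
  exists2 C : R, 0 < C & (forall (r : {poly R}) (c : R), (size r <= k - 2)%N ->
    exists u, one_edge k u (('X - 'X ^+ 2) * r) (c%:P * (('X - 'X ^+ 2) * r)^`()) /\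
      sqn u <= C * (1 + c ^+ 2) * I1 (('X - 'X ^+ 2) * r * r)) /\
    (forall r : {poly R}, (size r <= k - 2)%N -> I1 (r * r) <= C * I1 (('X - 'X ^+ 2) * r * r)).
Proof.
move=> k3; have [C0 C0p H] := ref_normal R k3; have [wn w0] := edge_weight R.
have [C1 C1p H1] := @coef_bound R (k - 2) _ wn w0.
pose B : R := \sum_(a < k - 2) I1 ('X^a * 'X^a).
have B0 : 0 <= B by apply: sumr_ge0 => a _; exact: I1_sqr_ge0.
have W0 (r : {poly R}) : 0 <= I1 (('X - 'X ^+ 2) * r * r).
  by apply: I1_ge0 => t t01; rewrite -mulrA hornerM mulr_ge0 ?w0 // hornerM -expr2 sqr_ge0.
have p0 := mulr_ge0 (ltW C1p) B0; have p1 := mulr_gt0 C0p C1p.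
exists (C0 * C1 + C1 * B); first by lra.
split=> [r c sr|r sr].
  have [u [u1 u2]] := H r c sr; exists u; split=> //; apply: (le_trans u2).
  have c0 : 0 <= 1 + c ^+ 2 by rewrite addr_ge0 // sqr_ge0.
  apply: (@le_trans _ _ (C0 * (1 + c ^+ 2) * (C1 * I1 (('X - 'X ^+ 2) * r * r)))).
    by apply: ler_wpM2l (H1 r sr); rewrite mulr_ge0 // ltW.
  rewrite (_ : C0 * _ * _ = C0 * C1 * ((1 + c ^+ 2) * I1 (('X - 'X ^+ 2) * r * r))); last by ring.
  by rewrite -[leRHS]mulrA ler_wpM2r ?lerDl // (mulr_ge0 c0 (W0 r)).
rewrite {1 2}(size_comb sr); apply: (le_trans (I1_comb_le _ _)); rewrite -/B.
apply: (le_trans (ler_wpM2r B0 (H1 r sr))).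
rewrite mulrAC ler_wpM2r // lerDr; exact: ltW.
Qed.

(** * The broken seminorm and the final estimate *)

Lemma sum22 (R : realType) (G : 'I_2 -> 'I_2 -> R) :
  \sum_i \sum_j G i j = G 0 0 + G 0 1 + (G 1 0 + G 1 1).
Proof.
rewrite !big_ord_recl !big_ord0 !addr0 (_ : lift _ _ = 1) //; exact: val_inj.
Qed.

(** The second derivatives along the three edges determine the Hessian: two are pure derivatives X
    and Z in barycentric coordinates, the third X - 2 Y + Z gives the mixed one Y. The chain rule
    costs two gradients, each bounded through [frame_size F / fdet F ^+ 2]. *)
Lemma hess_pointwise (R : realType) (F : frame R) (V : bpoly R) x : fdet F != 0 ->
  \sum_i \sum_j (pd i (pd j (plift F V)) x) ^+ 2 <=
  6 * (frame_size F / fdet F ^+ 2) ^+ 2 *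
  plift F (d1 (d1 V) * d1 (d1 V) + d2 (d2 V) * d2 (d2 V) + d3 (d3 V) * d3 (d3 V)) x.
Proof.
move=> F0.
have E i j : pd i (pd j (plift F V)) x =
   dotp (grad2 F) (basis_vec R i) * dotp (grad2 F) (basis_vec R j) * plift F (dpx (dpx V)) x +
   (dotp (grad2 F) (basis_vec R i) * dotp (grad3 F) (basis_vec R j) +
    dotp (grad3 F) (basis_vec R i) * dotp (grad2 F) (basis_vec R j)) * plift F (dpx (dpy V)) x +
   dotp (grad3 F) (basis_vec R i) * dotp (grad3 F) (basis_vec R j) * plift F (dpy (dpy V)) x.
  have pdE m P : pd m (plift F P) = plift F ((dotp (grad2 F) (basis_vec R m))%:P%:P * dpx P +
      (dotp (grad3 F) (basis_vec R m))%:P%:P * dpy P) by exact: D_lift.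
  rewrite !pdE /plift !(dpxD, dpyD, dpxZ, dpyZ) -(dpxyC V).
  move: (dpx (dpx V)) (dpx (dpy V)) (dpy (dpy V)) (bary F x) => A B C z.
  by rewrite !(evE z); ring.
have G : dotp (grad2 F) (grad2 F) + dotp (grad3 F) (grad3 F) <= frame_size F / fdet F ^+ 2.
  have -> : dotp (grad2 F) (grad2 F) + dotp (grad3 F) (grad3 F) =
     (dotp (te2 F) (te2 F) + dotp (te3 F) (te3 F)) / fdet F ^+ 2.
    by rewrite /dotp /grad2 /grad3 /=; field.
  apply: ler_wpM2r; first by rewrite invr_ge0 sqr_ge0.
  rewrite /frame_size; have := dotp_ge0 (te1 F).
  by move: (dotp (te1 F) _) (dotp (te2 F) _) (dotp (te3 F) _) => *; lra.
have -> : plift F (d1 (d1 V) * d1 (d1 V) + d2 (d2 V) * d2 (d2 V) + d3 (d3 V) * d3 (d3 V)) x =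
    (plift F (dpx (dpx V)) x - 2 * plift F (dpx (dpy V)) x + plift F (dpy (dpy V)) x) ^+ 2 +
    plift F (dpy (dpy V)) x ^+ 2 + plift F (dpx (dpx V)) x ^+ 2.
  rewrite /plift /d1 /d2 /d3 !(dpxD, dpyD, dpxN, dpyN) -(dpxyC V).
  move: (dpx (dpx V)) (dpx (dpy V)) (dpy (dpy V)) (bary F x) => A B C z.
  by rewrite !(evE z); ring.
rewrite sum22 !E {E}.
move: (plift F (dpx (dpx V)) x) (plift F (dpx (dpy V)) x) (plift F (dpy (dpy V)) x) => X Y Z.
have [bv0 bv1] : basis_vec R 0 = (1, 0) /\ basis_vec R 1 = (0, 1) by [].
rewrite bv0 bv1; move: G; move: (frame_size F / _) (grad2 F) (grad3 F) => g [a1 a2] [c1 c2].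
rewrite /dotp /= !mulr1 !mulr0 !addr0 !add0r => G.
have GG : (a1 * a1 + a2 * a2 + (c1 * c1 + c2 * c2)) ^+ 2 <= g ^+ 2.
  by rewrite ler_sqr ?nnegrE // ?(le_trans _ G) // !addr_ge0 // -expr2 sqr_ge0.
set N := (X - 2 * Y + Z) ^+ 2 + Z ^+ 2 + X ^+ 2.
have N0 : 0 <= N by rewrite !addr_ge0 // sqr_ge0.
have sq3 (p q r : R) : (p + q + r) ^+ 2 <= 3 * (p ^+ 2 + q ^+ 2 + r ^+ 2).
  rewrite -subr_ge0 (_ : _ - _ = (p - q) ^+ 2 + (p - r) ^+ 2 + (q - r) ^+ 2); last by ring.
  by rewrite !addr_ge0 // sqr_ge0.
have YN : Y ^+ 2 <= 3 / 4 * N by have := sq3 X Z (- (X - 2 * Y + Z)); rewrite /N; lra.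
have ZX : X ^+ 2 + Z ^+ 2 <= N by rewrite /N -addrA addrC [Z ^+ 2 + _]addrC lerDl sqr_ge0.
set A := a1 * a1 + a2 * a2; set B := c1 * c1 + c2 * c2.
have A0 : 0 <= A by rewrite addr_ge0 // -expr2 sqr_ge0.
have B0 : 0 <= B by rewrite addr_ge0 // -expr2 sqr_ge0.
apply: (@le_trans _ _ (3 * (A ^+ 2 * X ^+ 2 + 4 * (A * B) * Y ^+ 2 + B ^+ 2 * Z ^+ 2))).
  have h := sq3; have x00 := h (a1 * a1 * X) ((a1 * c1 + c1 * a1) * Y) (c1 * c1 * Z).
  have x01 := h (a1 * a2 * X) ((a1 * c2 + c1 * a2) * Y) (c1 * c2 * Z).
  have x10 := h (a2 * a1 * X) ((a2 * c1 + c2 * a1) * Y) (c2 * c1 * Z).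
  have x11 := h (a2 * a2 * X) ((a2 * c2 + c2 * a2) * Y) (c2 * c2 * Z).
  have := lerD (lerD x00 x01) (lerD x10 x11); move/le_trans; apply.
  rewrite -subr_ge0 (_ : _ - _ = 6 * ((a1 * c2 - a2 * c1) ^+ 2 * Y ^+ 2)).
    by apply: mulr_ge0 => //; apply: mulr_ge0; exact: sqr_ge0.
  by rewrite /A /B; ring.
apply: (@le_trans _ _ (6 * (A + B) ^+ 2 * N)); last first.
  by apply: ler_wpM2r => //; apply: ler_wpM2l.
have AA : 0 <= B * (2 * A + B) * X ^+ 2 by rewrite mulr_ge0 ?sqr_ge0 // mulr_ge0 // addr_ge0 // mulr_ge0.
have BB : 0 <= A * (2 * B + A) * Z ^+ 2 by rewrite mulr_ge0 ?sqr_ge0 // mulr_ge0 // addr_ge0 // mulr_ge0.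
have YY : 0 <= (A - B) ^+ 2 * Y ^+ 2 by apply: mulr_ge0; exact: sqr_ge0.
have S0 : 0 <= (A + B) ^+ 2 by exact: sqr_ge0.
have h1 := ler_wpM2l S0 YN; have h2 := ler_wpM2l S0 ZX.
have SN : 0 <= (A + B) ^+ 2 * N by rewrite mulr_ge0.
clearbody N; nra.
Qed.

(** Passing to the edge parameter costs one factor h, which turns the weights h^-3 and h^-1 of the
    jumps into h^-2 and 1. *)
Lemma seminorm_le (R : realType) (Omega : set (R * R)) (T : triangulation Omega) (k : nat)
    (kappa C B : R) (v : broken T R) (V : {set 'I_(nvert T)} -> {set 'I_(nvert T)} -> bpoly R) :
  (3 <= k)%N -> 0 < kappa ->
  (forall e K, @cell_edge _ _ T e K -> frame_size (tri_frame e K) <= kappa * `|fdet (tri_frame e K)|) ->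
  (forall e K, @cell_edge _ _ T e K -> bdeg (k - 2) (V e K)) ->
  (forall e K, @cell_edge _ _ T e K -> v K = plift (tri_frame e K) (V e K)) ->
  (forall r : {poly R}, (size r <= k - 2)%N -> I1 (r * r) <= C * I1 (('X - 'X ^+ 2) * r * r)) ->
  6 * kappa ^+ 2 * hess_energy V +
    \sum_(e in edges T) edge_length e ^- 2 * I1 (edge_jump V e * edge_jump V e) +
    C * \sum_(e in edges T) I1 (('X - 'X ^+ 2) * normal_jump V e * normal_jump V e) <= B ^+ 2 ->
  0 <= B -> seminorm2h v <= B.
Proof.
move=> k3 kp sh Vd vE trC BE B0.
rewrite -(ger0_norm B0) -sqrtr_sqr; apply: ler_wsqrtr; apply: le_trans BE.
have tE e K t : cell_edge e K -> v K (edge_pt e t) = (tr1 (V e K)).[t].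
  move=> eKv; have /and3P[KT eK /eqP e2] := eKv; rewrite (vE e K eKv).
  by have [h _ _] := plift_tr (tri_frame e K) (V e K) (edge_pt e t) t; exact: h (bary_edge KT eK e2 t).
have nE e K t : cell_edge e K -> 'D_(edge_normal e) (v K) (edge_pt e t) =
    (normal_trace (tri_frame e K) (edge_normal e) (V e K)).[t].
  move=> eKv; have /and3P[KT eK /eqP e2] := eKv; rewrite (vE e K eKv).
  exact: (normal_traceE (x := edge_pt e t) _ (tri_frame_fdet KT eK e2) (edge_normal_dotp KT eK e2)
    (edge_normal_te1 KT eK e2) (bary_edge KT eK e2 t)).
rewrite -addrA; apply: lerD.
  rewrite mulr_sumr; apply: ler_sum => K KT; have [e eKv] := ex_cell_edge KT.
  have /and3P[_ eK /eqP e2] := eKv; have F0 := tri_frame_fdet KT eK e2.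
  have D0 := cell_edge_fdet eKv.
  apply: (@le_trans _ _ (6 * kappa ^+ 2 * (`|fdet (tri_frame e K)|^-1 * hess (V e K)))); last first.
    apply: ler_wpM2l; first by rewrite mulr_ge0 // sqr_ge0.
    rewrite (bigD1 e) //= lerDl; apply: sumr_ge0 => e' _.
    by rewrite mulr_ge0 ?hess_ge0 // invr_ge0.
  pose c := 6 * (frame_size (tri_frame e K) / fdet (tri_frame e K) ^+ 2) ^+ 2.
  pose P := d1 (d1 (V e K)) * d1 (d1 (V e K)) + d2 (d2 (V e K)) * d2 (d2 (V e K)) +
    d3 (d3 (V e K)) * d3 (d3 (V e K)).
  apply: (@le_trans _ _ (cell_int K (plift (tri_frame e K) (c%:P%:P * P)))).
    apply: cell_int_le => //; last first.
      by move=> x; rewrite plift_scale (vE e K eKv); exact: hess_pointwise.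
      exact: polyf_lift.
    apply: polyf_sum => i _; apply: polyf_sum => j _.
    have pij : polyf (pd i (pd j (v K))).
      by rewrite (vE e K eKv); apply: polyf_D; apply: polyf_D; exact: polyf_lift.
    under eq_fun do rewrite expr2; exact: (polyfM pij pij).
  rewrite cell_int_plift // I2Z (_ : I2 P = hess (V e K)); last by rewrite /P /hess !I2D.
  rewrite [leRHS]mulrA mulrA; apply: ler_wpM2r; first exact: hess_ge0.
  rewrite /c; have := sh e K eKv; have f0 : 0 <= frame_size (tri_frame e K) :=
    addr_ge0 (addr_ge0 (dotp_ge0 _) (dotp_ge0 _)) (dotp_ge0 _).
  rewrite -[fdet _ ^+ 2]real_normK ?num_real //.
  move: (frame_size _) f0 => fs f0; move: D0; set D := `|fdet _| => D0 fsD.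
  have -> : D * (6 * (fs / D ^+ 2) ^+ 2) = 6 * fs ^+ 2 * D ^- 3 by field; rewrite gt_eqF.
  have -> : 6 * kappa ^+ 2 * D^-1 = 6 * (kappa * D) ^+ 2 * D ^- 3 by field; rewrite gt_eqF.
  apply: ler_wpM2r; first by rewrite invr_ge0 exprn_ge0 // ltW.
  by rewrite ler_pM2l // ler_pXn2r ?nnegrE // (le_trans f0).
rewrite mulr_sumr -big_split /=; apply: ler_sum => e eT.
have e2 : #|e| == 2%N by move: eT; rewrite inE => /andP[].
have [K0 KT0 eK0] : exists2 K, K \in cells T & e \subset K.
  by move: eT; rewrite inE => /andP[_ /existsP[K /andP[]]]; exists K.
have [h0 _] := edge_length_height KT0 eK0 (eqP e2).
apply: lerD.
  rewrite (@edge_intE _ _ _ e _ (edge_jump V e * edge_jump V e)); last first.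
    move=> t; rewrite jump_sqr // hornerM -expr2; congr (_ ^+ 2).
    rewrite /edge_jump horner_sum; apply: eq_bigr => K /andP[KT eK].
    by rewrite hornerM hornerC tE //; apply/and3P.
  by rewrite le_eqVlt; apply/orP; left; apply/eqP; field; rewrite gt_eqF.
rewrite (@edge_intE _ _ _ e _ (normal_jump V e * normal_jump V e)); last first.
  move=> t; rewrite jump_sqr // hornerM -expr2; congr (_ ^+ 2).
  rewrite /normal_jump horner_sum; apply: eq_bigr => K /andP[KT eK].
  by rewrite hornerM hornerC nE //; apply/and3P.
rewrite mulKf ?gt_eqF //; apply: trC.
exact: (size_normal_jump k3 Vd).
Qed.

Theorem lemma4p2 (R : realType) (Omega : set (R * R)) (I : Type)
    (Th : I -> triangulation Omega) (k l : nat) :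
  bounded_polygon Omega -> shape_regular Th ->
  (3 <= k)%N -> (k - 1 <= l)%N ->
  exists2 C : R, 0 < C &
    forall (i : I) (v : broken (Th i) R), Q_h k v ->
      ((seminorm2h v)%:E <=
       C%:E * ereal_sup [set (divdiv_form tau v / L2norm tau)%:E |
                          tau in [set tau | Sigma_h l k tau /\ nonzero tau]])%E.
Proof.
move=> [[x0 Ox0] _ _ _ _] sr k3 kl.
have [kappa kp shape_le] := shape_regular_frame sr.
have [C1 C1p bub] := ref_bubble R k3; have [C2 C2p she] := ref_shear_L2 R k3.
have [C3 C3p [nor trC]] := ref_normal_L2 R k3.
pose A := 32 * kappa ^+ 2 * C1 ^+ 2.
pose C2' := 8 * C2 * kappa; pose C3' := 2 * C3 * (3 + 8 * kappa ^+ 2) * kappa.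
pose W := 6 * kappa ^+ 2 * A + (32 * kappa ^+ 2 * C2' + 2 * C2' * A) +
  C3 * (32 * kappa ^+ 2 * C3' + 2 * C3' * A).
have k2 : 0 < kappa ^+ 2 by rewrite exprn_gt0.
have A0 : 0 < A by rewrite /A !mulr_gt0 // exprn_gt0.
have C2'0 : 0 < C2' by rewrite /C2' !mulr_gt0.
have C3'0 : 0 < C3' by rewrite /C3' !mulr_gt0 // addr_gt0 // mulr_gt0.
have pos c : 0 < c -> 0 < 32 * kappa ^+ 2 * c + 2 * c * A.
  by move=> c0; rewrite addr_gt0 // !mulr_gt0.
have W0 : 0 < W.
  apply: addr_gt0; first by apply: addr_gt0 (pos _ C2'0); rewrite !mulr_gt0.
  exact: mulr_gt0 C3p (pos _ C3'0).
exists (1 + W); first by rewrite addr_gt0.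
move=> i v Qv; set T := Th i in v Qv *; set s := ereal_sup _.
have [K0 KT0] : exists K0, K0 \in cells T.
  have : closure Omega x0 by exact: subset_closure.
  by rewrite -(cells_cover T) => -[K0 KT0 _]; exists K0.
(* Excludes the value -oo and gives S >= 0, so that (1 + W) S is a legitimate bound for a square
   root. *)
have s0 : (0 <= s)%E.
  apply: ereal_sup_ubound; exists (fun _ _ => mx2 1 0 1).
    by split; [exact: identity_Sigma|exact: identity_nonzero KT0].
  by rewrite identity_form mul0r.
have sub tau : Sigma_h l k tau -> nonzero tau -> ((divdiv_form tau v / L2norm tau)%:E <= s)%E.
  by move=> st nz; apply: ereal_sup_ubound; exists tau.
move: s s0 sub => [S||] // s0 sub; last by rewrite gt0_muley ?leey // lte_fin addr_gt0.
rewrite -EFinM lee_fin; rewrite lee_fin in s0.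
have fS (tau : broken T 'M[R]_2) : Sigma_h l k tau -> (forall K, mpolyf (tau K)) ->
    divdiv_form tau v <= S * L2norm tau.
  by apply: form_le => t st nz; have := sub t st nz; rewrite lee_fin.
have sh e K : @cell_edge _ _ T e K -> frame_size (tri_frame e K) <= kappa * `|fdet (tri_frame e K)|.
  by move=> /and3P[KT eK /eqP e2]; exact: shape_le.
(* On each triangle v is expressed in the frame of each of its edges. *)
have /choice[V0 V0P] : forall p : {set 'I_(nvert T)} * {set 'I_(nvert T)}, exists P : bpoly R,
    cell_edge p.1 p.2 -> bdeg (k - 2) P /\ v p.2 = plift (tri_frame p.1 p.2) P.
  move=> [e K]; have [/and3P[KT eK /eqP e2]|_] := boolP (cell_edge e K); last by exists 0.
  by have [P dP PE] := Poly_le_liftP (tri_frame_fdet KT eK e2) (Qv K KT); exists P.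
pose V e K := V0 (e, K).
have Vd e K : @cell_edge _ _ T e K -> bdeg (k - 2) (V e K) by move=> eK; have [] := V0P (e, K) eK.
have vE e K : @cell_edge _ _ T e K -> v K = plift (tri_frame e K) (V e K).
  by move=> eK; have [] := V0P (e, K) eK.
have hb := bubble_step k3 kl kp sh Vd vE fS C1p bub.
have hs := shear_step k3 kl kp sh Vd vE fS C2p she.
have hn := normal_step k3 kl kp sh Vd vE fS C3p (erefl C3') nor.
apply: (seminorm_le k3 kp sh Vd vE trC); last by rewrite mulr_ge0 // addr_ge0 // ltW.
rewrite -/C2' -/A in hb hs hn *.
move: (hess_energy V) hb hs hn => H hb hs hn.
set X := (\sum_(e in _) _ * _) in hs *; set Y := (\sum_(e in _) _) in hn *.
(* The Hessian energy in the two edge estimates is replaced by its bound A S^2 from the bubbles. *)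
have bd c Z : 0 < c -> Z <= 32 * kappa ^+ 2 * c * S ^+ 2 + 2 * c * H ->
    Z <= (32 * kappa ^+ 2 * c + 2 * c * A) * S ^+ 2.
  move=> c0 ZE; have h : 2 * c * H <= 2 * c * (A * S ^+ 2) by rewrite ler_pM2l // mulr_gt0.
  apply: (le_trans ZE); rewrite (_ : (_ + _) * _ = 32 * kappa ^+ 2 * c * S ^+ 2 + 2 * c * (A * S ^+ 2)).
    by rewrite lerD2l.
  by ring.
have hX := bd _ _ C2'0 hs; have hY := bd _ _ C3'0 hn.
have kH : 6 * kappa ^+ 2 * H <= 6 * kappa ^+ 2 * (A * S ^+ 2) by rewrite ler_pM2l // mulr_gt0.
have cY : C3 * Y <= C3 * ((32 * kappa ^+ 2 * C3' + 2 * C3' * A) * S ^+ 2) by rewrite ler_pM2l.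
apply: (@le_trans _ _ (W * S ^+ 2)).
  apply: (le_trans (lerD (lerD kH hX) cY)).
  by rewrite le_eqVlt; apply/orP; left; apply/eqP; rewrite /W; ring.
(* W <= (1 + W)^2 avoids the square root of W in the constant. *)
rewrite exprMn; apply: ler_wpM2r; first exact: sqr_ge0.
by clearbody W; nra.
Qed.
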